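(* Let $0<s<\frac12$, let $\Gamma\subset\mathbb R^n\setminus\{0\}$ be an open, non-empty, convex cone, and assume that $A^s_{0,\Gamma}(D)$ is $\Gamma$-antilocal. Let $\Omega\subset\mathbb R^n$ be bounded, open, Lipschitz and let $q\in L^\infty(\Omega)$ be real-valued and such that $0\notin\tilde\Sigma^s_{0,\Gamma;q}$. Assume that there is an open, non-empty set $W\subset(\Omega+\Gamma)\setminus\overline\Omega$ such that, if $\Omega_1:=\Omega\cap(W-\Gamma)$ and $\Omega_2:=\Omega\setminus\overline{\Omega}_1$, then $\Omega_2\ne\emptyset$ and zero is not a Dirichlet eigenvalue for $A^s_{0,\Gamma}(D)+q$ in $\Omega_2$. Then there exist an open, non-empty set $U\subset\Omega$ and a non-trivial $u\in H^s(\Gamma+\Omega)$ such that (weakly) $$(A^s_{0,\Gamma}(D)+q)u=0\quad\text{in }\Omega,$$ and $u=0$ in $U$.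
   Context: A cone is a set closed under multiplication by $t>0$. For $0<s<\frac12$, $$A^s_{0,\Gamma}(D)f(x)=\int_{\Gamma}\frac{f(x)-f(x+y)}{|y|^{n+2s}}\,dy .$$ $A^s_{0,\Gamma}(D)$ is $\Gamma$-antilocal if, whenever $f\in C_c^\infty(\mathbb R^n)$ and $f=A^s_{0,\Gamma}(D)f=0$ in an open non-empty set $V$, then $f=0$ in $V+\Gamma$. Sobolev spaces: for open $V$, $H^s(V)$ is the space of restrictions to $V$ of elements of $H^s(\mathbb R^n)$; $\widetilde H^s(V)$ is the closure of $C_c^\infty(V)$ in $H^s(\mathbb R^n)$; $H^{-s}(V)=(\widetilde H^s(V))^*$. Bilinear form on $H^s(\mathbb R^n)$: $$\tilde B(u,v)=\frac{1}{2-2^{2s}}\int_{\mathbb R^n}\int_{\Gamma}\big(u(x)-u(x+y)\big)\big(v(x)-v(x-y)\big)\frac{dy\,dx}{|y|^{n+2s}}+\int_\Omega quv\,dx .$$ The equation in $\Omega$ for $u\in H^s(\Omega+\Gamma)$ means $\tilde B(\tilde u,v)=0$ for all $v\in\widetilde H^s(\Omega)$ and any $\tilde u\in H^s(\mathbb R^n)$ with $\tilde u|_{\Omega+\Gamma}=u$ (independent of the extension). The condition $0\notin\tilde\Sigma^s_{0,\Gamma;q}$ means that for every $g\in H^{-s}(\Omega)$ there is a unique $w\in\widetilde H^s(\Omega)$ with $\tilde B(w,v)=\langle g,v\rangle$ for all $v\in\widetilde H^s(\Omega)$. Zero is not a Dirichlet eigenvalue in $\Omega_2$ if the only $w\in\widetilde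 H^s(\Omega_2)$ with $\tilde B(w,v)=0$ for all $v\in\widetilde H^s(\Omega_2)$ is $w=0$. *)

(* Defs.v *)
(* Mathematical Components with MathComp-Analysis. *)
From HB Require Import structures.
From mathcomp Require Import all_boot all_order all_algebra.
From mathcomp Require Import all_classical all_reals all_analysis.

Set Implicit Arguments.
Unset Strict Implicit.
Unset Printing Implicit Defensive.

Import Order.TTheory GRing.Theory Num.Theory.
Import numFieldNormedType.Exports.

Local Open Scope classical_set_scope.
Local Open Scope ring_scope.

(* The sigma-algebra on R^n = 'rV[R]_n generated by the coordinate functions,
   i.e. the Borel sigma-algebra. *)
Section measurable_rV.
Context {R : realType} (n : nat).

Let coord (i : 'I_n) (x : 'rV[R]_n) : measurableTypeR R := x ord0 i.

Let rV_set0 : g_sigma_preimage coord set0.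
Proof. exact: sigma_algebra0. Qed.

Let rV_setC A : g_sigma_preimage coord A -> g_sigma_preimage coord (~` A).
Proof. exact: sigma_algebraC. Qed.

Let rV_bigcup (F : (set 'rV[R]_n)^nat) :
  (forall i, g_sigma_preimage coord (F i)) ->
  g_sigma_preimage coord (\bigcup_i F i).
Proof. exact: sigma_algebra_bigcup. Qed.

HB.instance Definition _ := @isMeasurable.Build default_measure_display
  'rV[R]_n (g_sigma_preimage coord) rV_set0 rV_setC rV_bigcup.

Lemma measurable_coord (i : 'I_n) :
  measurable_fun setT (fun x : 'rV[R]_n => x ord0 i : measurableTypeR R).
Proof.
move=> _ Y mY; rewrite setTI; apply: sub_sigma_algebra => /=.
rewrite -bigcup_seq/=; exists i => /=; first by rewrite mem_index_enum.
by exists Y => //; rewrite setTI.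
Qed.

Lemma measurable_fun_rVP d (T : measurableType d) (f : T -> 'rV[R]_n) :
  (forall i, measurable_fun setT (fun t => f t ord0 i : measurableTypeR R)) ->
  measurable_fun setT f.
Proof.
move=> mf _ A mA; rewrite setTI; move: A mA.
suff : g_sigma_preimage coord `<=` [set A | measurable (f @^-1` A)] by [].
apply: smallest_sub => [|A].
- split => /=.
  + by rewrite preimage_set0.
  + by move=> A mA; rewrite setTD preimage_setC; exact: measurableC.
  + by move=> F mF; rewrite preimage_bigcup; exact: bigcupT_measurable.
rewrite -bigcup_seq => -[i _ [B mB <-]] /=; rewrite setTI.
by have := mf i measurableT _ mB; rewrite setTI.
Qed.

End measurable_rV.

Lemma sigma_finite_product d1 d2 (T1 : measurableType d1)
    (T2 : measurableType d2) (R : realType)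
    (m1 : {sigma_finite_measure set T1 -> \bar R})
    (m2 : {sigma_finite_measure set T2 -> \bar R}) :
  sigma_finite setT (m1 \x m2)%E.
Proof.
have /sigma_finiteP[F [TF ndF Foo]] := sigma_finiteT m1.
have /sigma_finiteP[G [TG ndG Goo]] := sigma_finiteT m2.
exists (fun n => F n `*` G n).
  rewrite -setXTT TF TG predeqE => -[x y]; split.
    move=> [/= [n _ Fnx] [k _ Gky]]; exists (maxn n k) => //; split.
    - by move: x Fnx; exact/subsetPset/ndF/leq_maxl.
    - by move: y Gky; exact/subsetPset/ndG/leq_maxr.
  by move=> [n _ []/= ? ?]; split; exists n.
move=> k; have [? ?] := Foo k; have [? ?] := Goo k.
split; first exact: measurableX.
by rewrite product_measure1E// lte_mul_pinfty// ge0_fin_numE.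
Qed.

Section lebesgue_rV.
Context {R : realType}.

Definition rV_cons n (p : measurableTypeR R * 'rV[R]_n) : 'rV[R]_n.+1 :=
  row_mx (p.1 : R)%:M p.2.

Definition rV_uncons n (x : 'rV[R]_n.+1) : measurableTypeR R * 'rV[R]_n :=
  (x ord0 ord0, \row_i x ord0 (lift ord0 i)).

Lemma rV_consE0 n p : @rV_cons n p ord0 ord0 = p.1.
Proof.
rewrite /rV_cons (_ : ord0 = lshift n (ord0 : 'I_1)); last exact: val_inj.
by rewrite (row_mxEl (p.1 : R)%:M p.2) mxE eqxx.
Qed.

Lemma rV_consE1 n p i : @rV_cons n p ord0 (lift ord0 i) = p.2 ord0 i.
Proof.
rewrite /rV_cons (_ : lift ord0 i = rshift 1 i); last exact: val_inj.
by rewrite (row_mxEr (p.1 : R)%:M p.2).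
Qed.

Lemma rV_consK n : cancel (@rV_cons n) (@rV_uncons n).
Proof.
move=> p; rewrite /rV_uncons rV_consE0 [RHS]surjective_pairing; congr pair.
by apply/rowP => i; rewrite mxE rV_consE1.
Qed.

Lemma measurable_rV_cons n : measurable_fun setT (@rV_cons n).
Proof.
apply: measurable_fun_rVP => i; have [j ->|->] := unliftP ord0 i.
  rewrite (_ : (fun _ => _) = (fun x : 'rV[R]_n => x ord0 j) \o snd).
    by apply: measurableT_comp => //; exact: measurable_coord.
  by apply/funext => p /=; rewrite rV_consE1.
rewrite (_ : (fun _ => _) = fst) //.
by apply/funext => p; rewrite rV_consE0.
Qed.

Lemma measurable_rV_uncons n : measurable_fun setT (@rV_uncons n).
Proof.
apply/measurable_fun_pair; first exact: measurable_coord.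
apply: measurable_fun_rVP => i.
rewrite (_ : (fun _ => _) = (fun x : 'rV[R]_n.+1 => x ord0 (lift ord0 i))).
  exact: measurable_coord.
by apply/funext => x; rewrite mxE.
Qed.

Section step.
Variables (n : nat) (m : {sigma_finite_measure set 'rV[R]_n -> \bar R}).

Definition lebesgue_rV_step : set 'rV[R]_n.+1 -> \bar R :=
  pushforward (lebesgue_measure \x m)%E (@rV_cons n).

Let mcons : measurable_fun setT (@rV_cons n) := @measurable_rV_cons n.

Let step0 : lebesgue_rV_step set0 = 0%E.
Proof. by have mf := mcons; exact: measure0. Qed.

Let step_ge0 A : (0 <= lebesgue_rV_step A)%E.
Proof. by have mf := mcons; exact: measure_ge0. Qed.

Let step_sigma_additive : semi_sigma_additive lebesgue_rV_step.
Proof. by have mf := mcons; exact: measure_semi_sigma_additive. Qed.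

HB.instance Definition _ := isMeasure.Build _ _ _ lebesgue_rV_step
  step0 step_ge0 step_sigma_additive.

Let step_sigma_finite : sigma_finite setT lebesgue_rV_step.
Proof.
have [F TF mF] := @sigma_finite_product _ _ _ _ R
  [the {sigma_finite_measure set (measurableTypeR R) -> \bar R}
   of @lebesgue_measure R] m.
exists (fun i => @rV_uncons n @^-1` F i).
  by rewrite -preimage_bigcup -TF preimage_setT.
move=> i; have [mFi Fioo] := mF i; split.
  by rewrite -[X in measurable X]setTI; exact: measurable_rV_uncons.
rewrite /lebesgue_rV_step /pushforward -comp_preimage.
rewrite (_ : _ \o _ = id) ?preimage_id//.
by apply/funext => p /=; rewrite rV_consK.
Qed.

HB.instance Definition _ := Measure_isSigmaFinite.Build _ _ _
  lebesgue_rV_step step_sigma_finite.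

End step.

(* Lebesgue measure on R^n: a point mass for n = 0, and the image of
   dx_1 \x dx' under (x_1, x') |-> (x_1, x') for n + 1. *)
Fixpoint lebesgue_rV (n : nat) : {sigma_finite_measure set 'rV[R]_n -> \bar R} :=
  match n with
  | 0 => [the {sigma_finite_measure set 'rV[R]_0 -> \bar R} of \d_(0 : 'rV[R]_0)]
  | n'.+1 => [the {sigma_finite_measure set 'rV[R]_n'.+1 -> \bar R}
              of lebesgue_rV_step (lebesgue_rV n')]
  end.

End lebesgue_rV.

(* The norm `|x| of 'rV[R]_n is the sup norm, so the Euclidean structure is
   introduced separately; both norms give the same topology, bounded sets and
   Lipschitz functions. *)
Definition dotp (R : realType) (n : nat) (x y : 'rV[R]_n) : R :=
  \sum_i x ord0 i * y ord0 i.

Definition enorm (R : realType) (n : nat) (x : 'rV[R]_n) : R :=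
  Num.sqrt (dotp x x).

Section sets.
Context {R : realType} {n : nat}.
Implicit Types A B : set 'rV[R]_n.

Definition cone A := forall (t : R) x, 0 < t -> A x -> A (t *: x).

Definition mink_add A B := [set x + y | x in A & y in B].

Definition mink_sub A B := [set x - y | x in A & y in B].

(* Near each boundary point x0, and for some unit vector e, A is the strict
   epigraph in the direction e of a Lipschitz function on the hyperplane
   orthogonal to e; phi is such a function precomposed with the orthogonal
   projection. *)
Definition lipschitz_domain A :=
  forall x0 : 'rV[R]_n, (closure A `\` A°) x0 ->
    exists (e : 'rV[R]_n) (phi : 'rV[R]_n -> R),
      [/\ dotp e e = 1, [lipschitz phi x | x in setT] &
          \forall x \near x0, A x <-> phi (x - dotp x e *: e) < dotp x e].

End sets.

Section smooth.
Context {R : realType} {n : nat}.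
Implicit Types (f : 'rV[R]_n -> R) (V : set 'rV[R]_n).

Fixpoint Cn (k : nat) f : Prop :=
  match k with
  | 0 => continuous f
  | k'.+1 => (forall x, differentiable f x) /\
             forall i : 'I_n, Cn k' (fun x => 'D_(delta_mx ord0 i) f x)
  end.

Definition smooth f := forall k, Cn k f.

Definition fsupp f := closure [set x | f x != 0].

Definition Cc_infty V f := [/\ smooth f, compact (fsupp f) & fsupp f `<=` V].

End smooth.

(* Elements of function spaces are represented by real-valued functions defined
   everywhere on R^n, compared almost everywhere. The real-valued integrals
   below converge absolutely for the functions they are applied to. *)
Section spaces.
Context {R : realType} {n : nat}.
Variable s : R.
Implicit Types (u v f : 'rV[R]_n -> R) (V : set 'rV[R]_n).

Local Notation mu := (lebesgue_rV n).

(* |y|^{n+2s}; it vanishes at y = 0, where dividing by it gives 0, which only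
   affects null sets in the integrals below. *)
Definition kernel_den (y : 'rV[R]_n) : R := enorm y `^ (n%:R + 2 * s).

Definition ae_eq_on V u v := {ae mu, forall x, V x -> u x = v x}.

Definition gagliardo u : \bar R :=
  (\int[mu]_x \int[mu]_y ((u x - u y) ^+ 2 / kernel_den (x - y))%:E)%E.

Definition Hs_norm u : \bar R :=
  ('N[mu]_2%:E[EFin \o u] `^ 2 + gagliardo u)%E `^ 2^-1.

(* H^s(R^n), 0 < s < 1, with its Sobolev-Slobodeckij norm *)
Definition Hs : set ('rV[R]_n -> R) :=
  [set u | measurable_fun setT u /\ (Hs_norm u < +oo)%E].

Definition Hs_on V : set ('rV[R]_n -> R) :=
  [set u | exists2 ut, Hs ut & ae_eq_on V ut u].

Definition Hs_tilde V : set ('rV[R]_n -> R) :=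
  [set u | Hs u /\ forall e : R, 0 < e ->
     exists2 f, Cc_infty V f & (Hs_norm (u \- f)%R < e%:E)%E].

(* H^{-s}(V): bounded linear functionals on the previous space; the bound
   makes the value of g independent of the representative. *)
Definition Hs_dual V : set (('rV[R]_n -> R) -> R) :=
  [set g | (forall (a : R) v w, Hs_tilde V v -> Hs_tilde V w ->
              g (fun x => a * v x + w x) = a * g v + g w) /\
           exists C : R, forall v, Hs_tilde V v ->
              (`|g v|%:E <= C%:E * Hs_norm v)%E].

Section operator.
Variable Gam : set 'rV[R]_n.

Definition A_op f (x : 'rV[R]_n) : R :=
  \int[mu]_(y in Gam) ((f x - f (x + y)) / kernel_den y).

Definition antilocal :=
  forall f, Cc_infty setT f ->
  forall V, open V -> V !=set0 ->
    (forall x, V x -> f x = 0 /\ A_op f x = 0) ->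
    forall x, mink_add V Gam x -> f x = 0.

Variables (Om : set 'rV[R]_n) (q : 'rV[R]_n -> R).

Definition B_form u v : R :=
  (2 - 2 `^ (2 * s))^-1 *
    (\int[mu]_x \int[mu]_(y in Gam)
       ((u x - u (x + y)) * (v x - v (x - y)) / kernel_den y)) +
  \int[mu]_(x in Om) (q x * u x * v x).

Definition zero_notin_spectrum :=
  forall g, Hs_dual Om g ->
  exists w, [/\ Hs_tilde Om w,
    forall v, Hs_tilde Om v -> B_form w v = g v &
    forall w', Hs_tilde Om w' ->
      (forall v, Hs_tilde Om v -> B_form w' v = g v) -> ae_eq_on setT w' w].

Definition zero_not_dirichlet_eigenvalue V :=
  forall w, Hs_tilde V w -> (forall v, Hs_tilde V v -> B_form w v = 0) ->
  ae_eq_on setT w (cst 0).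

Definition weak_solution u :=
  forall ut, Hs ut -> ae_eq_on (mink_add Om Gam) ut u ->
  forall v, Hs_tilde Om v -> B_form ut v = 0.

End operator.
End spaces.

(* Main.v *)
(* Let f be a tent function supported in W, let w in H~^s(Om) solve
   B(w, v) = - B(f, v), and put u = w + f: it is a solution, and it is nonzero
   because u = f on W. Let E = W - Gam. Since Gam is a convex cone,
   cl E - Gam is contained in E, so B(g, v) = 0 whenever g lives on the union of
   W and cl E, and v in C_c^oo(Om2). Hence w restricted to the complement P of
   cl E satisfies the homogeneous equation in Om2, so that it vanishes by the
   eigenvalue hypothesis, once it is known to belong to H~^s(Om2).

   For this last point nothing is assumed on the boundary of E, but Gam contains
   a ball around some e0. Let S_t be the set of points outside cl E at distance
   < t from E. The translates of S_t by multiples of t e0 (and small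
   perturbations) are disjoint and stay within S_(L t), which bounds the integral
   of w^2 over S_t by t^(2s) times a piece of the Gagliardo seminorm plus a
   fraction, small compared with L^(-2s) because 2s < 1, of the integral over
   S_(L t). Summing over t = L^-j gives a Hardy inequality, and the terms
   t^(-2s) int_(S_t) w^2 tend to 0. These control the cost of cutting w 1_P off
   in S_t, so w 1_P is a limit of functions vanishing near cl E. *)
Require Import Defs.
From mathcomp Require Import all_boot all_order all_algebra.
From mathcomp Require Import all_classical all_reals all_analysis measurable_realfun ess_sup_inf.
From mathcomp Require Import ring lra.

Set Implicit Arguments.
Unset Strict Implicit.
Unset Printing Implicit Defensive.

Import Order.TTheory GRing.Theory Num.Theory.
Import numFieldNormedType.Exports.

Local Open Scope classical_set_scope.
Local Open Scope ring_scope.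

(** The form pairs increments of [u] along [Gam] with increments of [v] along [- Gam] and is not
    symmetric. The support argument is therefore one-sided: the first argument lives on a set stable
    under subtraction of [Gam], and the test function vanishes there. It is applied to the union of
    [W] and cl [E], and once more to the complement of [Om + Gam], which makes the equation
    independent of the extension.

    Cutting off at scale t costs t^(-2s) times the mass in the strip, because min(1, |z|/t)^2
    |z|^(-n-2s) has an integral of order t^(-2s). One Hardy step with M translates multiplies the
    mass at the next scale by 2/M, while the weight t^(-2s) changes by L^(2s) with L = 2 + M |e0|;
    the product is small for large M only if 2s < 1.

    The function w 1_P may jump across the boundary of cl [E]. The Hardy sum also pays for this
    jump, by making the integral of w^2 against the kernel over cl [E] finite near [E].
    Multiplication by a cutoff has a norm that grows as its scale shrinks, so the scale is fixed
    first and w is approximated by a test function afterwards. *)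

(** * Lebesgue integrals on R^n under translation and reflection *)

Section integral_rV.
Context {R : realType}.
Local Open Scope ereal_scope.

Lemma ge0_integral_preserving d (T : measurableType d)
    (m : {measure set T -> \bar R}) (phi : T -> T) (f : T -> \bar R) :
  measurable_fun setT phi -> (forall A, measurable A -> m (phi @^-1` A) = m A) ->
  measurable_fun setT f -> (forall x, 0 <= f x) ->
  \int[m]_x f (phi x) = \int[m]_x f x.
Proof.
move=> mphi phim mf f0.
rewrite -[LHS]/(\int[m]_(x in phi @^-1` setT) (f \o phi) x).
rewrite -(ge0_integral_pushforward mphi m measurableT)//.
by apply: eq_measure_integral => //= A mA _; exact: phim.
Qed.

Lemma measurable_addl (a : R) :
  measurable_fun setT (fun x : measurableTypeR R => (a + x)%R : measurableTypeR R).
Proof. exact: measurable_funD. Qed.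

Lemma lebesgue_measure_addl (a : R) (A : set R) : measurable A ->
  lebesgue_measure ((fun x => a + x)%R @^-1` A) = lebesgue_measure A.
Proof.
move=> mA; have ma := @measurable_addl a.
rewrite -[LHS]/(pushforward (@lebesgue_measure R)
  (fun x : measurableTypeR R => (a + x)%R : measurableTypeR R) A).
apply/esym/lebesgue_measure_unique => //= _ [[b c]] _ <-.
rewrite /pushforward.
rewrite (_ : _ @^-1` _ = `](b - a)%R, (c - a)%R]%classic).
  rewrite !lebesgue_measure_itv/= !lte_fin ltrD2r; case: ifPn => // _.
  by rewrite -!EFinD; congr (_%:E); ring.
by apply/seteqP; split => x /=; rewrite !in_itv/= ltrBlDl lerBrDl.
Qed.

Lemma integral_rVS n (F : 'rV[R]_n.+1 -> \bar R) :
  measurable_fun setT F -> (forall x, 0 <= F x) ->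
  \int[lebesgue_rV n.+1]_x F x =
  \int[lebesgue_measure]_t \int[lebesgue_rV n]_y F (rV_cons (t, y)).
Proof.
move=> mF F0; have mc := @measurable_rV_cons R n.
have := @fubini_tonelli1 _ _ _ _ _
  [the {sigma_finite_measure set (measurableTypeR R) -> \bar R}
   of @lebesgue_measure R] (lebesgue_rV n) (F \o @rV_cons R n).
rewrite /fubini_F /= => <-//; last first.
  exact: measurableT_comp.
by rewrite -(ge0_integral_pushforward mc _ measurableT).
Qed.

Lemma measurable_rV_addl n (a : 'rV[R]_n) : measurable_fun setT (fun x => a + x)%R.
Proof.
apply: measurable_fun_rVP => i.
rewrite (_ : (fun _ => _) = (fun x : 'rV[R]_n => a ord0 i + x ord0 i)%R).
  by apply: measurable_funD => //; exact: measurable_coord.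
by apply/funext => x; rewrite mxE.
Qed.

Lemma measurable_rV_opp n : measurable_fun setT (fun x : 'rV[R]_n => - x)%R.
Proof.
apply: measurable_fun_rVP => i.
rewrite (_ : (fun _ => _) = (fun x : 'rV[R]_n => - x ord0 i)%R).
  by apply: measurableT_comp => //; exact: measurable_coord.
by apply/funext => x; rewrite mxE.
Qed.

Lemma rV_cons_section n (F : 'rV[R]_n.+1 -> \bar R) t :
  measurable_fun setT F -> measurable_fun setT (fun y => F (rV_cons (t, y))).
Proof.
move=> mF; apply: (measurableT_comp mF).
apply: (measurableT_comp (@measurable_rV_cons R n)).
exact: measurable_pair1.
Qed.

(** Induction on the dimension: [integral_rVS] splits off the first coordinate, whose shift is the
    invariance of the measure on the line, and the induction hypothesis shifts the other
    coordinates. *)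
Lemma integral_rV_addl n (a : 'rV[R]_n) (F : 'rV[R]_n -> \bar R) :
  measurable_fun setT F -> (forall x, 0 <= F x) ->
  \int[lebesgue_rV n]_x F (a + x)%R = \int[lebesgue_rV n]_x F x.
Proof.
elim: n => [|n IH] in a F * => mF F0.
  by apply: eq_integral => x _; congr F; apply/rowP => -[].
rewrite (integral_rVS mF F0).
rewrite (@integral_rVS _ (fun x => F (a + x)%R)); [|
  by apply: (measurableT_comp mF); exact: measurable_rV_addl|by []].
pose G t := \int[lebesgue_rV n]_y F (rV_cons (t, y)).
have mG : measurable_fun setT G.
  apply: (@measurable_fun_fubini_tonelli_F _ _ _ _ _ (lebesgue_rV n) (F \o @rV_cons R n)) => [|x].
    by apply: (measurableT_comp mF); exact: measurable_rV_cons.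
  exact: F0.
rewrite -[RHS]/(\int[lebesgue_measure]_t G t).
have ma := @measurable_addl (a ord0 ord0).
rewrite -[RHS](ge0_integral_preserving ma (@lebesgue_measure_addl _) mG); last first.
  by move=> t; exact: integral_ge0.
apply: eq_integral => t _; rewrite /G.
rewrite -[RHS](IH (\row_i a ord0 (lift ord0 i)))//; last exact: rV_cons_section.
apply: eq_integral => y _; congr F; apply/rowP => i.
have [j ->|->] := unliftP ord0 i; rewrite mxE ?rV_consE1 ?rV_consE0 ?mxE//.
Qed.

Lemma integral_rV_opp n (F : 'rV[R]_n -> \bar R) :
  measurable_fun setT F -> (forall x, 0 <= F x) ->
  \int[lebesgue_rV n]_x F (- x)%R = \int[lebesgue_rV n]_x F x.
Proof.
elim: n => [|n IH] in F * => mF F0.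
  by apply: eq_integral => x _; congr F; apply/rowP => -[].
rewrite (integral_rVS mF F0).
rewrite (@integral_rVS _ (fun x => F (- x)%R)); [|
  by apply: (measurableT_comp mF); exact: measurable_rV_opp|by []].
pose G t := \int[lebesgue_rV n]_y F (rV_cons (t, y)).
have mG : measurable_fun setT G.
  apply: (@measurable_fun_fubini_tonelli_F _ _ _ _ _ (lebesgue_rV n) (F \o @rV_cons R n)) => [|x].
    by apply: (measurableT_comp mF); exact: measurable_rV_cons.
  exact: F0.
rewrite -[RHS]/(\int[lebesgue_measure]_t G t).
have mN : measurable_fun setT (-%R : measurableTypeR R -> measurableTypeR R).
  exact: oppr_measurable.
rewrite -[RHS](ge0_integral_preserving mN (@lebesgue_measureN _) mG); last first.
  by move=> t; exact: integral_ge0.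
apply: eq_integral => t _; rewrite /G.
rewrite -[RHS]IH//; last exact: rV_cons_section.
apply: eq_integral => y _; congr F; apply/rowP => i.
have [j ->|->] := unliftP ord0 i; rewrite mxE ?rV_consE1 ?rV_consE0 ?mxE//.
Qed.

End integral_rV.

(** * Sup-norm topology and Borel sets of R^n *)

Section rV_topology.
Context {R : realType} {n : nat}.
Implicit Types (x y : 'rV[R]_n) (A : set 'rV[R]_n).

Lemma ball_rVE x r y : 0 < r ->
  ball x r y <-> forall i, `|x ord0 i - y ord0 i| < r.
Proof.
move=> r0; split=> [[_ xy] i|xy]; first exact: xy.
by split => // i j; rewrite (ord1 i); exact: xy.
Qed.

Lemma normr_coord_le x i : `|x ord0 i| <= `|x|.
Proof.
rewrite -[leRHS]/(mx_norm x) mx_normrE.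
exact: (le_bigmax _ (fun ij : 'I_1 * 'I_n => `|x ij.1 ij.2|) (ord0, i)).
Qed.

Lemma measurable_ball_rV x r : measurable (ball x r).
Proof.
have [r0|r0] := ltP 0 r; last first.
  rewrite (_ : ball x r = set0) //; apply/seteqP; split => // y [r1 _].
  by move: r0; rewrite leNgt r1.
rewrite (_ : ball x r = \bigcap_(i in [set: 'I_n])
    ((fun y : 'rV[R]_n => y ord0 i : measurableTypeR R) @^-1` ball (x ord0 i) r)).
  apply: fin_bigcap_measurable => // i _.
  have := @measurable_coord R n i measurableT _ (@measurable_ball R (x ord0 i) r).
  by rewrite setTI.
apply/seteqP; split => y; first by move=> /ball_rVE-/(_ r0) xy i _; exact: xy.
by move=> xy; apply/ball_rVE => // i; exact: xy.
Qed.

(** The sigma-algebra is generated by the coordinates, so open sets have to be exhausted by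
    countably many cubes with rational centres. *)
Lemma open_measurable_rV A : open A -> measurable A.
Proof.
move=> oA.
pose F (p : 'rV[rat]_n * nat) :=
  ball (map_mx ratr p.1 : 'rV[R]_n) p.2.+1%:R^-1.
(* Cubes that do not fit into [A] are replaced by the empty set, which keeps the union indexed by a
   countable type. *)
pose G p := if `[< F p `<=` A >] then F p else set0.
rewrite (_ : A = \bigcup_p G p).
  apply: countable_bigcupT_measurable => [|p]; first exact: countableP.
  by rewrite /G; case: ifP => // _; exact: measurable_ball_rV.
apply/seteqP; split => [x Ax|x [p _]]; last first.
  by rewrite /G; case: asboolP => // FA /FA.
have /nbhs_ballP[e/= e0 eA] := open_nbhs_nbhs (conj oA Ax).
have [N] : exists N, N.+1%:R^-1 < e / 2.
  have e20 : 0 < e / 2 by rewrite divr_gt0.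
  by have /= [N _ /(_ N (leqnn N))/= ?] := near_infty_natSinv_lt (PosNum e20); exists N.
move=> Ne; have N0 : 0 < N.+1%:R^-1 :> R by rewrite invr_gt0.
have qx i : exists q : rat, ratr q \in `]x ord0 i - N.+1%:R^-1, x ord0 i[.
  by apply: rat_in_itvoo; rewrite ltrBlDr ltrDl.
have xF : F (\row_i projT1 (cid (qx i)), N) x.
  apply/ball_rVE => // i; rewrite !mxE; case: cid => q /=.
  rewrite in_itv/= => /andP[q1 q2].
  rewrite ltr_norml; move: N0 q1 q2; move: (x ord0 i) (ratr q) (N.+1%:R^-1) => a b c.
  by move=> N0 q1 q2; apply/andP; split; lra.
exists (\row_i projT1 (cid (qx i)), N) => //.
rewrite /G; case: asboolP => // -[]; apply: subset_trans eA => y.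
move=> Fy; apply: (@le_ball _ _ _ (N.+1%:R^-1 + N.+1%:R^-1)).
  by move: Ne; move: (N.+1%:R^-1) => c; lra.
by apply: ball_triangle Fy; exact: ball_sym.
Qed.

Lemma closed_measurable_rV A : closed A -> measurable A.
Proof. by move=> /closed_openC/open_measurable_rV/measurableC; rewrite setCK. Qed.

Lemma continuous_measurable_rV (f : 'rV[R]_n -> R) :
  continuous f -> measurable_fun setT f.
Proof.
move=> /continuousP cf; apply: (measurability _ (RGenOpens.measurableE R)).
move=> _ [_ [a [b ->] <-]]; rewrite setTI; apply: open_measurable_rV.
exact/cf/interval_open.
Qed.

Lemma continuous_norm_rV : continuous (fun x : 'rV[R]_n => `|x|).
Proof. by move=> x; exact: norm_continuous. Qed.

Lemma measurable_fun_addr d (T : measurableType d) (f g : T -> 'rV[R]_n) :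
  measurable_fun setT f -> measurable_fun setT g ->
  measurable_fun setT (fun t => f t + g t).
Proof.
move=> mf mg; apply: measurable_fun_rVP => i.
rewrite (_ : (fun _ => _) = (fun t => f t ord0 i + g t ord0 i)).
  by apply: measurable_funD;
    apply: (measurableT_comp (@measurable_coord R n i)).
by apply/funext => x; rewrite mxE.
Qed.

Lemma measurable_fun_oppr d (T : measurableType d) (f : T -> 'rV[R]_n) :
  measurable_fun setT f -> measurable_fun setT (fun t => - f t).
Proof. exact: (measurableT_comp (@measurable_rV_opp R n)). Qed.

Lemma measurable_fun_subr d (T : measurableType d) (f g : T -> 'rV[R]_n) :
  measurable_fun setT f -> measurable_fun setT g ->
  measurable_fun setT (fun t => f t - g t).
Proof. by move=> mf mg; apply: measurable_fun_addr => //; exact: measurable_fun_oppr. Qed.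

End rV_topology.

(** Sup-norm balls are cubes, hence products of an interval and a cube of one dimension less. *)
Lemma lebesgue_rV_ball (R : realType) n (x : 'rV[R]_n) (r : R) : 0 < r ->
  lebesgue_rV n (ball x r) = ((r *+ 2) ^+ n)%:E.
Proof.
move=> r0; elim: n => [|n IH] in x *.
  by rewrite expr0 /= diracE mem_set//; apply/ball_rVE => // -[].
rewrite /= /lebesgue_rV_step /pushforward.
rewrite (_ : _ @^-1` _ = ball (x ord0 ord0) r `*`
    ball (\row_i x ord0 (lift ord0 i)) r).
  rewrite product_measure1E; [| |exact: measurable_ball_rV].
  rewrite -[X in (X * _)%E]/(lebesgue_measure (ball (x ord0 ord0) r)).
    by rewrite lebesgue_measure_ball ?ltW// IH -EFinM exprS.
  exact: measurable_ball.
apply/seteqP; split => -[t y] /=.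
  move=> /ball_rVE-/(_ r0) xy; split; first by have := xy ord0; rewrite rV_consE0.
  by apply/ball_rVE => // i; rewrite mxE; have := xy (lift ord0 i); rewrite rV_consE1.
move=> [xt /ball_rVE-/(_ r0) xy]; apply/ball_rVE => // i.
by have [j ->|->] := unliftP ord0 i; rewrite ?rV_consE1 ?rV_consE0//;
  have := xy j; rewrite mxE.
Qed.

(** * Integrals of nonnegative real functions *)

Section nonneg_integral.
Local Open Scope ereal_scope.
Context d (T : measurableType d) (R : realType) (m : {measure set T -> \bar R}).
Implicit Types f g : T -> R.

Lemma nnint_le f g : measurable_fun setT f -> measurable_fun setT g ->
  (forall x, 0 <= f x)%R -> (forall x, f x <= g x)%R ->
  \int[m]_x (f x)%:E <= \int[m]_x (g x)%:E.
Proof.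
move=> mf mg f0 fg; apply: ge0_le_integral => //.
- by move=> x _; rewrite lee_fin.
- exact/measurable_EFinP.
- exact/measurable_EFinP.
- by move=> x _; rewrite lee_fin.
Qed.

Lemma nnint_add f g : measurable_fun setT f -> measurable_fun setT g ->
  (forall x, 0 <= f x)%R -> (forall x, 0 <= g x)%R ->
  \int[m]_x (f x + g x)%:E = \int[m]_x (f x)%:E + \int[m]_x (g x)%:E.
Proof.
move=> mf mg f0 g0; rewrite -ge0_integralD//.
- by move=> x _; rewrite lee_fin.
- exact/measurable_EFinP.
- by move=> x _; rewrite lee_fin.
- exact/measurable_EFinP.
Qed.

Lemma nnint_scale (k : R) f : measurable_fun setT f ->
  (forall x, 0 <= f x)%R -> (0 <= k)%R ->
  \int[m]_x (k * f x)%:E = k%:E * \int[m]_x (f x)%:E.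
Proof.
move=> mf f0 k0; rewrite -ge0_integralZl_EFin//.
- by move=> x _; rewrite lee_fin.
- exact/measurable_EFinP.
Qed.

Lemma nnint_indic (A : set T) : measurable A -> \int[m]_x (\1_A x)%:E = m A.
Proof. by move=> mA; rewrite integral_indic// setIT. Qed.

Lemma nnint_ge0 f : (forall x, 0 <= f x)%R -> 0 <= \int[m]_x (f x)%:E.
Proof. by move=> f0; apply: integral_ge0 => x _; rewrite lee_fin. Qed.

Lemma nneseries_term_le (u : nat -> R) k : (forall j, 0 <= u j)%R ->
  (u k)%:E <= \sum_(j <oo) (u j)%:E.
Proof.
move=> u0; apply: le_trans (nneseries_lim_ge k.+1 _) => [|j _ _].
  rewrite big_nat_recr//= leeDr// sume_ge0// => j _; by rewrite lee_fin.
by rewrite lee_fin.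
Qed.

(* The pointwise bound only asks for one dominating term of the series. *)
Lemma nnint_eseries_le (f : T -> \bar R) (g : nat -> T -> R) (a : nat -> R) (c : \bar R) :
  measurable_fun setT f -> (forall j, measurable_fun setT (g j)) ->
  (forall x, 0 <= f x) -> (forall j x, 0 <= g j x)%R ->
  (forall x, f x = 0 \/ exists j, f x <= (g j x)%:E) ->
  (forall j, \int[m]_x (g j x)%:E <= (a j)%:E) ->
  \sum_(j <oo) (a j)%:E <= c ->
  \int[m]_x f x <= c.
Proof.
move=> mf mg f0 g0 fg ga ac; apply: le_trans ac.
have mgE j : measurable_fun setT (fun x => (g j x)%:E) by exact/measurable_EFinP.
have g0E j x : 0 <= (g j x)%:E by rewrite lee_fin.
apply: (@le_trans _ _ (\int[m]_x \sum_(j <oo) (g j x)%:E)).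
  apply: ge0_le_integral => //; first exact: ge0_emeasurable_sum.
  move=> x _; have [->|[j fgj]] := fg x; first exact: nneseries_ge0.
  exact: le_trans fgj (nneseries_term_le j (g0 ^~ x)).
rewrite integral_nneseries//; apply: lee_nneseries => // j _ _.
exact: integral_ge0.
Qed.

Lemma nnint_series_le f (g : nat -> T -> R) (a : nat -> R) (c : R) :
  measurable_fun setT f -> (forall j, measurable_fun setT (g j)) ->
  (forall x, 0 <= f x)%R -> (forall j x, 0 <= g j x)%R ->
  (forall x, f x = 0 \/ exists j, f x <= g j x)%R ->
  (forall j, \int[m]_x (g j x)%:E <= (a j)%:E) ->
  \sum_(j <oo) (a j)%:E <= c%:E ->
  \int[m]_x (f x)%:E <= c%:E.
Proof.
move=> mf mg f0 g0 fg ga ac.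
apply: (@nnint_eseries_le (fun x => (f x)%:E) g a c%:E _ mg _ g0 _ ga ac).
- exact/measurable_EFinP.
- by move=> x; rewrite lee_fin f0.
- by move=> x; have [->|[j h]] := fg x; [left|right; exists j; rewrite lee_fin].
Qed.

End nonneg_integral.

(** * Dyadic scales and geometric series *)

Section dyadic.
Context {R : realType}.
Implicit Types x r t q a : R.

Lemma dyadic_floor x : 1 <= x -> exists j, 2 ^+ j <= x < 2 ^+ j.+1.
Proof.
move=> x1; have [N xN] : exists N, x < 2 ^+ N.+1.
  exists (Num.truncn x).+1; apply: (lt_trans (truncnS_gt x)).
  rewrite -natrX ltr_nat; apply: (@ltn_trans (2 ^ (Num.truncn x).+1)).
    exact: ltn_expl.
  by rewrite ltn_exp2l.
have [j xj jmin] := ex_minnP (ex_intro (fun N => x < 2 ^+ N.+1) N xN).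
exists j; rewrite xj andbT; case: j xj jmin => [|j] xj jmin; first by rewrite expr0.
by rewrite leNgt; apply/negP => /jmin; rewrite ltnn.
Qed.

Lemma geometric_nneseries_le a q : 0 <= a -> 0 <= q < 1 ->
  (\sum_(j <oo) (a * q ^+ j)%:E <= (a / (1 - q))%:E)%E.
Proof.
move=> a0 /andP[q0 q1]; apply: lime_le.
  by apply: is_cvg_nneseries => j _ _; rewrite lee_fin mulr_ge0// exprn_ge0.
apply: nearW => N; rewrite sumEFin lee_fin.
have /(congr1 (@^~ N)) := @geometric_seriesE R a q (negbT (lt_eqF q1)).
rewrite /series /= => ->; rewrite ler_wpM2r ?invr_ge0 ?subr_ge0 ?(ltW q1)//.
by rewrite ler_piMr// gerBl exprn_ge0.
Qed.

End dyadic.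

(** As a factor rather than a divisor, the kernel enters products of nonnegative terms. For [0 < s]
    it vanishes at the origin, so lower bounds need a nonzero [y]. *)
Definition rker (R : realType) n (s : R) (y : 'rV[R]_n) : R :=
  (kernel_den s y)^-1.

Lemma ltr_powR_base_gt1 (R : realType) (a x y : R) : 1 < a -> x < y -> a `^ x < a `^ y.
Proof.
move=> a1 xy; have a0 : 0 < a by exact: lt_trans a1.
by rewrite /powR gt_eqF// ltr_expR ltr_pM2r// ln_gt0.
Qed.

(** * The Euclidean norm against the sup norm *)

Section enorm.
Context {R : realType} {n : nat}.
Implicit Types x y : 'rV[R]_n.

Lemma dotp_ge0 x : 0 <= dotp x x.
Proof. by apply: sumr_ge0 => i _; rewrite -expr2 sqr_ge0. Qed.

Lemma enormN x : enorm (- x) = enorm x.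
Proof.
by rewrite /enorm /dotp; under eq_bigr do rewrite !mxE mulrNN.
Qed.

Lemma normr_rV_le x a : 0 <= a -> (forall i, `|x ord0 i| <= a) -> `|x| <= a.
Proof.
move=> a0 xa; rewrite -[leLHS]/(mx_norm x) mx_normrE.
by apply: bigmax_le => // -[i j] _ /=; rewrite (ord1 i).
Qed.

Lemma normr_le_enorm x : `|x| <= enorm x.
Proof.
apply: normr_rV_le => [|i]; first exact: sqrtr_ge0.
rewrite -sqrtr_sqr ler_sqrt ?dotp_ge0// /dotp (bigD1 i)//= -expr2 lerDl.
by apply: sumr_ge0 => j _; rewrite -expr2 sqr_ge0.
Qed.

Lemma enorm_le x : enorm x <= Num.sqrt n%:R * `|x|.
Proof.
rewrite -[X in _ * X]ger0_norm// -sqrtr_sqr -sqrtrM// ler_sqrt; last first.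
  by rewrite mulr_ge0// sqr_ge0.
apply: (@le_trans _ _ (\sum_(i < n) `|x| ^+ 2)).
  apply: ler_sum => i _; rewrite -expr2 -[x ord0 i ^+ 2]real_normK ?num_real//.
  by rewrite lerXn2r ?nnegrE// normr_coord_le.
by rewrite sumr_const card_ord mulr_natl.
Qed.

Lemma measurable_enorm : measurable_fun setT (@enorm R n).
Proof.
rewrite (_ : @enorm R n = (@powR R ^~ 2^-1) \o (fun x => dotp x x)); last first.
  by apply/funext => x /=; rewrite powR12_sqrt// dotp_ge0.
apply: (measurableT_comp (measurable_powR 2^-1)).
by apply: measurable_sum => i; apply: measurable_funM; exact: measurable_coord.
Qed.

End enorm.

(** * Pointwise and integral bounds for the singular kernel *)

Section rker.
Context {R : realType} {n : nat} (s : R).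
Hypothesis s0 : 0 < s.
Local Notation mu := (@lebesgue_rV R n).
Local Notation p := (n%:R + 2 * s).
Local Notation k := (@rker R n s).

Let p0 : 0 < p.
Proof. by rewrite ltr_wpDl// mulr_gt0. Qed.

Lemma rker_ge0 y : 0 <= k y.
Proof. by rewrite /rker invr_ge0 powR_ge0. Qed.

Lemma rkerN y : k (- y) = k y.
Proof. by rewrite /rker /kernel_den enormN. Qed.

Lemma measurable_rker : measurable_fun setT k.
Proof.
rewrite (_ : k = (@powR R ^~ (- p)) \o @enorm R n); last first.
  by apply/funext => y /=; rewrite powRN.
exact: (measurableT_comp (measurable_powR _) measurable_enorm).
Qed.

Lemma rker_le a (y : 'rV[R]_n) : 0 < a -> a <= `|y| -> k y <= a `^ (- p).
Proof.
move=> a0 ay; rewrite /rker powRN lef_pV2 ?posrE ?powR_gt0//; last first.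
  by rewrite (lt_le_trans a0)// (le_trans ay)// normr_le_enorm.
rewrite ge0_ler_powR ?nnegrE ?(ltW a0) ?(ltW p0) ?sqrtr_ge0//.
exact: le_trans ay (normr_le_enorm y).
Qed.

Lemma rker_ge a (y : 'rV[R]_n) : 0 < `|y| -> `|y| <= a ->
  (Num.sqrt n%:R * a) `^ (- p) <= k y.
Proof.
move=> y0 ya; have e0 : 0 < enorm y := lt_le_trans y0 (normr_le_enorm y).
have eya : enorm y <= Num.sqrt n%:R * a.
  by apply: le_trans (enorm_le y) _; rewrite ler_wpM2l// sqrtr_ge0.
rewrite /rker powRN lef_pV2 ?posrE ?powR_gt0// ?(lt_le_trans e0)//.
by rewrite ge0_ler_powR ?nnegrE ?(ltW p0)// ?(ltW e0)// (le_trans (ltW e0)).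
Qed.

Lemma measurable_set_fun (T : 'rV[R]_n -> R) (a : R) : continuous T ->
  measurable [set y | a <= T y].
Proof.
move=> cT; apply: closed_measurable_rV.
exact: (closed_comp (fun y _ => cT y) (@closed_ge R a)).
Qed.

Lemma measurable_normr_ge (a : R) : measurable [set y : 'rV[R]_n | a <= `|y|].
Proof. by apply: measurable_set_fun; exact: continuous_norm_rV. Qed.

Lemma int_indic_ball (x : 'rV[R]_n) (r : R) : 0 < r ->
  (\int[mu]_y (\1_(ball x r) y)%:E)%E = ((r *+ 2) ^+ n)%:E.
Proof.
by move=> r0; rewrite nnint_indic; [exact: lebesgue_rV_ball|exact: measurable_ball_rV].
Qed.

(** On the annulus between 2^j r and 2^(j+1) r the kernel is at most (2^j r)^(-n-2s), and the
    enclosing cube has volume 4^n (2^j r)^n. The products form a geometric series of ratio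
    2^(-2s). *)
Lemma int_rker_far : exists2 C : R, 0 <= C & forall r : R, 0 < r ->
  (\int[mu]_y (\1_[set y | r <= `|y|] y * k y)%:E <= (C * r `^ (- (2 * s)))%:E)%E.
Proof.
pose q : R := 2 `^ (- (2 * s)).
have q01 : 0 <= q < 1.
  by rewrite powR_ge0/= /q powRN invf_lt1 ?powR_gt0// -[X in X < _](powRr0 2)
    ltr_powR_base_gt1 ?ltr1n// mulr_gt0.
exists (4 ^+ n / (1 - q)) => [|r r0].
  by rewrite divr_ge0// ?exprn_ge0// subr_ge0 ltW//; case/andP: q01.
pose a j : R := 4 ^+ n * r `^ (- (2 * s)) * q ^+ j.
apply: (@nnint_series_le _ _ _ mu _
  (fun j y => (2 ^+ j * r) `^ (- p) * \1_(ball 0 (2 ^+ j.+1 * r)) y) a).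
- apply: measurable_funM measurable_rker.
  by apply: measurable_indic; exact: measurable_normr_ge.
- move=> j; apply: measurable_funM => //.
  by apply: measurable_indic; exact: measurable_ball_rV.
- by move=> y; rewrite mulr_ge0// rker_ge0.
- by move=> j y; rewrite mulr_ge0// powR_ge0.
- move=> y; rewrite indicE; case: (boolP (_ \in _)) => [|_]; last by left; rewrite mul0r.
  rewrite inE/= => ry; right.
  have yr1 : 1 <= `|y| / r by rewrite ler_pdivlMr ?mul1r.
  have [j /andP[j1 j2]] := dyadic_floor yr1.
  exists j; rewrite indicE mem_set ?mul1r ?mulr1.
    by apply: rker_le; rewrite ?mulr_gt0 ?exprn_gt0// -ler_pdivlMr.
  by rewrite -ball_normE/= sub0r normrN -ltr_pdivrMr.
- move=> j; rewrite nnint_scale ?powR_ge0//; last first.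
    by apply: measurable_indic; exact: measurable_ball_rV.
  have jr0 : 0 < 2 ^+ j * r by rewrite mulr_gt0 ?exprn_gt0.
  rewrite int_indic_ball ?mulr_gt0 ?exprn_gt0//.
  rewrite -EFinM lee_fin /a.
  have -> : (2 ^+ j.+1 * r) *+ 2 = 4 * (2 ^+ j * r) by rewrite exprS mulr2n; ring.
  rewrite exprMn mulrCA -[X in _ * (_ * X)]powR_mulrn ?(ltW jr0)// -powRD; last first.
    by rewrite (gt_eqF jr0) implybT.
  rewrite [- _ + _](_ : _ = - (2 * s)); last by ring.
  rewrite powRM ?exprn_ge0 ?(ltW r0)// -powR_mulrn// -powRrM.
  by rewrite [j%:R * _]mulrC powRrM powR_mulrn ?powR_ge0// mulrA mulrAC.
- have := @geometric_nneseries_le R (4 ^+ n * r `^ (- (2 * s))) q _ q01.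
  rewrite /a mulrAC; apply.
  by rewrite mulr_ge0 ?exprn_ge0 ?powR_ge0.
Qed.

(** At distance about 2^(-j) r from the origin the squared minimum is of order 4^(-j), while the
    tail bound [int_rker_far] grows like 2^(2sj). The ratio 4^(-1) 2^(2s) is below 1 because
    [s < 1]. *)
Lemma int_rker_near : s < 1 -> exists2 C : R, 0 <= C & forall r : R, 0 < r ->
  (\int[mu]_y (Num.min 1 (`|y| / r) ^+ 2 * k y)%:E <= (C * r `^ (- (2 * s)))%:E)%E.
Proof.
move=> s1; have [C C0 HC] := int_rker_far.
pose q : R := 4^-1 * 2 `^ (2 * s).
have q01 : 0 <= q < 1.
  rewrite mulr_ge0 ?powR_ge0//= /q ltr_pdivrMl// mulr1.
  have -> : 4 = 2 `^ 2%:R :> R by rewrite powR_mulrn// expr2; ring.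
  by apply: ltr_powR_base_gt1; rewrite ?ltr1n//; lra.
exists (4 * C / (1 - q)) => [|r r0].
  by rewrite divr_ge0// ?mulr_ge0// subr_ge0 ltW//; case/andP: q01.
pose t j : R := 2 ^- j * r.
have t0 j : 0 < t j by rewrite mulr_gt0// invr_gt0 exprn_gt0.
pose a j : R := 4 * C * r `^ (- (2 * s)) * q ^+ j.
have mnormr : measurable_fun setT (fun y : 'rV[R]_n => `|y|).
  by apply: continuous_measurable_rV; exact: continuous_norm_rV.
apply: (@nnint_series_le _ _ _ mu _
  (fun j y => 4 * 4^-1 ^+ j * (\1_[set y | t j <= `|y|] y * k y)) a).
- apply: measurable_funM measurable_rker; apply: measurable_funX.
  apply: measurable_minr => //; apply: measurable_funM => //.
- move=> j; apply: measurable_funM => //; apply: measurable_funM measurable_rker.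
  by apply: measurable_indic; exact: measurable_normr_ge.
- by move=> y; rewrite mulr_ge0 ?rker_ge0// sqr_ge0.
- by move=> j y; rewrite !mulr_ge0 ?rker_ge0// exprn_ge0.
- move=> y; have [ry|yr] := leP r `|y|.
    right; exists 0%N; rewrite expr0 mulr1 indicE mem_set/= ?mul1r.
      by rewrite ler_wpM2r ?rker_ge0// min_l ?ler_pdivlMr ?mul1r// expr1n ler1n.
    by rewrite /t expr0 invr1 mul1r.
  have [->|y0] := eqVneq y 0.
    by left; rewrite normr0 mul0r min_r ?ler01// expr0n mul0r.
  have {}y0 : 0 < `|y| by rewrite normr_gt0.
  have ry1 : 1 <= r / `|y| by rewrite ler_pdivlMr ?mul1r ?ltW.
  have [j /andP[j1 j2]] := dyadic_floor ry1.
  (* The dyadic floor only gives |y| > 2^(-j-1) r, whence the index [j.+1]; the factor 4 in the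
     majorant turns 4^(-j-1) back into the required 4^(-j). *)
  right; exists j.+1; rewrite indicE mem_set/= ?mul1r; last first.
    by rewrite /t mulrC ler_pdivrMr ?exprn_gt0// mulrC -ler_pdivrMr// ltW.
  rewrite ler_wpM2r ?rker_ge0// min_r; last by rewrite ler_pdivrMr ?mul1r ?ltW.
  rewrite [4^-1 ^+ _]exprS mulrA divff// mul1r.
  have -> : 4^-1 = 2^-1 ^+ 2 :> R by rewrite exprVn expr2 -natrM.
  rewrite -exprM mulnC exprM lerXn2r ?nnegrE ?divr_ge0 ?exprn_ge0 ?(ltW y0) ?(ltW r0)//.
  rewrite ler_pdivrMr// exprVn mulrC ler_pdivlMr ?exprn_gt0//.
  by rewrite mulrC -ler_pdivlMr.
- move=> j; rewrite nnint_scale ?mulr_ge0 ?exprn_ge0//; last 2 first.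
  + apply: measurable_funM measurable_rker.
    by apply: measurable_indic; exact: measurable_normr_ge.
  + by move=> y; rewrite mulr_ge0 ?rker_ge0.
  apply: (@le_trans _ _ ((4 * 4^-1 ^+ j)%:E * (C * t j `^ (- (2 * s)))%:E)%E).
    by rewrite lee_wpmul2l ?HC// lee_fin mulr_ge0 ?exprn_ge0.
  rewrite -EFinM lee_fin /a /t powRM ?invr_ge0 ?exprn_ge0 ?(ltW r0)//.
  rewrite -powR_inv1 ?exprn_ge0// -powRrM mulN1r opprK -[2 ^+ j]powR_mulrn//.
  rewrite -powRrM [j%:R * _]mulrC powRrM powR_mulrn ?powR_ge0// /q exprMn.
  move: (4^-1 ^+ j) (2 `^ _ ^+ j) (r `^ _) => u v w.
  by rewrite le_eqVlt; apply/orP; left; apply/eqP; ring.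
have := @geometric_nneseries_le R (4 * C * r `^ (- (2 * s))) q _ q01.
rewrite /a [4 * C / _ * _]mulrAC; apply.
by rewrite !mulr_ge0// powR_ge0.
Qed.

Lemma rkerE (y : 'rV[R]_n) : k y = (kernel_den s y)^-1.
Proof. by []. Qed.

End rker.

#[global] Opaque rker kernel_den.

(** * Iterated integrals of nonnegative functions of two points *)

Section double_integral.
Context {R : realType} {n : nat}.
Local Notation rV := 'rV[R]_n.
Local Notation mu := (@lebesgue_rV R n).
Implicit Types F G : rV -> rV -> R.

Definition dint F : \bar R := (\int[mu]_x \int[mu]_y (F x y)%:E)%E.

Definition measurable2 F := measurable_fun setT (fun z : rV * rV => F z.1 z.2).

Lemma measurable2_comp F (g h : rV * rV -> rV) : measurable2 F ->
  measurable_fun setT g -> measurable_fun setT h ->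
  measurable2 (fun x y => F (g (x, y)) (h (x, y))).
Proof.
move=> mF mg mh; rewrite /measurable2.
rewrite (_ : (fun z => _) = (fun z => F z.1 z.2) \o (fun z => (g z, h z))).
  by apply: (measurableT_comp mF); exact/measurable_fun_pair.
by apply/funext => -[].
Qed.

Lemma measurable2_1 (u : rV -> R) : measurable_fun setT u ->
  measurable2 (fun x _ => u x).
Proof. by move=> mf; apply: (measurableT_comp mf); exact: measurable_fst. Qed.

Lemma measurable2_2 (u : rV -> R) : measurable_fun setT u ->
  measurable2 (fun _ y => u y).
Proof. by move=> mf; apply: (measurableT_comp mf); exact: measurable_snd. Qed.

Lemma measurable2_comp1 (u : rV -> R) (g : rV * rV -> rV) :
  measurable_fun setT u -> measurable_fun setT g ->
  measurable2 (fun x y => u (g (x, y))).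
Proof.
move=> mf mg; rewrite /measurable2 (_ : (fun z => _) = u \o g).
  exact: measurableT_comp.
by apply/funext => -[].
Qed.

Lemma measurable_zsub : measurable_fun setT (fun z : rV * rV => z.1 - z.2).
Proof. by apply: measurable_fun_subr; [exact: measurable_fst|exact: measurable_snd]. Qed.

Lemma measurable_zadd : measurable_fun setT (fun z : rV * rV => z.1 + z.2).
Proof. by apply: measurable_fun_addr; [exact: measurable_fst|exact: measurable_snd]. Qed.

Lemma measurable2_sub (u : rV -> R) : measurable_fun setT u ->
  measurable2 (fun x y => u (x - y)).
Proof. by move=> mf; exact: (measurable2_comp1 mf measurable_zsub). Qed.

Lemma measurable2_add (u : rV -> R) : measurable_fun setT u ->
  measurable2 (fun x y => u (x + y)).
Proof. by move=> mf; exact: (measurable2_comp1 mf measurable_zadd). Qed.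

Lemma measurable2_swap F : measurable2 F -> measurable2 (fun x y => F y x).
Proof.
move=> mF; exact: (measurable2_comp (g := snd) (h := fst) mF).
Qed.

Lemma measurable2_y F x : measurable2 F -> measurable_fun setT (F x).
Proof.
by move=> mF; exact: (measurableT_comp mF (measurable_pair1 x)).
Qed.

Lemma dintE F : measurable2 F -> (forall x y, 0 <= F x y) ->
  dint F = (\int[mu \x mu]_z (F z.1 z.2)%:E)%E.
Proof.
move=> mF F0; rewrite fubini_tonelli1//; first exact/measurable_EFinP.
by move=> z; rewrite lee_fin.
Qed.

Lemma dint_ge0 F : (forall x y, 0 <= F x y) -> (0 <= dint F)%E.
Proof.
by move=> F0; apply: integral_ge0 => x _; apply: integral_ge0 => y _; rewrite lee_fin.
Qed.

Lemma dint_le F G : measurable2 F -> measurable2 G ->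
  (forall x y, 0 <= F x y) -> (forall x y, F x y <= G x y) ->
  (dint F <= dint G)%E.
Proof.
move=> mF mG F0 FG; have G0 x y : 0 <= G x y by exact: le_trans (FG x y).
by rewrite !dintE//; exact: nnint_le.
Qed.

Lemma measurable2D F G : measurable2 F -> measurable2 G ->
  measurable2 (fun x y => F x y + G x y).
Proof. exact: measurable_funD. Qed.

Lemma measurable2M F G : measurable2 F -> measurable2 G ->
  measurable2 (fun x y => F x y * G x y).
Proof. exact: measurable_funM. Qed.

Lemma measurable2B F G : measurable2 F -> measurable2 G ->
  measurable2 (fun x y => F x y - G x y).
Proof. exact: measurable_funB. Qed.

Lemma measurable2X F k : measurable2 F -> measurable2 (fun x y => F x y ^+ k).
Proof. exact: measurable_funX. Qed.

Lemma measurable2_cst (c : R) : measurable2 (fun _ _ => c).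
Proof. exact: measurable_cst. Qed.

Lemma dint_add F G : measurable2 F -> measurable2 G ->
  (forall x y, 0 <= F x y) -> (forall x y, 0 <= G x y) ->
  dint (fun x y => F x y + G x y) = (dint F + dint G)%E.
Proof.
move=> mF mG F0 G0; rewrite !dintE//; first exact: nnint_add.
- exact: measurable2D.
- by move=> x y; rewrite addr_ge0.
Qed.

Lemma dint_scale (c : R) F : measurable2 F -> (forall x y, 0 <= F x y) -> 0 <= c ->
  dint (fun x y => c * F x y) = (c%:E * dint F)%E.
Proof.
move=> mF F0 c0; rewrite !dintE//; first exact: nnint_scale.
- by apply: measurable2M mF; exact: measurable2_cst.
- by move=> x y; rewrite mulr_ge0.
Qed.

Lemma dint_swap F : measurable2 F -> (forall x y, 0 <= F x y) ->
  dint (fun x y => F y x) = dint F.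
Proof.
move=> mF F0; rewrite /dint.
rewrite (@fubini_tonelli _ _ _ _ _ mu mu (fun z => (F z.1 z.2)%:E))//.
  exact/measurable_EFinP.
by move=> z; rewrite lee_fin.
Qed.

Lemma dint_shift F : measurable2 F -> (forall x y, 0 <= F x y) ->
  dint (fun x y => F x (x + y)) = dint F.
Proof.
move=> mF F0; apply: eq_integral => x _.
rewrite (@integral_rV_addl R n x (fun y => (F x y)%:E))//.
  by apply/measurable_EFinP; exact: measurable2_y.
by move=> y; rewrite lee_fin.
Qed.

Lemma dint_opp F : measurable2 F -> (forall x y, 0 <= F x y) ->
  dint (fun x y => F x (- y)) = dint F.
Proof.
move=> mF F0; apply: eq_integral => x _.
rewrite (@integral_rV_opp R n (fun y => (F x y)%:E))//.
  by apply/measurable_EFinP; exact: measurable2_y.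
by move=> y; rewrite lee_fin.
Qed.

Lemma dint_shiftN F : measurable2 F -> (forall x y, 0 <= F x y) ->
  dint (fun x y => F x (x - y)) = dint F.
Proof.
move=> mF F0; rewrite -[RHS]dint_shift//.
rewrite -(dint_opp (F := fun x y => F x (x + y)))//.
exact: (measurable2_comp (g := fst) mF measurable_fst measurable_zadd).
Qed.

Lemma dint_wl (w : rV -> R) F : measurable2 F -> (forall x y, 0 <= F x y) ->
  (forall x, 0 <= w x) ->
  dint (fun x y => w x * F x y) =
  (\int[mu]_x ((w x)%:E * \int[mu]_y (F x y)%:E))%E.
Proof.
move=> mF F0 w0; apply: eq_integral => x _; apply: nnint_scale => //.
exact: measurable2_y.
Qed.

Lemma measurable_dint_inner F : measurable2 F -> (forall x y, 0 <= F x y) ->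
  measurable_fun setT (fun x => \int[mu]_y (F x y)%:E)%E.
Proof.
move=> mF F0; apply: (@measurable_fun_fubini_tonelli_F _ _ _ _ _ mu
  (fun z => (F z.1 z.2)%:E)); first exact/measurable_EFinP.
by move=> z; rewrite lee_fin.
Qed.

Lemma eq_dint F G : (forall x y, F x y = G x y) -> dint F = dint G.
Proof. by move=> FG; congr dint; apply/funext => x; apply/funext => y. Qed.

Lemma dint_def F : dint F = (\int[mu]_x \int[mu]_y (F x y)%:E)%E.
Proof. by []. Qed.

End double_integral.

(* Unification must not unfold these when trying to close side conditions. *)
#[global] Opaque dint measurable2.

(** * The squared Sobolev-Slobodeckij norm *)

Section Hsq.
Context {R : realType} {n : nat} (s : R).
Local Notation rV := 'rV[R]_n.
Local Notation mu := (@lebesgue_rV R n).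
Local Notation k := (@rker R n s).
Implicit Types u v : rV -> R.

Definition L2sq u : \bar R := (\int[mu]_x (u x ^+ 2)%:E)%E.

(** This is the square of [Hs_norm]. For it the inequality [Hsq_add], with a factor 2, replaces the
    triangle inequality and needs no Minkowski argument. *)
Definition Hsq u : \bar R := (L2sq u + gagliardo s u)%E.

Lemma L2sqE u : L2sq u = (\int[mu]_x (u x ^+ 2)%:E)%E.
Proof. by []. Qed.

Lemma gagliardoE u :
  gagliardo s u = dint (fun x y => (u x - u y) ^+ 2 * k (x - y)).
Proof. by rewrite dint_def. Qed.

Lemma gag_pt_ge0 u x y z : 0 <= (u x - u y) ^+ 2 * k z.
Proof. by rewrite mulr_ge0 ?sqr_ge0 ?rker_ge0. Qed.

Lemma L2sq_ge0 u : (0 <= L2sq u)%E.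
Proof. by apply: nnint_ge0 => x; exact: sqr_ge0. Qed.

Lemma gagliardo_ge0 u : (0 <= gagliardo s u)%E.
Proof. by apply: dint_ge0 => x y; exact: gag_pt_ge0. Qed.

Lemma Hsq_ge0 u : (0 <= Hsq u)%E.
Proof. exact: adde_ge0 (L2sq_ge0 u) (gagliardo_ge0 u). Qed.

Lemma Hs_normE u : Hs_norm s u = (Hsq u `^ 2^-1)%E.
Proof.
rewrite /Hs_norm /Hsq; congr ((_ + _) `^ _)%E.
rewrite unlock -poweRrM mulVf// poweRe1; last first.
  by apply: integral_ge0 => x _; rewrite poweR_ge0.
apply: eq_integral => x _ /=.
by rewrite powR_mulrn// real_normK ?num_real.
Qed.

Lemma Hs_normW u : (Hs_norm s u < +oo)%E <-> (Hsq u < +oo)%E.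
Proof.
rewrite Hs_normE; split=> [|Q]; last exact: poweR_lty.
by apply: lty_poweRy; rewrite invr_eq0.
Qed.

Lemma HsE u : Hs s u <-> measurable_fun setT u /\ (Hsq u < +oo)%E.
Proof. by split=> -[mf /Hs_normW Q]. Qed.

Lemma Hs_norm_lt u e : 0 < e -> (Hs_norm s u < e%:E)%E <-> (Hsq u < (e ^+ 2)%:E)%E.
Proof.
move=> e0; rewrite Hs_normE.
have [Qoo|] := ltP (Hsq u) +oo%E; last first.
  by rewrite leye_eq => /eqP ->; rewrite poweRyr ?invr_eq0//; split.
have Qf : Hsq u \is a fin_num by rewrite ge0_fin_numE ?Hsq_ge0.
have Q0 : 0 <= fine (Hsq u) by rewrite fine_ge0 ?Hsq_ge0.
rewrite -(fineK Qf) poweR_EFin !lte_fin powR12_sqrt//.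
rewrite -[X in Num.sqrt _ < X]gtr0_norm// -sqrtr_sqr ltr_sqrt//.
by rewrite exprn_gt0.
Qed.

Lemma measurable_gag u : measurable_fun setT u ->
  measurable2 (fun x y => (u x - u y) ^+ 2 * k (x - y)).
Proof.
move=> mf; apply: measurable2M; last exact: measurable2_sub (measurable_rker s).
by apply: measurable2X; apply: measurable2B; [exact: measurable2_1|exact: measurable2_2].
Qed.

Lemma gag_ge0 u x y : 0 <= (u x - u y) ^+ 2 * k (x - y).
Proof. exact: gag_pt_ge0. Qed.

Lemma gagliardo_shift u : measurable_fun setT u ->
  gagliardo s u = dint (fun x y => (u x - u (x + y)) ^+ 2 * k y).
Proof.
move=> mf; rewrite gagliardoE -(dint_shift (measurable_gag mf) (gag_ge0 u)).
by apply: eq_dint => x y; rewrite opprD addNKr rkerN.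
Qed.

Lemma gagliardo_shiftN u : measurable_fun setT u ->
  gagliardo s u = dint (fun x y => (u x - u (x - y)) ^+ 2 * k y).
Proof.
move=> mf; rewrite gagliardoE -(dint_shiftN (measurable_gag mf) (gag_ge0 u)).
by apply: eq_dint => x y; rewrite subKr.
Qed.

Lemma measurable_sqr u : measurable_fun setT u ->
  measurable_fun setT (fun x => u x ^+ 2).
Proof. exact: measurable_funX. Qed.

#[local] Opaque L2sq gagliardo.

Lemma L2sq_scale c u : measurable_fun setT u ->
  L2sq (fun x => c * u x) = ((c ^+ 2)%:E * L2sq u)%E.
Proof.
move=> mf; rewrite !L2sqE.
rewrite -(nnint_scale mu (measurable_sqr mf) (fun x => sqr_ge0 (u x)) (sqr_ge0 c)).
by apply: eq_integral => x _; rewrite exprMn.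
Qed.

Lemma gagliardo_scale c u : measurable_fun setT u ->
  gagliardo s (fun x => c * u x) = ((c ^+ 2)%:E * gagliardo s u)%E.
Proof.
move=> mf; rewrite !gagliardoE -(dint_scale (measurable_gag mf) (gag_ge0 u) (sqr_ge0 c)).
by apply: eq_dint => x y; rewrite -mulrBr exprMn mulrA.
Qed.

Lemma Hsq_scale c u : measurable_fun setT u ->
  Hsq (fun x => c * u x) = ((c ^+ 2)%:E * Hsq u)%E.
Proof.
move=> mf; rewrite /Hsq (ge0_muleDr _ (L2sq_ge0 u) (gagliardo_ge0 u)).
by rewrite L2sq_scale// gagliardo_scale.
Qed.

Lemma HsqN u : measurable_fun setT u -> Hsq (fun x => - u x) = Hsq u.
Proof.
move=> mf; have := Hsq_scale (-1) mf.
rewrite sqrrN expr1n mul1e => <-; congr Hsq.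
by apply/funext => x; rewrite mulN1r.
Qed.

Lemma sqrD_le (a b : R) : (a + b) ^+ 2 <= 2 * (a ^+ 2 + b ^+ 2).
Proof. by have := sqr_ge0 (a - b); rewrite !expr2 => ?; nra. Qed.

Lemma L2sq_le u v : measurable_fun setT u -> measurable_fun setT v ->
  (forall x, u x ^+ 2 <= v x ^+ 2) -> (L2sq u <= L2sq v)%E.
Proof.
move=> mf mv uv; rewrite !L2sqE.
exact: nnint_le (measurable_sqr mf) (measurable_sqr mv) (fun x => sqr_ge0 (u x)) uv.
Qed.

Lemma L2sq_add u v : measurable_fun setT u -> measurable_fun setT v ->
  (L2sq (fun x => u x + v x)%R <= 2%:E * (L2sq u + L2sq v))%E.
Proof.
move=> mf mv; rewrite !L2sqE.
rewrite -(nnint_add mu (measurable_sqr mf) (measurable_sqr mv)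
  (fun x => sqr_ge0 (u x)) (fun x => sqr_ge0 (v x))).
have m2 := measurable_funD (measurable_sqr mf) (measurable_sqr mv).
have p2 x : 0 <= u x ^+ 2 + v x ^+ 2 by rewrite addr_ge0 ?sqr_ge0.
rewrite -(nnint_scale mu m2 p2 (ler0n _ 2)).
apply: nnint_le.
- by apply: measurable_sqr; exact: measurable_funD.
- exact: measurable_funM m2.
- by move=> x; exact: sqr_ge0.
- by move=> x; exact: sqrD_le.
Qed.

Lemma gagliardo_add u v : measurable_fun setT u -> measurable_fun setT v ->
  (gagliardo s (fun x => u x + v x)%R <= 2%:E * (gagliardo s u + gagliardo s v))%E.
Proof.
move=> mf mv; rewrite !gagliardoE.
rewrite -(dint_add (measurable_gag mf) (measurable_gag mv) (gag_ge0 u) (gag_ge0 v)).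
have m2 := measurable2D (measurable_gag mf) (measurable_gag mv).
have p2 x y := addr_ge0 (gag_ge0 u x y) (gag_ge0 v x y).
rewrite -(dint_scale m2 p2 (ler0n _ 2)).
apply: dint_le.
- by apply: measurable_gag; exact: measurable_funD.
- by apply: measurable2M m2; exact: measurable2_cst.
- by move=> x y; rewrite mulr_ge0 ?sqr_ge0 ?rker_ge0.
- move=> x y; rewrite -mulrDl mulrA ler_wpM2r ?rker_ge0//.
  by rewrite opprD addrACA; exact: sqrD_le.
Qed.

Lemma Hsq_add u v : measurable_fun setT u -> measurable_fun setT v ->
  (Hsq (fun x => u x + v x)%R <= 2%:E * (Hsq u + Hsq v))%E.
Proof.
move=> mf mv.
rewrite (_ : Hsq u + Hsq v = L2sq u + L2sq v + (gagliardo s u + gagliardo s v))%E;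
  last by rewrite /Hsq addeACA.
rewrite (ge0_muleDr _ (adde_ge0 (L2sq_ge0 u) (L2sq_ge0 v))
  (adde_ge0 (gagliardo_ge0 u) (gagliardo_ge0 v))).
by apply: leeD; [exact: L2sq_add|exact: gagliardo_add].
Qed.

Lemma L2sq_ae0 u : measurable_fun setT u ->
  L2sq u = 0%E <-> ae_eq_on setT u (cst 0).
Proof.
move=> mf; have m2 : measurable_fun setT (fun x => (u x ^+ 2)%:E).
  by apply/measurable_EFinP; exact: measurable_funX.
rewrite L2sqE (_ : (\int[mu]_x _)%E = \int[mu]_x `|(u x ^+ 2)%:E|)%E; last first.
  by apply: eq_integral => x _; rewrite /= ger0_norm ?sqr_ge0.
split=> [/(ae_eq_integral_abs mu measurableT m2)|u0].
  apply: filterS => x /= u0 _; have := u0 I => -[] /eqP.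
  by rewrite sqrf_eq0 => /eqP.
apply/(ae_eq_integral_abs mu measurableT m2); apply: filterS u0 => x u0 _ /=.
by rewrite u0// expr0n.
Qed.

(** The kernel has no finite integral near the diagonal, so the seminorm is split by (a - b)^2 <= 2
    (a^2 + b^2). The integral of u(x)^2 k(x - y) vanishes since for almost every x its inner
    integrand is identically zero; the other half follows by exchanging the variables. *)
Lemma Hsq_ae0 u : measurable_fun setT u -> ae_eq_on setT u (cst 0) -> Hsq u = 0%E.
Proof.
move=> mf u0; have L0 : L2sq u = 0%E by apply/L2sq_ae0.
rewrite /Hsq L0 add0e; apply/eqP; rewrite eq_le gagliardo_ge0 andbT gagliardoE.
have mu2 := measurable_sqr mf.
have mk2 := measurable2_sub (measurable_rker (n := n) s).
have mF : measurable2 (fun x y => u x ^+ 2 * k (x - y)).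
  by apply: measurable2M mk2; exact: measurable2_1.
have mG : measurable2 (fun x y => u y ^+ 2 * k (x - y)).
  by apply: measurable2M mk2; exact: measurable2_2.
have F0 x y : 0 <= u x ^+ 2 * k (x - y) by rewrite mulr_ge0 ?sqr_ge0 ?rker_ge0.
have G0 x y : 0 <= u y ^+ 2 * k (x - y) by rewrite mulr_ge0 ?sqr_ge0 ?rker_ge0.
have dF0 : dint (fun x y => u x ^+ 2 * k (x - y)) = 0%E.
  rewrite dint_def (@ge0_ae_eq_integral _ _ _ mu _ _ (cst 0%E))//.
  - by rewrite integral0.
  - exact: measurable_dint_inner.
  - by move=> x _; apply: integral_ge0 => y _; rewrite lee_fin.
  - apply: filterS u0 => x u0 _ /=.
    by apply: integral0_eq => y _; rewrite u0// expr0n mul0r.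
have dG0 : dint (fun x y => u y ^+ 2 * k (x - y)) = 0%E.
  rewrite -[RHS]dF0 -(dint_swap mF F0); apply: eq_dint => x y.
  by rewrite -rkerN opprB.
apply: (@le_trans _ _ (dint (fun x y =>
    2 * (u x ^+ 2 * k (x - y) + u y ^+ 2 * k (x - y))))).
  apply: dint_le.
  - exact: measurable_gag.
  - by apply: measurable2M; [exact: measurable2_cst|exact: measurable2D].
  - by move=> x y; exact: gag_pt_ge0.
  - move=> x y; rewrite -mulrDl mulrA ler_wpM2r ?rker_ge0//.
    by rewrite -[u y ^+ 2]sqrrN; exact: sqrD_le.
rewrite (dint_scale (measurable2D mF mG) (fun x y => addr_ge0 (F0 x y) (G0 x y)))//.
by rewrite (dint_add mF mG F0 G0) dF0 dG0 adde0 mule0.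
Qed.

End Hsq.

#[global] Opaque L2sq gagliardo.

(** * Square-integrable pairings and a Cauchy-Schwarz inequality with a free parameter *)

Section L2_pairing.
Context d (T : measurableType d) (R : realType) (m : {measure set T -> \bar R}).
Implicit Types f g : T -> R.

Definition L2fun f :=
  measurable_fun setT f /\ (\int[m]_x (f x ^+ 2)%:E < +oo)%E.

Definition L2n f : R := fine (\int[m]_x (f x ^+ 2)%:E)%E.

Lemma mean_geo_le (a b l : R) : 0 < l -> `|a * b| <= 2^-1 * (l * a ^+ 2 + l^-1 * b ^+ 2).
Proof.
move=> l0; rewrite ler_norml.
have h1 := sqr_ge0 (l * a - b); have h2 := sqr_ge0 (l * a + b).
have li : 0 < l^-1 by rewrite invr_gt0.
have E1 : l^-1 * (l * a - b) ^+ 2 = l * a ^+ 2 + l^-1 * b ^+ 2 - 2 * (a * b).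
  by field; rewrite gt_eqF.
have E2 : l^-1 * (l * a + b) ^+ 2 = l * a ^+ 2 + l^-1 * b ^+ 2 + 2 * (a * b).
  by field; rewrite gt_eqF.
have := mulr_ge0 (ltW li) h1; have := mulr_ge0 (ltW li) h2; rewrite E1 E2.
move: (l * a ^+ 2 + l^-1 * b ^+ 2) (a * b) => A B ? ?.
by apply/andP; split; lra.
Qed.

Lemma L2fun_integrable_sqr f : L2fun f ->
  m.-integrable setT (EFin \o (fun x => f x ^+ 2)).
Proof.
move=> [mf foo]; apply/integrableP; split.
  by apply/measurable_EFinP; exact: measurable_funX.
rewrite (_ : (\int[m]_x _)%E = \int[m]_x (f x ^+ 2)%:E)%E//.
by apply: eq_integral => x _; rewrite /= ger0_norm ?sqr_ge0.
Qed.

Lemma integrable_add_scale (a b : R) (F G : T -> R) :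
  m.-integrable setT (EFin \o F) -> m.-integrable setT (EFin \o G) ->
  m.-integrable setT (EFin \o (fun x => a * F x + b * G x)).
Proof.
move=> iF iG; have := integrableD measurableT (integrableZl measurableT a iF)
  (integrableZl measurableT b iG).
by apply: eq_integrable => // x _ /=; rewrite EFinD !EFinM.
Qed.

Lemma Rintegral_add_scale (a b : R) (F G : T -> R) :
  m.-integrable setT (EFin \o F) -> m.-integrable setT (EFin \o G) ->
  \int[m]_x (a * F x + b * G x) = a * \int[m]_x F x + b * \int[m]_x G x.
Proof.
move=> iF iG.
have E (c : R) H : m.-integrable setT (EFin \o H) ->
    m.-integrable setT (EFin \o (fun x => c * H x)).
  by move=> iH; have := integrableZl measurableT c iH; apply: eq_integrable.
by rewrite RintegralD ?RintegralZl//; exact: E.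
Qed.

Lemma pairing_integrable f g : L2fun f -> L2fun g ->
  m.-integrable setT (EFin \o (fun x => f x * g x)).
Proof.
move=> Lf Lg.
have := integrable_add_scale 2^-1 2^-1 (L2fun_integrable_sqr Lf) (L2fun_integrable_sqr Lg).
apply: le_integrable => //.
  by apply/measurable_EFinP; apply: measurable_funM; [case: Lf|case: Lg].
move=> x _ /=; rewrite lee_fin.
have := @mean_geo_le (f x) (g x) 1 ltr01; rewrite invr1 !mul1r => h.
by apply: le_trans (ler_norm _); rewrite -mulrDr.
Qed.

(** Cauchy-Schwarz with the parameter [l] left free: the two terms of the form can be bounded with
    the same [l] and added, and [optimize_scale] chooses it at the end. *)
Lemma pairing_bound f g (l : R) : L2fun f -> L2fun g -> 0 < l ->
  `|\int[m]_x (f x * g x)| <= 2^-1 * (l * L2n f + l^-1 * L2n g).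
Proof.
move=> Lf Lg l0.
have i2f := L2fun_integrable_sqr Lf; have i2g := L2fun_integrable_sqr Lg.
rewrite mulrDr !mulrA -[L2n f]/(\int[m]_x (f x ^+ 2)) -[L2n g]/(\int[m]_x (g x ^+ 2)).
rewrite -Rintegral_add_scale//.
apply: le_trans (le_normr_Rintegral measurableT (pairing_integrable Lf Lg)) _.
apply: le_Rintegral => //.
- have := pairing_integrable Lf Lg => /integrable_abse.
  by apply: eq_integrable.
- exact: integrable_add_scale.
- by move=> x _; rewrite -!mulrA -mulrDr; exact: mean_geo_le.
Qed.

Lemma pairing_linl (a : R) f f' g : L2fun f -> L2fun f' -> L2fun g ->
  \int[m]_x ((a * f x + f' x) * g x) =
  a * \int[m]_x (f x * g x) + \int[m]_x (f' x * g x).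
Proof.
move=> Lf Lf' Lg; rewrite -[X in _ + X]mul1r.
rewrite -(Rintegral_add_scale _ _ (pairing_integrable Lf Lg) (pairing_integrable Lf' Lg)).
by apply: eq_Rintegral => x _; rewrite mulrDl mul1r mulrA.
Qed.

Lemma pairing_linr (a : R) f g g' : L2fun f -> L2fun g -> L2fun g' ->
  \int[m]_x (f x * (a * g x + g' x)) =
  a * \int[m]_x (f x * g x) + \int[m]_x (f x * g' x).
Proof.
move=> Lf Lg Lg'; rewrite -[X in _ + X]mul1r.
rewrite -(Rintegral_add_scale _ _ (pairing_integrable Lf Lg) (pairing_integrable Lf Lg')).
by apply: eq_Rintegral => x _; rewrite mulrDr mul1r mulrCA.
Qed.

End L2_pairing.

Lemma pairing_constants_le (R : realFieldType) (l l' c N : R) (Lu Lv Gu Gv : R) :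
  0 <= l -> 0 <= l' -> 0 <= c -> 0 <= N -> 0 <= Lu -> 0 <= Lv -> 0 <= Gu -> 0 <= Gv ->
  c * (2^-1 * (l * Gu + l' * Gv)) + 2^-1 * (l * (N * Lu) + l' * Lv) <=
  (c + (N + 1)) * (l * (Lu + Gu) + l' * (Lv + Gv)).
Proof.
move=> l0 l'0 c0 N0 Lu0 Lv0 Gu0 Gv0; rewrite [l * (N * _)]mulrCA !mulrDr.
have := mulr_ge0 l0 Gu0; have := mulr_ge0 l'0 Gv0.
have := mulr_ge0 l0 Lu0; have := mulr_ge0 l'0 Lv0.
move: (l * Gu) (l' * Gv) (l * Lu) (l' * Lv) => a1 a2 a3 a4 p4 p3 p2 p1.
have := mulr_ge0 c0 p1; have := mulr_ge0 c0 p2; have := mulr_ge0 c0 p3; have := mulr_ge0 c0 p4.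
have := mulr_ge0 N0 p1; have := mulr_ge0 N0 p2; have := mulr_ge0 N0 p3; have := mulr_ge0 N0 p4.
rewrite !mulrDl !mul1r; lra.
Qed.

Lemma optimize_scale (R : realType) (C a b X : R) : 0 <= C -> 0 <= a -> 0 <= b ->
  (forall l, 0 < l -> X <= C * (l * a + l^-1 * b)) ->
  X <= 2 * C * Num.sqrt a * Num.sqrt b.
Proof.
move=> C0 a0 b0; rewrite -{1}[a]sqr_sqrtr// -{1}[b]sqr_sqrtr//.
have := sqrtr_ge0 a; have := sqrtr_ge0 b.
move: (Num.sqrt a) (Num.sqrt b) => {a0 b0} {}a {}b b0 a0 Hl.
apply/ler_addgt0Pr => e e0.
have pos (t : R) : 0 < C * t ^+ 2 + 1 by rewrite ltr_wpDl// mulr_ge0// sqr_ge0.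
have lt1 (t : R) : C * t ^+ 2 * (e / (C * t ^+ 2 + 1)) <= e.
  by rewrite mulrCA ger_pMr// ler_pdivrMr// mul1r lerDl.
move: a0; rewrite le_eqVlt => /predU1P[a0|a0].
  (* For [a = 0] the infimum is only approached as [l] grows; this value brings the bound below [e].
     The case [b = 0] is symmetric with a small [l], and otherwise [l = b / a] is optimal. *)
  rewrite -a0 mulr0 mul0r add0r; apply: le_trans (Hl ((C * b ^+ 2 + 1) / e) _) _.
    by rewrite divr_gt0.
  by rewrite -a0 expr0n mulr0 add0r invf_div mulrCA mulrC.
move: b0; rewrite le_eqVlt => /predU1P[b0|b0].
  rewrite -b0 mulr0 add0r; apply: le_trans (Hl (e / (C * a ^+ 2 + 1)) _) _.
    by rewrite divr_gt0.
  by rewrite -b0 expr0n mulr0 addr0 mulrCA mulrC.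
apply: le_trans (Hl (b / a) _) _; first by rewrite divr_gt0.
rewrite invf_div; have -> : b / a * a ^+ 2 = a * b by field; rewrite gt_eqF.
have -> : a / b * b ^+ 2 = a * b by field; rewrite gt_eqF.
have := mulr_ge0 (mulr_ge0 C0 (ltW a0)) (ltW b0).
by rewrite -!mulrA mulrDr; move: (C * (a * b)) => z; lra.
Qed.

(** * Linearity and continuity of the bilinear form *)

Section bilinear_form.
Context {R : realType} {n : nat} (s : R).
Local Notation rV := 'rV[R]_n.
Local Notation mu := (@lebesgue_rV R n).
Local Notation k := (@rker R n s).
Variables (Gam Om : set rV) (q : rV -> R).
Hypothesis mGam : measurable Gam.
Hypothesis qL : q \_ Om \in Lfun (lebesgue_rV n) +oo%E.
Implicit Types u v : rV -> R.

(** Clamping [q] to [-M, M], with M its essential supremum, changes it on a null set only and makes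
    the bound hold at every point. *)
Lemma ess_bounded_repr : exists (q' : rV -> R) (M : R),
  [/\ measurable_fun setT q', forall x, `|q' x| <= M &
      {ae mu, forall x, q' x = (q \_ Om) x}].
Proof.
have mq : measurable_fun setT (q \_ Om).
  exact: set_mem (sub_Lfun_mfun qL).
have /set_mem := sub_Lfun_finLfun qL.
rewrite /= /finite_norm unlock; case: ifPn => [mu0 qoo|]; last first.
  rewrite -leNgt => mu0 _; exists (cst 0), 0; split => //; first by move=> x; rewrite normr0.
  have m0 : mu setT = 0%E by apply/eqP; rewrite eq_le mu0 measure_ge0.
  by exists setT; split.
have [M HM] : exists M : R, ess_sup mu (abse \o (EFin \o (q \_ Om))) = M%:E.
  move: qoo; case E: (ess_sup _ _) => [M| |]//= _; first by exists M.
  have : (0 <= ess_sup mu (abse \o (EFin \o (q \_ Om))))%E.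
    by apply: ess_sup_gee => //; apply: nearW => x; exact: abse_ge0.
  by rewrite E.
pose c x := Num.max (- M) (Num.min M ((q \_ Om) x)).
have aeM : {ae mu, forall x, (`|(q \_ Om) x| <= M)%R}.
  have /ess_supP : (ess_sup mu (abse \o (EFin \o (q \_ Om))) <= M%:E)%E by rewrite HM.
  by apply: filterS => x /=; rewrite lee_fin.
exists c, `|M|; split.
- by apply: measurable_maxr => //; exact: measurable_minr.
- move=> x; rewrite /c; have := ler_norm M; have := ler_norm (- M); rewrite normrN => h1 h2.
  rewrite ler_norml; apply/andP; split.
    by rewrite le_max; apply/orP; left; lra.
  by rewrite ge_max; apply/andP; split => //; rewrite ge_min h2.
- apply: filterS aeM => x; rewrite ler_norml => /andP[h1 h2].
  by rewrite /c min_r// max_r.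
Qed.

(** Giving the square root of the kernel to each increment turns the nonlocal term into a pairing in
    L^2 of the product space, with factors [diffp] and [diffm]. *)
Definition sker (y : rV) : R := k y `^ 2^-1.

Lemma sker_sqr y : sker y ^+ 2 = k y.
Proof. by rewrite -powR_mulrn ?powR_ge0// -powRrM mulVf// powRr1// rker_ge0. Qed.

Lemma measurable_sker : measurable_fun setT sker.
Proof. exact: (measurableT_comp (measurable_powR _) (measurable_rker s)). Qed.

Definition diffp u (z : rV * rV) : R := \1_Gam z.2 * (u z.1 - u (z.1 + z.2)) * sker z.2.
Definition diffm v (z : rV * rV) : R := (v z.1 - v (z.1 - z.2)) * sker z.2.

Lemma measurable_diffp u : measurable_fun setT u -> measurable_fun setT (diffp u).
Proof.
move=> mf; apply: measurable_funM; last first.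
  exact: (measurableT_comp measurable_sker measurable_snd).
apply: measurable_funM.
  by apply: (measurableT_comp _ measurable_snd); exact: measurable_indic.
apply: measurable_funB; first exact: (measurableT_comp mf measurable_fst).
exact: (measurableT_comp mf measurable_zadd).
Qed.

Lemma measurable_diffm u : measurable_fun setT u -> measurable_fun setT (diffm u).
Proof.
move=> mf; apply: measurable_funM; last first.
  exact: (measurableT_comp measurable_sker measurable_snd).
apply: measurable_funB; first exact: (measurableT_comp mf measurable_fst).
exact: (measurableT_comp mf measurable_zsub).
Qed.

Let pi := (mu \x mu)%E.

Lemma diffp_sqr_le u : measurable_fun setT u ->
  (\int[pi]_z (diffp u z ^+ 2)%:E <= gagliardo s u)%E.
Proof.
move=> mf; rewrite (gagliardo_shift s mf) dintE; last 2 first.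
- apply: measurable2M (measurable2_2 (measurable_rker s)).
  apply: measurable2X; apply: measurable2B; first exact: measurable2_1.
  exact: measurable2_add.
- by move=> x y; exact: gag_pt_ge0.
apply: nnint_le.
- by apply: measurable_funX; exact: measurable_diffp.
- apply: measurable_funM; last exact: (measurableT_comp (measurable_rker s) measurable_snd).
  apply: measurable_funX; apply: measurable_funB.
    exact: (measurableT_comp mf measurable_fst).
  exact: (measurableT_comp mf measurable_zadd).
- by move=> z; exact: sqr_ge0.
- move=> z; rewrite /diffp exprMn sker_sqr ler_wpM2r ?rker_ge0// exprMn.
  by rewrite ler_piMl ?sqr_ge0// indicE; case: (_ \in _); rewrite ?expr1n ?expr0n.
Qed.

Lemma diffm_sqr u : measurable_fun setT u ->
  (\int[pi]_z (diffm u z ^+ 2)%:E = gagliardo s u)%E.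
Proof.
move=> mf; rewrite (gagliardo_shiftN s mf) dintE; last 2 first.
- apply: measurable2M (measurable2_2 (measurable_rker s)).
  apply: measurable2X; apply: measurable2B; first exact: measurable2_1.
  exact: measurable2_sub.
- by move=> x y; exact: gag_pt_ge0.
by apply: eq_integral => z _; rewrite /diffm exprMn sker_sqr.
Qed.

Lemma gagliardo_lty u : Hs s u -> (gagliardo s u < +oo)%E.
Proof.
by move=> /HsE[_]; apply: le_lt_trans; rewrite /Hsq leeDr// L2sq_ge0.
Qed.

Lemma L2sq_lty u : Hs s u -> (L2sq u < +oo)%E.
Proof.
by move=> /HsE[_]; apply: le_lt_trans; rewrite /Hsq leeDl// gagliardo_ge0.
Qed.

Lemma Hs_meas u : Hs s u -> measurable_fun setT u.
Proof. by case. Qed.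

Lemma Hsq_fin u : Hs s u -> Hsq s u \is a fin_num.
Proof. by move=> /HsE[_]; rewrite ge0_fin_numE// Hsq_ge0. Qed.

Lemma L2fun_diffp u : Hs s u -> L2fun pi (diffp u).
Proof.
move=> Hu; have mf := Hs_meas Hu; split; first exact: measurable_diffp.
exact: le_lt_trans (diffp_sqr_le mf) (gagliardo_lty Hu).
Qed.

Lemma L2fun_diffm u : Hs s u -> L2fun pi (diffm u).
Proof.
move=> Hu; have mf := Hs_meas Hu; split; first exact: measurable_diffm.
by rewrite diffm_sqr// gagliardo_lty.
Qed.

Lemma nonlocal_prod u v : Hs s u -> Hs s v ->
  \int[mu]_x \int[mu]_(y in Gam)
     ((u x - u (x + y)) * (v x - v (x - y)) / kernel_den s y) =
  \int[pi]_z (diffp u z * diffm v z).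
Proof.
move=> Hu Hv; have iP := pairing_integrable (L2fun_diffp Hu) (L2fun_diffm Hv).
pose F := fubini_F mu (EFin \o (fun z => diffp u z * diffm v z)).
have FE x : (\int[mu]_(y in Gam)
    (((u x - u (x + y)) * (v x - v (x - y)) / kernel_den s y))%:E)%E = F x.
  rewrite integral_mkcond; apply: eq_integral => y _ /=.
  rewrite /patch /diffp /diffm /= indicE; case: ifP => _; last by rewrite !mul0r.
  rewrite -rkerE -sker_sqr mul1r expr2.
  by rewrite mulrACA -!mulrA.
rewrite /Rintegral -(integral12_prod_meas1 iP).
congr fine; apply: ae_eq_integral => //.
- apply/measurable_EFinP; rewrite (_ : (fun x => _) = fine \o F).
    by apply: (measurableT_comp _ (measurable_fubini_F iP)).
  by apply/funext => x; rewrite /= FE.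
- exact: (measurable_fubini_F iP).
(* The real-valued inner integral is [fine] of the extended one, which is faithful where that one is
   finite, thus for almost every [x]. *)
- apply: filterS (ae_integrable1 iP) => x ix _.
  rewrite FE fineK//; exact: integrable_fin_num.
Qed.

Lemma qterm_repr : exists (q' : rV -> R) (M : R),
  [/\ measurable_fun setT q', forall x, `|q' x| <= M &
   forall u v, measurable_fun setT u -> measurable_fun setT v ->
     \int[mu]_(x in Om) (q x * u x * v x) = \int[mu]_x (q' x * u x * v x)].
Proof.
have [q' [M [mq' q'M q'q]]] := ess_bounded_repr.
exists q', M; split => // u v mf mv.
have mq : measurable_fun setT (q \_ Om) by exact: set_mem (sub_Lfun_mfun qL).
rewrite Rintegral_mkcond /Rintegral.
have -> : (fun x => (((fun x => q x * u x * v x) \_ Om) x)%:E) =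
    (fun x => ((q \_ Om) x * u x * v x)%:E).
  by apply/funext => x; rewrite /patch; case: ifP => // _; rewrite !mul0r.
congr fine; apply: ae_eq_integral => //.
- by apply/measurable_EFinP; do 2?apply: measurable_funM.
- by apply/measurable_EFinP; do 2?apply: measurable_funM.
- by apply: filterS q'q => x qx _; rewrite qx.
Qed.

Lemma L2fun_Hs u : Hs s u -> L2fun mu u.
Proof.
by move=> Hu; split; [exact: Hs_meas Hu|rewrite -L2sqE; exact: L2sq_lty].
Qed.

Lemma sqr_mul_bounded_le (q' : rV -> R) (M : R) u : measurable_fun setT q' ->
  (forall x, `|q' x| <= M) -> measurable_fun setT u ->
  (\int[mu]_x ((q' x * u x) ^+ 2)%:E <= (M ^+ 2)%:E * L2sq u)%E.
Proof.
move=> mq' q'M mf; rewrite L2sqE.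
rewrite -(nnint_scale mu (measurable_sqr mf) (fun x => sqr_ge0 (u x)) (sqr_ge0 M)).
apply: nnint_le.
- by apply: measurable_funX; exact: measurable_funM.
- by apply: measurable_funM => //; exact: measurable_funX.
- by move=> x; exact: sqr_ge0.
- move=> x; rewrite exprMn ler_wpM2r ?sqr_ge0// -real_normK ?num_real//.
  by rewrite lerXn2r ?nnegrE// (le_trans _ (q'M x)).
Qed.

Lemma L2fun_qHs (q' : rV -> R) (M : R) u : measurable_fun setT q' ->
  (forall x, `|q' x| <= M) -> Hs s u -> L2fun mu (fun x => q' x * u x).
Proof.
move=> mq' q'M Hu; have mf := Hs_meas Hu; split; first exact: measurable_funM.
apply: le_lt_trans (sqr_mul_bounded_le mq' q'M mf) _.
by rewrite lte_mul_pinfty ?lee_fin ?sqr_ge0// L2sq_lty.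
Qed.

Lemma Hs_lin (a : R) u v : Hs s u -> Hs s v -> Hs s (fun x => a * u x + v x).
Proof.
move=> Hu Hv; have mf := Hs_meas Hu; have mv := Hs_meas Hv.
have mau : measurable_fun setT (fun x => a * u x) by exact: measurable_funM.
apply/HsE; split; first exact: measurable_funD.
apply: le_lt_trans (Hsq_add s mau mv) _.
rewrite lte_mul_pinfty// lte_add_pinfty//; last by case/HsE: Hv.
rewrite Hsq_scale// lte_mul_pinfty ?lee_fin ?sqr_ge0//.
by case/HsE: Hu.
Qed.

Lemma diffp_lin (a : R) u v z :
  diffp (fun x => a * u x + v x) z = a * diffp u z + diffp v z.
Proof. by rewrite /diffp; move: (\1_Gam z.2 : R) => c; ring. Qed.

Lemma diffm_lin (a : R) u v z :
  diffm (fun x => a * u x + v x) z = a * diffm u z + diffm v z.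
Proof. by rewrite /diffm; ring. Qed.

Local Notation B := (B_form s Gam Om q).

Lemma B_form_linl (a : R) u u' v : Hs s u -> Hs s u' -> Hs s v ->
  B (fun x => a * u x + u' x) v = a * B u v + B u' v.
Proof.
move=> Hu Hu' Hv; have [q' [M [mq' q'M Eq]]] := qterm_repr.
have HL := Hs_lin a Hu Hu'.
rewrite /B_form !nonlocal_prod//.
rewrite !Eq; try exact: Hs_meas HL; try exact: Hs_meas Hu; try exact: Hs_meas Hu';
  try exact: Hs_meas Hv.
under eq_Rintegral do rewrite diffp_lin.
rewrite pairing_linl; [|exact: L2fun_diffp|exact: L2fun_diffp|exact: L2fun_diffm].
under [X in _ + X = _]eq_Rintegral do rewrite mulrDr mulrCA.
rewrite (pairing_linl a (L2fun_qHs mq' q'M Hu) (L2fun_qHs mq' q'M Hu') (L2fun_Hs Hv)).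
move: (_^-1) => c; ring.
Qed.

Lemma B_form_linr (a : R) u v v' : Hs s u -> Hs s v -> Hs s v' ->
  B u (fun x => a * v x + v' x) = a * B u v + B u v'.
Proof.
move=> Hu Hv Hv'; have [q' [M [mq' q'M Eq]]] := qterm_repr.
have HL := Hs_lin a Hv Hv'.
rewrite /B_form !nonlocal_prod//.
rewrite !Eq; try exact: Hs_meas HL; try exact: Hs_meas Hu; try exact: Hs_meas Hv';
  try exact: Hs_meas Hv.
under eq_Rintegral do rewrite diffm_lin.
rewrite pairing_linr; [|exact: L2fun_diffp|exact: L2fun_diffm|exact: L2fun_diffm].
rewrite (pairing_linr a (L2fun_qHs mq' q'M Hu) (L2fun_Hs Hv) (L2fun_Hs Hv')).
move: (_^-1) => c; ring.
Qed.

Lemma B_form_bound_scale : exists2 C : R, 0 <= C & forall u v (l : R), Hs s u -> Hs s v ->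
  0 < l -> `|B u v| <= C * (l * fine (Hsq s u) + l^-1 * fine (Hsq s v)).
Proof.
have [q' [M [mq' q'M Eq]]] := qterm_repr.
pose c := `|(2 - 2 `^ (2 * s))^-1 : R|.
have c0 : 0 <= c by exact: normr_ge0.
exists (c + (M ^+ 2 + 1)) => [|u v l Hu Hv l0]; first by rewrite !addr_ge0// sqr_ge0.
have mf := Hs_meas Hu; have mv := Hs_meas Hv.
have finL (w : rV -> R) : Hs s w -> L2sq w \is a fin_num.
  by move=> Hw; rewrite ge0_fin_numE ?L2sq_ge0// L2sq_lty.
have finG (w : rV -> R) : Hs s w -> gagliardo s w \is a fin_num.
  by move=> Hw; rewrite ge0_fin_numE ?gagliardo_ge0// gagliardo_lty.
have L0 (w : rV -> R) : 0 <= fine (L2sq w) by rewrite fine_ge0 ?L2sq_ge0.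
have G0 (w : rV -> R) : 0 <= fine (gagliardo s w) by rewrite fine_ge0 ?gagliardo_ge0.
have l'0 : 0 < l^-1 by rewrite invr_gt0.
have b1 := pairing_bound (L2fun_diffp Hu) (L2fun_diffm Hv) l0.
have b2 := pairing_bound (L2fun_qHs mq' q'M Hu) (L2fun_Hs Hv) l0.
have d1 : L2n pi (diffp u) <= fine (gagliardo s u).
  by apply: fine_le; [|exact: finG|exact: diffp_sqr_le];
    case: (L2fun_diffp Hu) => _; rewrite ge0_fin_numE//; apply: nnint_ge0 => z;
    exact: sqr_ge0.
have d2 : L2n pi (diffm v) = fine (gagliardo s v) by rewrite /L2n diffm_sqr.
have d3 : L2n mu (fun x => q' x * u x) <= M ^+ 2 * fine (L2sq u).
  rewrite -[M ^+ 2 * _]/(fine (M ^+ 2)%:E * fine (L2sq u)) -fineM ?finL//.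
  apply: fine_le; [| |exact: sqr_mul_bounded_le].
    case: (L2fun_qHs mq' q'M Hu) => _; rewrite ge0_fin_numE//; apply: nnint_ge0 => z.
    exact: sqr_ge0.
  by rewrite fin_numM ?finL.
have d4 : L2n mu v = fine (L2sq v) by rewrite /L2n -L2sqE.
have HQ (w : rV -> R) : Hs s w -> fine (Hsq s w) = fine (L2sq w) + fine (gagliardo s w).
  by move=> Hw; rewrite /Hsq (fineD (finL _ Hw) (finG _ Hw)).
rewrite /B_form (nonlocal_prod Hu Hv) (Eq _ _ mf mv) (HQ _ Hu) (HQ _ Hv).
apply: le_trans (ler_normD _ _) _; rewrite normrM -/c.
apply: (@le_trans _ _ (c * (2^-1 * (l * fine (gagliardo s u) + l^-1 * fine (gagliardo s v)))
   + (2^-1 * (l * (M ^+ 2 * fine (L2sq u)) + l^-1 * fine (L2sq v))))).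
  apply: lerD.
    rewrite ler_wpM2l//; apply: le_trans b1 _; rewrite d2 ler_wpM2l//.
    by rewrite lerD2r ler_wpM2l// ltW.
  by apply: le_trans b2 _; rewrite d4 ler_wpM2l// lerD2r ler_wpM2l// ltW.
exact: pairing_constants_le (ltW l0) (ltW l'0) c0 (sqr_ge0 M) (L0 u) (L0 v) (G0 u) (G0 v).
Qed.

Lemma B_form_bound : exists2 C : R, 0 <= C & forall u v, Hs s u -> Hs s v ->
  `|B u v| <= C * Num.sqrt (fine (Hsq s u)) * Num.sqrt (fine (Hsq s v)).
Proof.
have [C C0 HC] := B_form_bound_scale.
exists (2 * C) => [|u v Hu Hv]; first by rewrite mulr_ge0.
apply: optimize_scale => [//|||l l0].
- by rewrite fine_ge0// Hsq_ge0.
- by rewrite fine_ge0// Hsq_ge0.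
- exact: HC.
Qed.

End bilinear_form.

(** * A smooth function that is flat at the origin *)

Section flat_function.
Context {R : realType}.
Implicit Types (p : {poly R}) (t u : R).

(* The family [p (1/t) exp (-1/t)], extended by [0], is closed under derivation. *)
Definition flat p t : R := if 0 < t then p.[t^-1] * expR (- t^-1) else 0.

Lemma flat_pos p t : 0 < t -> flat p t = p.[t^-1] * expR (- t^-1).
Proof. by rewrite /flat => ->. Qed.

Lemma flat_npos p t : t <= 0 -> flat p t = 0.
Proof. by rewrite /flat ltNge => ->. Qed.

(** Monomials satisfy u^k e^(-u) <= k! by the exponential series. The power [m] is carried along so
    that the induction on [p] can absorb each factor X into it. *)
Lemma poly_expRN_bounded p m : exists2 M, 0 <= M &
  forall u, 0 <= u -> `|p.[u] * u ^+ m * expR (- u)| <= M.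
Proof.
have mono k u : 0 <= u -> u ^+ k * expR (- u) <= k`!%:R.
  move=> u0; rewrite expRN ler_pdivrMr ?expR_gt0//.
  case: k => [|k].
    by rewrite expr0 fact0 mul1r; apply: le_trans (expR_ge1Dx u); rewrite lerDl.
  rewrite mulrC -ler_pdivrMr ?ltr0n ?fact_gt0//.
  by apply: le_trans (expR_ge1Dxn k u0); rewrite lerDr.
elim/poly_ind: p m => [|p c IH] m.
  by exists 0 => // u _; rewrite horner0 !mul0r normr0.
have [M M0 HM] := IH m.+1.
exists (M + `|c| * m`!%:R) => [|u u0]; first by rewrite addr_ge0// mulr_ge0.
rewrite hornerD hornerMX hornerC.
have -> : (p.[u] * u + c) * u ^+ m * expR (- u) =
    p.[u] * u ^+ m.+1 * expR (- u) + c * (u ^+ m * expR (- u)).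
  by rewrite exprS; ring.
apply: le_trans (ler_normD _ _) _; apply: lerD; first exact: HM.
rewrite normrM ler_wpM2l// ger0_norm ?mono//.
by rewrite mulr_ge0 ?exprn_ge0 ?expR_ge0.
Qed.

Lemma flat_le p : exists2 M, 0 <= M & forall t, `|flat p t| <= M * `|t|.
Proof.
have [M M0 HM] := poly_expRN_bounded p 1.
exists M => // t; have [t0|t0] := ltP 0 t; last first.
  by rewrite flat_npos// normr0 mulr_ge0.
have ti : 0 <= t^-1 by rewrite invr_ge0 ltW.
have := HM _ ti; rewrite expr1 flat_pos// => h.
rewrite -ler_pdivrMr ?normr_gt0 ?gt_eqF//.
apply: le_trans h; rewrite le_eqVlt; apply/orP; left; apply/eqP.
by rewrite -normfV -normrM; congr (`|_|); ring.
Qed.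

Lemma flat_continuous0 p : {for 0, continuous (flat p)}.
Proof.
have [M M0 HM] := flat_le p.
apply/cvgrPdist_lt => e e0; rewrite flat_npos//.
near=> t; rewrite sub0r normrN; apply: le_lt_trans (HM t) _.
rewrite (@le_lt_trans _ _ ((M + 1) * `|t|))//; first by rewrite ler_wpM2r// lerDl.
rewrite mulrC -ltr_pdivlMr ?ltr_wpDl//.
near: t; apply/nbhs_ballP; exists (e / (M + 1)) => /=; first by rewrite divr_gt0// ltr_wpDl.
by move=> t /=; rewrite sub0r normrN.
Unshelve. all: by end_near. Qed.

Lemma is_derive_flat p t :
  is_derive t 1 (flat p) (flat ('X^2 * (p - p^`())) t).
Proof.
have [t0|t0|<-] := ltgtP 0 t.
- rewrite flat_pos//; have tn : t != 0 by rewrite gt_eqF.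
  apply: (@near_eq_is_derive _ _ _ (fun t => p.[t^-1] * expR (- t^-1))).
    by near=> z; rewrite flat_pos//; near: z; exact: lt_nbhsr.
  have dv := is_deriveV tn (is_derive_id t 1).
  have d1 := is_derive1_comp (is_derive_poly p t^-1) dv.
  have d2 := @is_derive1_comp _ expR (fun y => - y^-1) t _ _
    (is_derive_expR (- t^-1)) (is_deriveN dv).
  apply: (is_derive_eq (is_deriveM d1 d2)) => /=.
  rewrite !hornerE /GRing.scale/=.
  move: (expR _) p.[_] (p^`()).[_] => E u v.
  by field.
- rewrite flat_npos ?ltW//.
  apply: (near_eq_is_derive _ (is_derive_cst (0 : R) t (1 : R))).
  by near=> z; rewrite flat_npos// ltW//; near: z; exact: lt_nbhsl.
(* At the origin the difference quotient is (1/t) p(1/t) e^(-1/t), again a member of the family, and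
   it tends to 0. *)
- apply/is_derive1_caratheodory; exists (flat (p * 'X)); split.
  + move=> z; have [z0|z0] := ltP 0 z; last first.
      by rewrite !flat_npos// mul0r subrr.
    rewrite [flat p 0]flat_npos// !flat_pos// subr0 subr0 hornerMX.
    by field; rewrite gt_eqF.
  + exact: flat_continuous0.
  + by rewrite !flat_npos.
Unshelve. all: by end_near. Qed.

Definition flat1 t : R := flat 1 t.

Lemma flat1_ge0 t : 0 <= flat1 t.
Proof.
by rewrite /flat1 /flat; case: ifP => // _; rewrite hornerC mul1r expR_ge0.
Qed.

Lemma flat1_gt0 t : 0 < t -> 0 < flat1 t.
Proof. by move=> t0; rewrite /flat1 flat_pos// hornerC mul1r expR_gt0. Qed.

Lemma flat1_npos t : t <= 0 -> flat1 t = 0.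
Proof. exact: flat_npos. Qed.

Lemma flat1_homo a b : a <= b -> flat1 a <= flat1 b.
Proof.
move=> ab; have [a0|a0] := ltP 0 a; last by rewrite (flat1_npos a0) flat1_ge0.
have b0 : 0 < b by exact: lt_le_trans ab.
rewrite /flat1 !flat_pos// !hornerC !mul1r ler_expR lerN2 lef_pV2//.
Qed.

Lemma flat1_lipschitz : exists2 M, 0 <= M &
  forall a b, `|flat1 a - flat1 b| <= M * `|a - b|.
Proof.
have [M M0 HM] := poly_expRN_bounded ('X^2) 0.
have dM t : `|flat ('X^2 * (1 - 1^`())) t| <= M.
  have [t0|t0] := ltP 0 t; last by rewrite flat_npos// normr0.
  rewrite flat_pos//; have ti : 0 <= t^-1 by rewrite invr_ge0 ltW.
  have := HM _ ti; rewrite expr0 mulr1; apply: le_trans.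
  by rewrite -polyC1 derivC subr0 polyC1 mulr1.
exists M => //.
suff H a b : a <= b -> `|flat1 a - flat1 b| <= M * `|a - b|.
  move=> a b; have [ab|/ltW ba] := leP a b; first exact: H.
  by rewrite distrC [`|a - b|]distrC; exact: H.
move=> ab; have cont : {within `[a, b], continuous (flat 1)}.
  apply/continuous_subspaceT => t.
  by apply/differentiable_continuous/derivable1_diffP; case: (is_derive_flat 1 t).
have [c _] := MVT_segment ab (fun t _ => is_derive_flat 1 t) cont.
rewrite -/(flat1 a) -/(flat1 b) => E.
rewrite distrC E normrM [`|a - b|]distrC ler_wpM2r//.
Qed.

End flat_function.

(** * Calculus of k times continuously differentiable functions *)

Section Cn_calculus.
Context {R : realType} {n : nat}.
Local Notation rV := 'rV[R]_n.
Local Notation e_ i := (delta_mx ord0 i : rV).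
Implicit Types (f g : rV -> R).

(** The product and quotient rules at order [k.+1] involve the undifferentiated factors at order
    [k]. *)
Lemma Cn_pred k f : Cn k.+1 f -> Cn k f.
Proof.
elim: k f => [|k IH] f [df Df]; first by move=> x; exact: differentiable_continuous.
by split => // i; exact: IH.
Qed.

Lemma Cn_eq k f g : (forall x, f x = g x) -> Cn k f -> Cn k g.
Proof. by move=> /funext ->. Qed.

Lemma Cn_cst k (c : R) : Cn k (fun _ : rV => c).
Proof.
elim: k c => [|k IH] c; first by move=> x; exact: cst_continuous.
split => [x|i]; first exact: differentiable_cst.
by apply: Cn_eq (IH 0) => x; rewrite derive_cst.
Qed.

Lemma Cn_add k f g : Cn k f -> Cn k g -> Cn k (fun x => f x + g x).
Proof.
elim: k f g => [|k IH] f g; first by move=> cf cg x; exact: cvgD (cf x) (cg x).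
move=> [df Df] [dg Dg]; split => [x|i]; first exact: differentiableD.
apply: Cn_eq (IH _ _ (Df i) (Dg i)) => x.
by rewrite deriveD//; exact: diff_derivable.
Qed.

Lemma Cn_mul k f g : Cn k f -> Cn k g -> Cn k (fun x => f x * g x).
Proof.
elim: k f g => [|k IH] f g; first by move=> cf cg x; exact: cvgM (cf x) (cg x).
move=> [df Df] [dg Dg]; split => [x|i]; first exact: differentiableM.
apply: (Cn_eq _ (Cn_add (IH _ _ (Cn_pred (conj df Df)) (Dg i))
  (IH _ _ (Cn_pred (conj dg Dg)) (Df i)))) => x.
by rewrite deriveM//; exact: diff_derivable.
Qed.

Lemma Cn_inv k f : (forall x, f x != 0) -> Cn k f -> Cn k (fun x => (f x)^-1).
Proof.
elim: k f => [|k IH] f f0; first by move=> cf x; exact: cvgV (f0 x) (cf x).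
move=> [df Df]; split => [x|i]; first exact: differentiableV.
have If := IH _ f0 (Cn_pred (conj df Df)).
apply: (Cn_eq _ (Cn_mul (Cn_mul (Cn_cst k (-1)) (Cn_mul If If)) (Df i))) => x.
rewrite deriveV//; last exact: diff_derivable.
by rewrite /GRing.scale/= mulN1r -invfM expr2.
Qed.

Lemma Cn_sum k (I : Type) (r : seq I) (F : I -> rV -> R) :
  (forall i, Cn k (F i)) -> Cn k (fun x => \sum_(i <- r) F i x).
Proof.
move=> CF; elim: r => [|i r IH].
  by apply: Cn_eq (Cn_cst k 0) => x; rewrite big_nil.
by apply: Cn_eq (Cn_add (CF i) IH) => x; rewrite big_cons.
Qed.

Lemma Cn_prod k (I : Type) (r : seq I) (F : I -> rV -> R) :
  (forall i, Cn k (F i)) -> Cn k (fun x => \prod_(i <- r) F i x).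
Proof.
move=> CF; elim: r => [|i r IH].
  by apply: Cn_eq (Cn_cst k 1) => x; rewrite big_nil.
by apply: Cn_eq (Cn_mul (CF i) IH) => x; rewrite big_cons.
Qed.

Lemma derive_coord j (v x : rV) :
  'D_v (fun y : rV => y ord0 j) x = v ord0 j.
Proof.
rewrite deriveE; last exact: differentiable_coord.
have @f : {linear rV -> R}.
  by exists (fun N : rV => N ord0 j); do 2![eexists]; do ?[constructor];
     rewrite ?mxE// => ? *; rewrite ?mxE//; move=> ?; rewrite !mxE.
rewrite (_ : (fun _ => _) = f) // diff_lin//; exact: coord_continuous.
Qed.

Lemma differentiable_affine_coord j (a b : R) (x : rV) :
  differentiable (fun y : rV => a * y ord0 j + b) x.
Proof.
apply: differentiableD; last exact: differentiable_cst.
by apply: differentiableM; [exact: differentiable_cst|exact: differentiable_coord].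
Qed.

Lemma derive_affine_coord j (a b : R) (v x : rV) :
  'D_v (fun y : rV => a * y ord0 j + b) x = a * v ord0 j.
Proof.
have dc : derivable (fun y : rV => y ord0 j) x v.
  by apply: diff_derivable; exact: differentiable_coord.
rewrite deriveD ?derive_cst ?addr0//; last first.
  by apply: diff_derivable; apply: differentiableM => //; exact: differentiable_coord.
by rewrite deriveM// derive_cst scaler0 addr0 derive_coord.
Qed.

Lemma Cn_flat k (p : {poly R}) (a b : R) (j : 'I_n) :
  Cn k (fun x : rV => flat p (a * x ord0 j + b)).
Proof.
have dflat q t : differentiable (flat q) t.
  by apply/derivable1_diffP; case: (is_derive_flat q t).
have dcomp q x : differentiable (fun x : rV => flat q (a * x ord0 j + b)) x.
  apply: (@differentiable_comp _ _ _ _ (fun y : rV => a * y ord0 j + b) (flat q)) => //.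
  exact: differentiable_affine_coord.
elim: k p => [|k IH] p; first by move=> x; exact: differentiable_continuous.
split => [x|i]; first exact: dcomp.
apply: (Cn_eq _ (Cn_mul (Cn_cst k (a * e_ i ord0 j)) (IH ('X^2 * (p - p^`()))))) => x.
rewrite deriveE; last exact: dcomp.
rewrite (@diff_comp _ _ _ _ (fun y : rV => a * y ord0 j + b) (flat p))//; last first.
  exact: differentiable_affine_coord.
rewrite /= diff1E// -deriveE ?derive_affine_coord; last exact: differentiable_affine_coord.
by rewrite derive1E; case: (is_derive_flat p (a * x ord0 j + b)) => _ ->.
Qed.

End Cn_calculus.

(** * A smooth step and a partition of unity on the line *)

Section smooth_step.
Context {R : realType}.
Implicit Types a b t : R.

Definition sstep t : R := flat1 t / (flat1 t + flat1 (1 - t)).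

(** One of t and 1 - t is at least 1/2. The uniform lower bound on the denominator makes [sstep]
    globally Lipschitz. *)
Let den_ge t : flat1 (2^-1 : R) <= flat1 t + flat1 (1 - t).
Proof.
have [h|h] := leP 2^-1 t.
  by apply: le_trans (flat1_homo h) _; rewrite lerDl flat1_ge0.
by apply: (@le_trans _ _ (flat1 (1 - t))); [apply: flat1_homo; lra|rewrite lerDr flat1_ge0].
Qed.

Let c0 : 0 < flat1 (2^-1 : R).
Proof. by rewrite flat1_gt0// invr_gt0. Qed.

Let den_gt0 t : 0 < flat1 t + flat1 (1 - t).
Proof. exact: lt_le_trans c0 (den_ge t). Qed.

Lemma sstep_npos t : t <= 0 -> sstep t = 0.
Proof. by move=> t0; rewrite /sstep (flat1_npos t0) mul0r. Qed.

Lemma sstep_ge1 t : 1 <= t -> sstep t = 1.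
Proof.
move=> t1; rewrite /sstep (@flat1_npos R (1 - t)); last by rewrite subr_le0.
by rewrite addr0 divff// gt_eqF// flat1_gt0// (lt_le_trans _ t1).
Qed.

Lemma sstep_ge0 t : 0 <= sstep t.
Proof. by rewrite divr_ge0 ?flat1_ge0// ltW. Qed.

Lemma sstep_le1 t : sstep t <= 1.
Proof. by rewrite ler_pdivrMr// mul1r lerDl flat1_ge0. Qed.

Lemma sstep_lipschitz : exists2 L : R, 0 <= L & forall a b, `|sstep a - sstep b| <= L * `|a - b|.
Proof.
have [M M0 HM] := @flat1_lipschitz R.
pose c := flat1 (2^-1 : R).
exists (2 * M / c) => [|a b]; first by rewrite divr_ge0 ?mulr_ge0// ltW.
have := den_gt0 a; have := den_gt0 b; have := den_ge b; rewrite -/c.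
have h1 := HM a b; have h2 := HM (1 - b) (1 - a).
move: h2; rewrite (_ : 1 - b - (1 - a) = a - b); last by ring.
move=> h2; have := flat1_ge0 a; have := flat1_ge0 (1 - a); rewrite /sstep.
move: h1 h2; move: (flat1 a) (flat1 (1 - a)) (flat1 b) (flat1 (1 - b)) => h k h' k' h1 h2.
move=> k0 h0 cb Db Da.
have -> : h / (h + k) - h' / (h' + k') =
    (h * (k' - k) + k * (h - h')) / ((h + k) * (h' + k')).
  by field; rewrite !gt_eqF.
rewrite normrM normfV [`|_ * (h' + k')|]ger0_norm; last by rewrite mulr_ge0// ltW.
rewrite ler_pdivrMr ?mulr_gt0//.
have num : `|h * (k' - k) + k * (h - h')| <= (h + k) * (2 * M * `|a - b|).
  apply: le_trans (ler_normD _ _) _; rewrite !normrM (ger0_norm h0) (ger0_norm k0).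
  rewrite -mulrA mulrDl; apply: lerD; rewrite ler_wpM2l//.
    by apply: le_trans h2 _; rewrite ler_peMl ?mulr_ge0// ler1n.
  by apply: le_trans h1 _; rewrite ler_peMl ?mulr_ge0// ler1n.
apply: le_trans num _.
rewrite (_ : 2 * M / c * `|a - b| * _ =
  ((h + k) * (2 * M * `|a - b|)) * ((h' + k') / c)); last by field; rewrite gt_eqF.
by rewrite ler_peMr ?mulr_ge0 ?addr_ge0// ler_pdivlMr// mul1r.
Qed.

Lemma Cn_sstep n k (a b : R) (j : 'I_n) :
  Cn k (fun x : 'rV[R]_n => sstep (a * x ord0 j + b)).
Proof.
have C1 := @Cn_flat R n k 1 a b j.
have C2 := @Cn_flat R n k 1 (- a) (1 - b) j.
have E x : flat 1 (- a * x + (1 - b)) = flat1 (1 - (a * x + b)).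
  by rewrite /flat1; congr flat; ring.
apply: (Cn_eq _ (Cn_mul C1 (Cn_inv _ (Cn_add C1 C2)))) => x; rewrite E//.
exact: lt0r_neq0 (den_gt0 _).
Qed.

(** Being a difference of consecutive steps, its integer translates have telescoping sums. *)
Definition bump1 t : R := sstep (t + 1) - sstep t.

Lemma bump1_ge0 t : 0 <= bump1 t.
Proof.
rewrite /bump1; have [t0|t0] := leP t 0; first by rewrite (sstep_npos t0) subr0 sstep_ge0.
by rewrite (@sstep_ge1 (t + 1)) ?subr_ge0 ?sstep_le1//; lra.
Qed.

Lemma bump1_neq0 t : bump1 t != 0 -> `|t| < 1.
Proof.
rewrite /bump1; apply: contraNT; rewrite -leNgt ler_normr => /orP[t1|t1].
  by rewrite !sstep_ge1 ?subrr//; lra.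
by rewrite !sstep_npos ?subrr//; lra.
Qed.

Lemma bump1_le1 t : bump1 t <= 1.
Proof. by rewrite /bump1; have := sstep_le1 (t + 1); have := sstep_ge0 t; lra. Qed.

Lemma bump1_lipschitz : exists2 L : R, 0 <= L & forall a b, `|bump1 a - bump1 b| <= L * `|a - b|.
Proof.
have [L L0 HL] := sstep_lipschitz; exists (2 * L) => [|a b]; first by rewrite mulr_ge0.
rewrite /bump1 (_ : _ - _ = (sstep (a + 1) - sstep (b + 1)) + (sstep b - sstep a)); last by ring.
apply: le_trans (ler_normD _ _) _; rewrite -mulrA mulrDl mul1r; apply: lerD.
  by apply: le_trans (HL _ _) _; rewrite (_ : a + 1 - _ = a - b)//; ring.
by apply: le_trans (HL _ _) _; rewrite distrC.
Qed.

(* Grid coordinate of index [i], the grid being centred at [0]. *)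
Definition gridc N (i : 'I_(2 * N).+1) : R := i%:R - N%:R.

Lemma sum_bump1 N t : `|t| <= N%:R -> \sum_i bump1 (t - @gridc N i) = 1.
Proof.
move=> tN; pose F i := - sstep (t + N%:R + 1 - i%:R).
rewrite (eq_bigr (fun i : 'I_(2 * N).+1 => F i.+1 - F i)); last first.
  move=> i _; rewrite /F /bump1 /gridc opprK [RHS]addrC; congr (sstep _ - sstep _).
    by ring.
  by rewrite -natr1; ring.
rewrite -(big_mkord xpredT (fun i => F i.+1 - F i)) telescope_sumr// /F opprK subr0.
move: tN; rewrite ler_norml => /andP[t1 t2].
rewrite sstep_npos ?oppr0 ?add0r ?sstep_ge1//; first by lra.
by rewrite -natr1 natrM; lra.
Qed.

Lemma sum_bump1_le1 N t : \sum_i bump1 (t - @gridc N i) <= 1.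
Proof.
pose F i := - sstep (t + N%:R + 1 - i%:R).
rewrite (eq_bigr (fun i : 'I_(2 * N).+1 => F i.+1 - F i)); last first.
  move=> i _; rewrite /F /bump1 /gridc opprK [RHS]addrC; congr (sstep _ - sstep _).
    by ring.
  by rewrite -natr1; ring.
rewrite -(big_mkord xpredT (fun i => F i.+1 - F i)) telescope_sumr// /F opprK.
by have := sstep_ge0 (t + N%:R + 1 - (2 * N).+1%:R); have := sstep_le1 (t + N%:R + 1 - 0%:R); lra.
Qed.

(** With S the indicator of the positive reals, the indicator of |u| < 1 is at most S(u + 1) - S(u -
    1). This is a difference two steps apart, so its sum over the grid telescopes to at most 2. *)
Lemma count_grid N t :
  \sum_(i < (2 * N).+1) (`|t - gridc i| < 1)%R%:R <= 2 :> R.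
Proof.
pose S (u : R) : R := (0 < u)%R%:R.
have S01 u : 0 <= S u <= 1 by rewrite ler0n lern1 leq_b1.
pose F i := - (S (t + N%:R + 1 - i%:R) + S (t + N%:R - i%:R)).
apply: (@le_trans _ _ (\sum_(i < (2 * N).+1) (F i.+1 - F i))); last first.
  rewrite -(big_mkord xpredT (fun i => F i.+1 - F i)) telescope_sumr// /F opprK.
  have := S01 (t + N%:R + 1 - (2 * N).+1%:R); have := S01 (t + N%:R - (2 * N).+1%:R).
  by have := S01 (t + N%:R + 1 - 0%:R); have := S01 (t + N%:R - 0%:R); lra.
apply: ler_sum => i _; rewrite /F opprK.
rewrite (_ : t + N%:R + 1 - i.+1%:R = t + N%:R - i%:R); last by rewrite -natr1; ring.
rewrite (_ : t + N%:R - i.+1%:R = t + N%:R - i%:R - 1); last by rewrite -natr1; ring.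
rewrite (_ : t + N%:R + 1 - i%:R = t + N%:R - i%:R + 1); last by ring.
rewrite /gridc (_ : t - (i%:R - N%:R) = t + N%:R - i%:R); last by ring.
move: (t + N%:R - i%:R) => u.
rewrite (_ : - _ + _ = S (u + 1) - S (u - 1)); last by ring.
rewrite /S ltr_norml; have [u1|u1] := ltP (- 1) u; last first.
  by rewrite /= subr_ge0 ler_nat; case: ltP => //=; case: ltP => //; lra.
have [u2|u2] /= := ltP u 1.
  by rewrite (_ : 0 < u + 1); [case: ltP => //=; [lra|rewrite subr0]|lra].
by rewrite subr_ge0 (_ : 0 < u + 1); [rewrite ler_nat leq_b1|lra].
Qed.

End smooth_step.

Lemma prodr_01 (R : realDomainType) (I : Type) (r : seq I) (a : I -> R) :
  (forall i, 0 <= a i <= 1) -> 0 <= \prod_(i <- r) a i <= 1.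
Proof.
move=> a01; elim/big_ind : _ => [|x y /andP[x0 x1] /andP[y0 y1]|//]; first by rewrite ler01 lexx.
by rewrite mulr_ge0// mulr_ile1.
Qed.

Lemma prod_dist_le (R : realDomainType) (I : Type) (r : seq I) (a b : I -> R) :
  (forall i, 0 <= a i <= 1) -> (forall i, 0 <= b i <= 1) ->
  `|\prod_(i <- r) a i - \prod_(i <- r) b i| <= \sum_(i <- r) `|a i - b i|.
Proof.
move=> a01 b01; elim: r => [|i r IH]; first by rewrite !big_nil subrr normr0.
rewrite !big_cons.
have pa := prodr_01 r a01.
have /andP[bi0 bi1] := b01 i; have /andP[p0 p1] := pa.
rewrite (_ : _ - _ = (a i - b i) * \prod_(j <- r) a j +
  b i * (\prod_(j <- r) a j - \prod_(j <- r) b j)); last by ring.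
apply: le_trans (ler_normD _ _) _; rewrite !normrM; apply: lerD.
  by rewrite ler_piMr// ger0_norm.
by apply: le_trans IH; rewrite ler_piMl// ger0_norm.
Qed.

(** * Smooth cutoffs of a set at a given scale *)

Section lattice_bump.
Context {R : realType} {n : nat}.
Local Notation rV := 'rV[R]_n.

(* A sum of grid bumps of size [d]: the Lipschitz constant is of order [1/d] because
   at most [2 ^ n] bumps are active at a given point. *)
Lemma lattice_bump : exists2 C : R, 0 <= C & forall (d r : R) (D : set rV), 0 < d ->
  exists eta : rV -> R,
  [/\ forall k, Cn k eta, forall x, 0 <= eta x <= 1,
      forall x y, `|eta x - eta y| <= C / d * `|x - y|,
      forall x, `|x| <= r -> (forall z, `|x - z| < d -> D z) -> eta x = 1 &
      forall x, eta x != 0 -> exists2 z, D z & `|x - z| < d].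
Proof.
have [L L0 HL] := @bump1_lipschitz R.
exists (2 ^+ n * 2 * (n%:R * L)) => [|d r D d0]; first by rewrite !mulr_ge0// exprn_ge0.
pose N := (Num.truncn (`|r| / d)).+1.
have rN : r / d <= N%:R.
  apply: le_trans (ltW (truncnS_gt _)); rewrite ler_wpM2r ?invr_ge0 ?(ltW d0)//.
  exact: ler_norm.
pose M := (2 * N).+1.
pose pt (f : {ffun 'I_n -> 'I_M}) : rV := d *: \row_j gridc (f j).
pose th (f : {ffun 'I_n -> 'I_M}) j (x : rV) : R := bump1 (x ord0 j / d - gridc (f j)).
pose phi f (x : rV) : R := \prod_j th f j x.
(* Only the bumps centred in [D] are kept. A bump active at [x] has its centre within [d] of [x]:
   where all such points lie in [D] nothing of the partition of unity is lost, and where [eta] is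
   nonzero some centre in [D] is close. *)
pose eta (x : rV) := \sum_(f | `[< D (pt f) >]) phi f x.
have th01 f j x : 0 <= th f j x <= 1 by rewrite /th bump1_ge0 bump1_le1.
have phi0 f x : 0 <= phi f x by apply: prodr_ge0 => j _; case/andP: (th01 f j x).
have phi_sum x : \sum_f phi f x = \prod_(j < n) \sum_(i < M) bump1 (x ord0 j / d - gridc i).
  by rewrite bigA_distr_bigA.
have sum_le1 x : \sum_f phi f x <= 1.
  have c01 (j : 'I_n) : 0 <= \sum_(i < M) bump1 (x ord0 j / d - gridc i) <= 1.
    by rewrite sum_bump1_le1 andbT; apply: sumr_ge0 => i _; exact: bump1_ge0.
  by rewrite phi_sum; case/andP: (prodr_01 (index_enum 'I_n) c01).
have near_pt f x : phi f x != 0 -> forall j, `|x ord0 j / d - gridc (f j)| < 1.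
  by move=> /prodf_neq0 h j; apply: bump1_neq0; exact: h.
have dist_pt f x : phi f x != 0 -> `|x - pt f| < d.
  move=> /near_pt h.
  have : ball (pt f) d x.
    apply/ball_rVE => // j; rewrite /pt !mxE distrC.
    have -> : x ord0 j - d * gridc (f j) = d * (x ord0 j / d - gridc (f j)).
      by field; rewrite gt_eqF.
    by rewrite normrM gtr0_norm// gtr_pMr.
  by rewrite -ball_normE/= distrC.
exists eta; split.
- move=> k; apply: (Cn_eq _ (@Cn_sum R n k _ (enum {ffun 'I_n -> 'I_M})
    (fun f x => (`[< D (pt f) >])%:R * phi f x) _)).
    move=> x; rewrite big_enum/= /eta [RHS]big_mkcond/=; apply: eq_bigr => f _.
    by case: ifP => _; rewrite ?mul1r ?mul0r.
  move=> f; apply: Cn_mul; first exact: Cn_cst.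
  apply: Cn_prod => j; rewrite /th /bump1.
  apply: (Cn_eq _ (Cn_add (Cn_sstep k d^-1 (1 - gridc (f j)) j)
    (Cn_mul (Cn_cst k (-1)) (Cn_sstep k d^-1 (- gridc (f j)) j)))) => x.
  rewrite mulN1r; congr (sstep _ - sstep _); first by ring.
  by rewrite mulrC.
- move=> x; rewrite sumr_ge0//=; apply: le_trans (sum_le1 x).
  by rewrite [leRHS](bigID (fun f => `[< D (pt f) >]))/= lerDl sumr_ge0.
- move=> x y; rewrite /eta -sumrB.
  (* [act] equals 1 on every bump active at [z]. Its sum over all multi-indices factors over the
     coordinates, so [count_grid] bounds it by 2^n whatever the size of the grid. *)
  pose act (f : {ffun 'I_n -> 'I_M}) (z : rV) : R := \prod_j (`|z ord0 j / d - gridc (f j)| < 1)%R%:R.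
  have act0 f z : 0 <= act f z by apply: prodr_ge0 => j _.
  have act1 f z : phi f z != 0 -> act f z = 1.
    by move=> /near_pt h; rewrite /act big1// => j _; rewrite h.
  have act_sum z : \sum_f act f z <= 2 ^+ n.
    rewrite -(bigA_distr_bigA (fun j (i : 'I_M) => (`|z ord0 j / d - gridc i| < 1)%R%:R)).
    rewrite -[X in _ <= _ ^+ X]card_ord -prodr_const; apply: ler_prod => j _.
    by rewrite sumr_ge0//= count_grid.
  pose K := n%:R * L / d * `|x - y|.
  have K0 : 0 <= K by rewrite !mulr_ge0// invr_ge0 ltW.
  have phi_lip f : `|phi f x - phi f y| <= K.
    apply: le_trans (prod_dist_le _ (fun j => th01 f j x) (fun j => th01 f j y)) _.
    apply: (@le_trans _ _ (\sum_(j < n) L / d * `|x - y|)); last first.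
      by rewrite sumr_const card_ord /K -!mulrA mulr_natl.
    apply: ler_sum => j _; apply: le_trans (HL _ _) _.
    rewrite -mulrA ler_wpM2l//.
    rewrite (_ : _ - _ = (x ord0 j - y ord0 j) * d^-1); last by ring.
    rewrite normrM mulrC [`|d^-1|]gtr0_norm ?invr_gt0// ler_wpM2l ?invr_ge0 ?(ltW d0)//.
    by have := normr_coord_le (x - y) j; rewrite !mxE.
  have phi_act f : `|phi f x - phi f y| <= (act f x + act f y) * K.
    have [px|px] := eqVneq (phi f x) 0; last first.
      rewrite (act1 _ _ px) mulrDl mul1r.
      by apply: le_trans (phi_lip f) _; rewrite lerDl mulr_ge0.
    have [py|py] := eqVneq (phi f y) 0; last first.
      rewrite (act1 _ _ py) mulrDl mul1r.
      by apply: le_trans (phi_lip f) _; rewrite lerDr mulr_ge0.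
    by rewrite px py subrr normr0 mulr_ge0// addr_ge0.
  apply: le_trans (ler_norm_sum _ _ _) _.
  apply: (@le_trans _ _ (\sum_f (act f x + act f y) * K)).
    rewrite [leRHS](bigID (fun f => `[< D (pt f) >]))/= -[leLHS]addr0; apply: lerD.
      by apply: ler_sum => f _; exact: phi_act.
    by apply: sumr_ge0 => f _; rewrite mulr_ge0// addr_ge0.
  rewrite -mulr_suml big_split/= /K.
  rewrite (_ : 2 ^+ n * 2 * (n%:R * L) / d * `|x - y| = (2 ^+ n + 2 ^+ n) * (n%:R * L / d * `|x - y|)).
    by rewrite ler_wpM2r// lerD.
  by move: (2 ^+ n) => z; ring.
- move=> x xr HD; rewrite /eta.
  rewrite (_ : \sum_(f | _) _ = \sum_f phi f x).
    rewrite phi_sum big1// => j _; apply: sum_bump1.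
    rewrite normrM [`|d^-1|]gtr0_norm ?invr_gt0//; apply: le_trans rN.
    by rewrite ler_wpM2r ?invr_ge0 ?(ltW d0)// (le_trans (normr_coord_le x j)).
  rewrite [RHS](bigID (fun f => `[< D (pt f) >]))/= [X in _ + X]big1 ?addr0// => f.
  move=> /asboolPn nD; apply/eqP; apply: contraPT nD => /dist_pt /HD h; exact.
- move=> x; apply: contra_neqP => h; apply: big1 => f /asboolP Df.
  by apply/eqP; apply: contra_notT h => /dist_pt h; exists (pt f).
Qed.

End lattice_bump.

Ltac nonneg := repeat first [ exact: sqr_ge0 | exact: rker_ge0 | exact: ler0n
  | apply: mulr_ge0 | assumption ]; try by rewrite indicE; exact: ler0n.

(** * Finite sums and shifts in double integrals *)

Section dint_more.
Context {R : realType} {n : nat}.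
Local Notation rV := 'rV[R]_n.
Local Notation mu := (@lebesgue_rV R n).

Lemma measurable2_sum (I : Type) (r : seq I) (F : I -> rV -> rV -> R) :
  (forall i, measurable2 (F i)) -> measurable2 (fun x y => \sum_(i <- r) F i x y).
Proof.
move=> mF; elim: r => [|i r IH].
  rewrite (_ : (fun _ _ => _) = (fun _ _ => 0)); first exact: measurable2_cst.
  by apply/funext => x; apply/funext => y; rewrite big_nil.
rewrite (_ : (fun _ _ => _) = (fun x y => F i x y + \sum_(j <- r) F j x y)).
  exact: measurable2D.
by apply/funext => x; apply/funext => y; rewrite big_cons.
Qed.

Lemma dint_sum (I : Type) (r : seq I) (F : I -> rV -> rV -> R) :
  (forall i, measurable2 (F i)) -> (forall i x y, 0 <= F i x y) ->
  dint (fun x y => \sum_(i <- r) F i x y) = (\sum_(i <- r) dint (F i))%E.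
Proof.
move=> mF F0; elim: r => [|i r IH].
  rewrite big_nil dint_def; apply: integral0_eq => x _; apply: integral0_eq => y _.
  by rewrite big_nil.
rewrite big_cons -IH -(dint_add (mF i) (measurable2_sum r mF) (F0 i)); last first.
  by move=> x y; exact: sumr_ge0.
by apply: eq_dint => x y; rewrite big_cons.
Qed.

Lemma dint_indic_ball (t : R) (G : rV -> R) : 0 < t -> measurable_fun setT G ->
  (forall x, 0 <= G x) ->
  dint (fun z x => \1_(ball 0 (t / 2)) z * G x) =
  ((t ^+ n)%:E * \int[mu]_x (G x)%:E)%E.
Proof.
move=> t0 mG G0.
have mB : measurable_fun setT (\1_(ball 0 (t / 2)) : rV -> R).
  by apply: measurable_indic; exact: measurable_ball_rV.
have m1 : measurable2 (fun x z => G x * \1_(ball 0 (t / 2)) z : R).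
  by apply: measurable2M; [exact: measurable2_1|exact: measurable2_2].
rewrite (@eq_dint _ _ _ (fun z x => (fun x z => G x * \1_(ball 0 (t / 2)) z) x z)); last first.
  by move=> x y; rewrite mulrC.
rewrite (dint_swap m1); last by move=> x y; rewrite mulr_ge0.
rewrite (dint_wl (measurable2_2 mB))//.
rewrite -(nnint_scale mu mG G0); last by rewrite exprn_ge0// ltW.
apply: eq_integral => x _.
rewrite int_indic_ball ?divr_gt0// -EFinM mulrC.
by rewrite -[t / 2 *+ 2]mulr_natr divfK.
Qed.

Lemma dint_shift_fst (c : rV -> rV) (F : rV -> rV -> R) : measurable2 F ->
  (forall x y, 0 <= F x y) ->
  dint (fun x y => F x (c x + y)) = dint F.
Proof.
move=> mF F0; rewrite !dint_def; apply: eq_integral => x _.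
rewrite (@integral_rV_addl R n (c x) (fun y => (F x y)%:E))//.
  by apply/measurable_EFinP; exact: measurable2_y.
by move=> y; rewrite lee_fin.
Qed.

End dint_more.

(** * Strips around [E] and one step of the Hardy inequality *)

Section strips.
Context {R : realType} {n : nat}.
Local Notation rV := 'rV[R]_n.
Local Notation mu := (@lebesgue_rV R n).
Variables (E Gam : set rV) (e0 : rV).
Hypotheses (coneG : cone Gam) (ballG : ball e0 1 `<=` Gam).
Hypothesis EG : forall x y, closure E x -> Gam y -> E (x - y).
Hypothesis e02 : 2 <= `|e0|.

Definition nbhd t : set rV := [set x | exists2 z, E z & `|x - z| < t].

Definition strip t : set rV := nbhd t `\` closure E.

Lemma nbhd_open t : open (nbhd t).
Proof.
rewrite (_ : nbhd t = \bigcup_(z in E) ball z t).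
  by apply: bigcup_open => z _; exact: ball_open.
apply/seteqP; split => x [z Ez xz]; exists z => //; move: xz; rewrite -ball_normE/= distrC//.
Qed.

Lemma measurable_strip t : measurable (strip t).
Proof.
apply: measurableD; first by apply: open_measurable_rV; exact: nbhd_open.
by apply: closed_measurable_rV; exact: closed_closure.
Qed.

Lemma strip_le t t' : t <= t' -> strip t `<=` strip t'.
Proof.
by move=> tt' x [[z Ez xz] nx]; split => //; exists z => //; exact: lt_le_trans tt'.
Qed.

Lemma closure_nbhd t : 0 < t -> closure E `<=` nbhd t.
Proof.
move=> t0 x /(_ (ball x t) (nbhsx_ballx _ _ t0)) [z [Ez]].
by rewrite -ball_normE/= => xz; exists z.
Qed.

Lemma Gam_ball (r : R) y : 0 < r -> `|y - r *: e0| < r -> Gam y.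
Proof.
move=> r0 yr; have -> : y = r *: (r^-1 *: y) by rewrite scalerA divff ?gt_eqF// scale1r.
apply: coneG => //; apply: ballG; rewrite -ball_normE/=.
have -> : e0 - r^-1 *: y = - (r^-1 *: (y - r *: e0)).
  by rewrite scalerBr scalerA mulVf ?gt_eqF// scale1r opprB.
by rewrite normrN normrZ gtr0_norm ?invr_gt0// ltr_pdivrMl// mulr1.
Qed.

(** If [x + y] were within [t] of some [z] in [E], then [z - x] would be within [t] of [y], hence in
    [Gam], and [x = z - (z - x)] would lie in [E] by [EG]. *)
Lemma exit_nbhd x y t : ~ closure E x -> (forall z, `|z - y| < t -> Gam z) ->
  ~ nbhd t (x + y).
Proof.
move=> nx Gy [z Ez xyz]; apply: nx; apply: subset_closure.
have -> : x = z - (z - x) by rewrite opprB addrC subrK.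
apply: EG; first exact: subset_closure.
by apply: Gy; rewrite distrC opprB addrA [y + x]addrC.
Qed.

Lemma stay_outside x y : ~ closure E x -> Gam y -> ~ closure E (x + y).
Proof.
move=> nx Gy cxy; apply: nx; apply: subset_closure.
by rewrite -(addrK y x); exact: EG.
Qed.

(** Multiples start at 1, so that every shift stays away from the singularity of the kernel. *)
Definition shiftv t (i : nat) (z : rV) : rV := (i.+1%:R * t) *: e0 + z.

Let shiftv_dist t i z : shiftv t i z - (i.+1%:R * t) *: e0 = z.
Proof. by rewrite /shiftv addrAC subrr add0r. Qed.

(** The two points differ by (j - i) t [e0], whose [t]-ball lies in [Gam]. Starting outside cl [E],
    such a move leaves the [t]-neighbourhood of [E]. *)
Lemma strip_shift_disjoint t z x i j : 0 < t -> (i < j)%N ->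
  strip t (x - shiftv t i z) -> strip t (x - shiftv t j z) -> False.
Proof.
move=> t0 ij [Ni ni] [Nj nj].
have := @exit_nbhd _ (((j - i)%:R * t) *: e0) t nj; apply.
- move=> y yt; apply: (@Gam_ball ((j - i)%:R * t)); first by rewrite mulr_gt0// ltr0n subn_gt0.
  apply: lt_le_trans yt _; rewrite ler_peMl ?(ltW t0)// ler1n subn_gt0//.
- have -> : x - shiftv t j z + ((j - i)%:R * t) *: e0 = x - shiftv t i z => //.
  by apply/rowP => l; rewrite !mxE natrB ?(ltnW ij)// -![_.+1%:R]natr1; ring.
Qed.

Lemma strip_shift t z i (M : nat) (L : R) x : 0 < t -> `|z| < t / 2 -> (i < M)%N ->
  2 + M%:R * `|e0| <= L ->
  strip t (x - shiftv t i z) -> strip (L * t) x.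
Proof.
move=> t0 zt iM HL [[y Ey xy] nx]; split; last first.
  have := @stay_outside _ (shiftv t i z) nx; rewrite subrK; apply.
  apply: (@Gam_ball (i.+1%:R * t)); first by rewrite mulr_gt0.
  rewrite shiftv_dist; apply: lt_le_trans zt _.
  by rewrite mulrC; apply: ler_pM; rewrite ?invr_ge0 ?(ltW t0)// (@le_trans _ _ 1)// ?invf_le1 ?ler1n.
exists y => //.
rewrite (_ : x - y = (x - shiftv t i z - y) + (i.+1%:R * t) *: e0 + z); last first.
  by apply/rowP => l; rewrite !mxE; ring.
apply: le_lt_trans (ler_normD _ _) _.
have := ler_normD (x - shiftv t i z - y) ((i.+1%:R * t) *: e0).
have -> : `|(i.+1%:R * t) *: e0| = i.+1%:R * t * `|e0|.
  by rewrite normrZ gtr0_norm// mulr_gt0.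
have h1 : i.+1%:R * t * `|e0| <= M%:R * `|e0| * t.
  by rewrite mulrAC ler_wpM2r ?(ltW t0)// ler_wpM2r// ler_nat.
have h2 : (2 + M%:R * `|e0|) * t <= L * t by rewrite ler_wpM2r// ltW.
move: h1 h2 zt xy; rewrite mulrDl.
move: (_ * _ * _) (M%:R * _ * t) `|z| `|_ + _| `|_ - y| (L * t) => u v w p q r; lra.
Qed.

(** The lower bound rests on [2 <= |e0|]: the shift has norm at least 2t - t/2. It places all shifts
    in one annulus, on which the kernel is comparable to t^(-n-2s). *)
Lemma shiftv_norm t z i (M : nat) (L : R) : 0 < t -> `|z| < t / 2 -> (i < M)%N ->
  2 + M%:R * `|e0| <= L -> t <= `|shiftv t i z| < L * t.
Proof.
move=> t0 zt iM HL.
have hi : 1 <= i.+1%:R :> R by rewrite ler1n.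
have hM : i.+1%:R <= M%:R :> R by rewrite ler_nat.
have E1 : `|(i.+1%:R * t) *: e0| = i.+1%:R * t * `|e0|.
  by rewrite normrZ gtr0_norm// mulr_gt0.
apply/andP; split.
  have := ler_normB (shiftv t i z) z; rewrite /shiftv addrK E1.
  have h1 : 2 * t <= i.+1%:R * t * `|e0| by rewrite mulrC; apply: ler_pM => //; [lra|rewrite ler_peMl// ltW].
  move: h1 zt; move: (_ * _ * _) `|z| `|_ + z| => u v w; lra.
have := ler_normD ((i.+1%:R * t) *: e0) z; rewrite -/(shiftv t i z) E1.
have h1 : i.+1%:R * t * `|e0| <= M%:R * `|e0| * t by rewrite mulrAC ler_wpM2r ?(ltW t0)// ler_wpM2r.
have h2 : (2 + M%:R * `|e0|) * t <= L * t by rewrite ler_wpM2r// ltW.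
move: h1 h2 zt; rewrite mulrDl; move: (i.+1%:R * t * `|e0|) (M%:R * `|e0| * t) `|z| `|shiftv t i z| (L * t).
by move=> u v w x y; lra.
Qed.

Variable (s : R).
Hypothesis s0 : 0 < s.
Local Notation k := (@rker R n s).
Local Notation p := (n%:R + 2 * s).
Implicit Type w : rV -> R.

Definition strip_int w t : \bar R := (\int[mu]_x (\1_(strip t) x * w x ^+ 2)%:E)%E.

Definition annulus (a b : R) : set rV := [set y | a <= `|y| < b].

Definition annulus_gag w a b : \bar R :=
  dint (fun x y => \1_(annulus a b) y * ((w x - w (x + y)) ^+ 2 * k y)).

Lemma measurable_annulus a b : measurable (annulus a b).
Proof.
rewrite (_ : annulus a b = [set y | a <= `|y|] `\` [set y | b <= `|y|]).
  by apply: measurableD; exact: measurable_normr_ge.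
apply/seteqP; split => y /=; first by move=> /andP[-> h]; split => //; apply/negP; rewrite -ltNge.
by move=> [h /negP]; rewrite -ltNge => h'; apply/andP.
Qed.

Lemma indic01 (A : set rV) x : (\1_A x : R) = 0 \/ (\1_A x : R) = 1 /\ A x.
Proof.
rewrite indicE; case: (boolP (x \in A)) => [|_]; [|by left].
by rewrite inE => Ax; right.
Qed.

Lemma indic_ge0' (A : set rV) x : 0 <= (\1_A x : R).
Proof. by rewrite indicE. Qed.

Lemma sum_indic_disjoint_le (M : nat) (P : nat -> Prop) (Q : Prop) :
  (forall i j, (i < j)%N -> P i -> P j -> False) ->
  (forall i, (i < M)%N -> P i -> Q) ->
  \sum_(i < M) (`[< P i >])%:R <= (`[< Q >])%:R :> R.
Proof.
move=> disj PQ; have [[i Pi]|nP] := pselect (exists i : 'I_M, P i).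
  rewrite (bigD1 i)//= big1 => [|j ji].
    by rewrite (asboolT Pi) (asboolT (PQ _ (ltn_ord i) Pi)) addr0.
  rewrite asboolF// => Pj; case: (ltngtP i j) => ij.
  - exact: disj ij Pi Pj.
  - exact: disj ij Pj Pi.
  - by move: ji; rewrite (val_inj (esym ij)) eqxx.
by rewrite big1// => i _; rewrite asboolF// => Pi; apply: nP; exists i.
Qed.

(* Averages [w x ^+ 2 <= 2 (w x - w (x + y)) ^+ 2 + 2 w (x + y) ^+ 2] over the
   [M] disjoint shifts [y = (i + 1) t e0 + z], then over [`|z| < t / 2]. *)
Lemma hardy_step w (t : R) (M : nat) (L : R) : measurable_fun setT w -> 0 < t ->
  2 + M%:R * `|e0| <= L ->
  ((M%:R * t ^+ n)%:E * strip_int w t <=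
   (2 * M%:R * (Num.sqrt n%:R * (L * t)) `^ p)%:E * annulus_gag w t (L * t)%R +
   (2 * t ^+ n)%:E * strip_int w (L * t)%R)%E.
Proof.
move=> mw t0 HL; set B := ball (0 : rV) (t / 2).
have mB : measurable B by exact: measurable_ball_rV.
have mS := measurable_strip t; have mS' := measurable_strip (L * t).
have m1B : measurable_fun setT (\1_B : rV -> R) by exact: measurable_indic.
have m1S : measurable_fun setT (\1_(strip t) : rV -> R) by exact: measurable_indic.
have m1S' : measurable_fun setT (\1_(strip (L * t)) : rV -> R) by exact: measurable_indic.
have mw2 := measurable_sqr mw.
have mG : measurable_fun setT (fun x => \1_(strip t) x * w x ^+ 2).
  exact: measurable_funM.
have mG' : measurable_fun setT (fun x => \1_(strip (L * t)) x * w x ^+ 2).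
  exact: measurable_funM.
have G0 u x : 0 <= \1_(strip u) x * w x ^+ 2 by rewrite mulr_ge0 ?indic_ge0' ?sqr_ge0.
have mshift i : measurable_fun setT (fun z => shiftv t i z) by exact: measurable_rV_addl.
pose F2 i z x := \1_B z * (\1_(strip t) x * (w x - w (x + shiftv t i z)) ^+ 2) : R.
pose F3 i z x := \1_B z * (\1_(strip t) x * w (x + shiftv t i z) ^+ 2) : R.
have mwz i : measurable2 (fun z x => w (x + shiftv t i z)).
  apply: (measurable2_comp1 (g := fun zx => zx.2 + shiftv t i zx.1) mw).
  apply: measurable_fun_addr; first exact: measurable_snd.
  exact: (measurableT_comp (mshift i) measurable_fst).
have mF2 i : measurable2 (F2 i).
  apply: measurable2M; first exact: measurable2_1.
  apply: measurable2M; first exact: measurable2_2.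
  by apply: measurable2X; apply: measurable2B => //; exact: measurable2_2.
have mF3 i : measurable2 (F3 i).
  apply: measurable2M; first exact: measurable2_1.
  by apply: measurable2M; [exact: measurable2_2|exact: measurable2X].
have F20 i z x : 0 <= F2 i z x by rewrite /F2; nonneg.
have F30 i z x : 0 <= F3 i z x by rewrite /F3; nonneg.
have tn0 : 0 <= t ^+ n by rewrite exprn_ge0// ltW.
have Lt0 : 0 < L.
  by apply: lt_le_trans HL; rewrite ltr_wpDr// mulr_ge0.
have step1 : ((M%:R * t ^+ n)%:E * strip_int w t <=
    2%:E * (\sum_(i < M) dint (F2 i) + \sum_(i < M) dint (F3 i)))%E.
  rewrite /strip_int EFinM -muleA -(dint_indic_ball t0 mG (G0 t)).
  rewrite -(dint_sum (index_enum _) (fun i : 'I_M => mF2 i) (fun i : 'I_M => F20 i)).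
  rewrite -(dint_sum (index_enum _) (fun i : 'I_M => mF3 i) (fun i : 'I_M => F30 i)).
  have s2 := measurable2_sum (index_enum _) (fun i : 'I_M => mF2 i).
  have s3 := measurable2_sum (index_enum _) (fun i : 'I_M => mF3 i).
  have p2 z x : 0 <= \sum_(i < M) F2 i z x by apply: sumr_ge0 => i _.
  have p3 z x : 0 <= \sum_(i < M) F3 i z x by apply: sumr_ge0 => i _.
  rewrite -(dint_add s2 s3 p2 p3).
  rewrite -(dint_scale (measurable2D s2 s3) (fun z x => addr_ge0 (p2 z x) (p3 z x)) (ler0n _ 2)).
  have m1 : measurable2 (fun z x => \1_B z * (\1_(strip t) x * w x ^+ 2) : R).
    by apply: measurable2M; [exact: measurable2_1|exact: measurable2_2].
  rewrite -(dint_scale m1 _ (ler0n _ M)); last by move=> z x; rewrite mulr_ge0 ?indic_ge0'.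
  apply: dint_le.
  - by apply: measurable2M m1; exact: measurable2_cst.
  - by apply: measurable2M; [exact: measurable2_cst|exact: measurable2D].
  - by move=> z x; nonneg.
  - move=> z x; rewrite -big_split/= mulr_sumr mulr_natl -[X in _ *+ X]card_ord -sumr_const.
    apply: ler_sum => i _; rewrite /F2 /F3.
    have [->|[-> _]] := indic01 B z; first by rewrite !mul0r addr0 mulr0.
    have [->|[-> _]] := indic01 (strip t) x; first by rewrite !mul0r !mulr0 addr0 mulr0.
    by rewrite !mul1r -[w x in leLHS](subrK (w (x + shiftv t i z))) sqrD_le.
(* After translation in [x] the [M] indicators are those of disjoint subsets of the wider strip.
   Their sum is at most one indicator, so no factor [M] appears on the right; this is the gain of
   the step. *)
have step3 : (\sum_(i < M) dint (F3 i) <= (t ^+ n)%:E * strip_int w (L * t)%R)%E.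
  pose F4 i z x := \1_B z * (\1_(strip t) (x - shiftv t i z) * w x ^+ 2) : R.
  have mF4 i : measurable2 (F4 i).
    apply: measurable2M; first exact: measurable2_1.
    apply: measurable2M; last exact: measurable2_2.
    apply: (measurable2_comp1 (g := fun zx => zx.2 - shiftv t i zx.1) m1S).
    apply: measurable_fun_subr; first exact: measurable_snd.
    exact: (measurableT_comp (mshift i) measurable_fst).
  have F40 i z x : 0 <= F4 i z x by rewrite /F4; nonneg.
  rewrite (eq_bigr (fun i : 'I_M => dint (F4 i))); last first.
    move=> i _; rewrite -(dint_shift_fst (shiftv t i) (mF4 i) (F40 i)).
    by apply: eq_dint => z x; rewrite /F3 /F4 [shiftv t i z + x]addrC addrK.
  rewrite -(dint_sum (index_enum _) (fun i : 'I_M => mF4 i) (fun i : 'I_M => F40 i)).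
  rewrite /strip_int -(dint_indic_ball t0 mG' (G0 _)).
  apply: dint_le.
  - exact: measurable2_sum.
  - by apply: measurable2M; [exact: measurable2_1|exact: measurable2_2].
  - by move=> z x; apply: sumr_ge0 => i _.
  - move=> z x; rewrite /F4 -mulr_sumr -mulr_suml.
    have [->|[-> Bz]] := indic01 B z; first by rewrite !mul0r.
    rewrite !mul1r ler_wpM2r ?sqr_ge0//.
    have zt : `|z| < t / 2 by move: Bz; rewrite /B -ball_normE/= sub0r normrN.
    apply: (@sum_indic_disjoint_le M (fun i => strip t (x - shiftv t i z)) (strip (L * t) x)).
    - by move=> i j ij; exact: strip_shift_disjoint.
    - by move=> i iM; exact: strip_shift iM HL.
(* The shift becomes the integration variable [y], which lies in the annulus. There the kernel is
   bounded below, so it can be inserted at the cost of the displayed power. *)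
have step2 i : (i < M)%N -> (dint (F2 i) <=
    ((Num.sqrt n%:R * (L * t)) `^ p)%:E * annulus_gag w t (L * t)%R)%E.
  move=> iM; pose c := (i.+1%:R * t) *: e0.
  pose F5 x y := \1_B (y - c) * (\1_(strip t) x * (w x - w (x + y)) ^+ 2) : R.
  have mF5 : measurable2 F5.
    apply: measurable2M.
      apply: measurable2_2; apply: (measurableT_comp m1B).
      have := @measurable_rV_addl R n (- c).
      by under eq_fun do rewrite addrC.
    apply: measurable2M; first exact: measurable2_1.
    apply: measurable2X; apply: measurable2B; first exact: measurable2_1.
    exact: measurable2_add.
  have F50 x y : 0 <= F5 x y by rewrite /F5; nonneg.
  rewrite -(dint_swap (mF2 i) (F20 i)).
  rewrite (@eq_dint _ _ _ (fun x z => F5 x (c + z))); last first.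
    by move=> x z; rewrite /F5 [c + z - c]addrC addrA [- c + c]addrC subrr add0r.
  rewrite (dint_shift_fst (fun=> c) mF5 F50).
  have mA : measurable2 (fun x y => \1_(annulus t (L * t)) y * ((w x - w (x + y)) ^+ 2 * k y)).
    apply: measurable2M.
      by apply: measurable2_2; apply: measurable_indic; exact: measurable_annulus.
    apply: measurable2M; last exact: measurable2_2 (measurable_rker s).
    apply: measurable2X; apply: measurable2B; first exact: measurable2_1.
    exact: measurable2_add.
  have A0 x y : 0 <= \1_(annulus t (L * t)) y * ((w x - w (x + y)) ^+ 2 * k y).
    by nonneg.
  rewrite /annulus_gag -(dint_scale mA A0 (powR_ge0 _ _)).
  apply: dint_le => //.
  - by apply: measurable2M mA; exact: measurable2_cst.
  - move=> x y; rewrite /F5; have [->|[-> Byc]] := indic01 B (y - c).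
      by rewrite mul0r mulr_ge0 ?powR_ge0.
    have zt : `|y - c| < t / 2 by move: Byc; rewrite /B -ball_normE/= sub0r normrN.
    have := shiftv_norm t0 zt iM HL.
    rewrite /shiftv -/c addrC subrK => yt.
    have y0 : 0 < `|y| by case/andP: yt => + _; exact: lt_le_trans.
    rewrite [\1_(annulus _ _) y]indicE mem_set//= !mul1r.
    have h : 1 <= (Num.sqrt n%:R * (L * t)) `^ p * k y.
      have Lt1 : `|y| <= L * t by case/andP: yt => _ /ltW.
      (* A nonzero [y] exists, so the dimension is not 0. *)
      have sn0 : 0 < Num.sqrt n%:R :> R.
        rewrite lt_neqAle sqrtr_ge0 andbT eq_sym; apply/eqP => n0.
        by have := le_trans (normr_le_enorm y) (enorm_le y); rewrite n0 mul0r leNgt y0.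
      have := rker_ge s0 y0 Lt1; rewrite powRN -[X in X <= _]mul1r ler_pdivrMr 1?mulrC//.
      by rewrite powR_gt0// !mulr_gt0.
    apply: (@le_trans _ _ ((w x - w (x + y)) ^+ 2)).
      by rewrite ler_piMl ?sqr_ge0// indicE lern1 leq_b1.
    by rewrite mulrCA ler_peMr ?sqr_ge0.
have A0 : (0 <= annulus_gag w t (L * t)%R)%E by apply: dint_ge0 => x y; nonneg.
have I0 : (0 <= strip_int w (L * t)%R)%E by apply: nnint_ge0 => x; exact: G0.
apply: le_trans step1 _.
have sum2 : (\sum_(i < M) dint (F2 i) <=
   (M%:R * (Num.sqrt n%:R * (L * t)) `^ p)%:E * annulus_gag w t (L * t)%R)%E.
  apply: (@le_trans _ _ (\sum_(i < M)
      ((Num.sqrt n%:R * (L * t)) `^ p)%:E * annulus_gag w t (L * t)%R)%E).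
    by apply: lee_sum => i _; exact: step2.
  rewrite EFinM -muleA.
  have : (0 <= ((Num.sqrt n%:R * (L * t)) `^ p)%:E * annulus_gag w t (L * t)%R)%E.
    by rewrite mule_ge0// lee_fin powR_ge0.
  move: (_ * _)%E => X X0; elim: (M) => [|m IH]; first by rewrite big_ord0 mul0e.
  rewrite big_ord_recr/= -[m.+1%:R]natr1 EFinD ge0_muleDl ?lee_fin//.
  by rewrite mul1e leeD2r.
rewrite (_ : (2 * M%:R * _)%:E = 2%:E * (M%:R * (Num.sqrt n%:R * (L * t)) `^ p)%:E)%E; last first.
  by rewrite -EFinM -mulrA.
rewrite [(2 * t ^+ n)%:E]EFinM -!muleA -ge0_muleDr; last 2 first.
- by rewrite mule_ge0// lee_fin mulr_ge0// powR_ge0.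
- by rewrite mule_ge0.
by rewrite lee_wpmul2l//; exact: leeD.
Qed.

End strips.

(** * The Hardy inequality, summed over scales *)

Section hardy_sum.
Context {R : realType} {n : nat}.
Local Notation rV := 'rV[R]_n.
Local Notation mu := (@lebesgue_rV R n).
Variables (E Gam : set rV) (e0 : rV) (s : R).
Hypotheses (coneG : cone Gam) (ballG : ball e0 1 `<=` Gam).
Hypothesis EG : forall x y, closure E x -> Gam y -> E (x - y).
Hypothesis e02 : 2 <= `|e0|.
Hypotheses (s0 : 0 < s) (s12 : s < 2^-1).
Local Notation k := (@rker R n s).
Local Notation p := (n%:R + 2 * s).
Implicit Type w : rV -> R.

(* [(2 / M) L ^ (2 s) <= 1 / 2] is possible exactly because [2 s < 1] *)
Lemma hardy_scale : exists M : nat, [/\ (0 < M)%N, 1 < 2 + M%:R * `|e0| &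
  (2 + M%:R * `|e0|) `^ (2 * s) <= M%:R / 4].
Proof.
set a := `|e0|; have a0 : 0 <= a by exact: normr_ge0.
(* If M^(1-2s) >= b, then L <= M (2 + a) gives L^(2s) <= M^(2s) (2 + a) <= M^(2s) M^(1-2s) / 4 = M /
   4. *)
pose b : R := 4 * (2 + a).
have b1 : 1 <= b by rewrite /b; lra.
have d0 : 0 < 1 - 2 * s by have := s12; lra.
pose M := (Num.truncn (b `^ (1 - 2 * s)^-1)).+1.
have M0 : 0 < M%:R :> R by rewrite ltr0n.
have bM : b <= M%:R `^ (1 - 2 * s).
  have -> : b = (b `^ (1 - 2 * s)^-1) `^ (1 - 2 * s).
    by rewrite -powRrM mulVf ?gt_eqF// powRr1// (le_trans _ b1).
  rewrite ge0_ler_powR ?nnegrE ?powR_ge0 ?(ltW d0) ?(ltW M0)//.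
  exact: ltW (truncnS_gt _).
exists M; split => //; first by rewrite ltr_wpDr ?mulr_ge0// ltr1n.
have M1 : 1 <= M%:R :> R by rewrite ler1n.
apply: (@le_trans _ _ ((M%:R * (2 + a)) `^ (2 * s))).
  have a2 : 0 <= 2 + a by rewrite addr_ge0.
  have Ma : 0 <= 2 + M%:R * a by rewrite addr_ge0// mulr_ge0.
  rewrite ge0_ler_powR ?nnegrE ?mulr_ge0 ?(ltW s0)//.
  by rewrite mulrDr lerD2r ler_peMl.
rewrite powRM ?addr_ge0//.
apply: (@le_trans _ _ (M%:R `^ (2 * s) * (2 + a))).
  rewrite ler_wpM2l ?powR_ge0//; have := s12; have := s0 => h1 h2.
  by apply: ler1_powR; lra.
apply: (@le_trans _ _ (M%:R `^ (2 * s) * (M%:R `^ (1 - 2 * s) / 4))).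
  by rewrite ler_wpM2l ?powR_ge0// ler_pdivlMr// mulrC.
rewrite mulrA -powRD; last by rewrite (gt_eqF M0) implybT.
by rewrite addrC subrK powRr1.
Qed.

Lemma strip_int_le w t : measurable_fun setT w -> (strip_int E w t <= L2sq w)%E.
Proof.
move=> mw; rewrite L2sqE /strip_int; apply: nnint_le.
- apply: measurable_funM; last exact: measurable_sqr.
  by apply: measurable_indic; exact: measurable_strip.
- exact: measurable_sqr.
- by move=> x; nonneg.
- by move=> x; rewrite ler_piMl ?sqr_ge0// indicE lern1 leq_b1.
Qed.

Lemma strip_int_ge0 w t : (0 <= strip_int E w t)%E.
Proof. by apply: nnint_ge0 => x; nonneg. Qed.

Lemma strip_int_fin w t : Hs s w -> strip_int E w t \is a fin_num.
Proof.
move=> Hw; rewrite ge0_fin_numE ?strip_int_ge0//.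
exact: le_lt_trans (strip_int_le t (Hs_meas Hw)) (L2sq_lty Hw).
Qed.

Lemma measurable_annulus_gag w a b : measurable_fun setT w ->
  measurable2 (fun x y => \1_(annulus a b) y * ((w x - w (x + y)) ^+ 2 * k y)).
Proof.
move=> mw; apply: measurable2M.
  by apply: measurable2_2; apply: measurable_indic; exact: measurable_annulus.
apply: measurable2M; last exact: measurable2_2 (measurable_rker s).
apply: measurable2X; apply: measurable2B; first exact: measurable2_1.
exact: measurable2_add.
Qed.

Lemma annulus_gag_ge0 w a b : (0 <= annulus_gag s w a b)%E.
Proof. by apply: dint_ge0 => x y; nonneg. Qed.

(** The annuli from L^(-j) to L^(1-j) are disjoint, so the pieces used at the different scales share
    a single Gagliardo seminorm. *)
Lemma annulus_gag_sum w (L : R) N : measurable_fun setT w -> 1 < L ->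
  (\sum_(j < N) annulus_gag s w (L ^- j) (L * L ^- j)%R <= gagliardo s w)%E.
Proof.
move=> mw L1; have L0 : 0 < L by exact: lt_trans L1.
have mA j := measurable_annulus_gag (L ^- j) (L * L ^- j) mw.
rewrite /annulus_gag -(dint_sum (index_enum 'I_N) (fun j : 'I_N => mA j)); last first.
  by move=> j x y; nonneg.
rewrite (gagliardo_shift s mw); apply: dint_le.
- exact: (measurable2_sum (index_enum 'I_N) (fun j : 'I_N => mA j)).
- apply: measurable2M; last exact: measurable2_2 (measurable_rker s).
  apply: measurable2X; apply: measurable2B; first exact: measurable2_1.
  exact: measurable2_add.
- by move=> x y; apply: sumr_ge0 => j _; nonneg.
- move=> x y; rewrite -mulr_suml ler_piMl//; first by nonneg.
  have := @sum_indic_disjoint_le R N (fun j => annulus (L ^- j) (L * L ^- j) y) True.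
  rewrite asboolT//; apply=> // i j ij /andP[i1 i2] /andP[j1 j2].
  have : L * L ^- j <= L ^- i.
    rewrite -[j]prednK ?(leq_trans _ ij)// exprS invfM mulrA divff ?gt_eqF// mul1r.
    rewrite lef_pV2 ?posrE ?exprn_gt0// ler_weXn2l ?ltW//.
    by rewrite -ltnS prednK// (leq_trans _ ij).
  by move=> h; have := lt_le_trans j2 h; rewrite ltNge i1.
Qed.

Lemma hardy_sum : exists L C : R, [/\ 1 < L, 0 <= C & forall w, Hs s w -> forall N,
  \sum_(j < N) (L `^ (2 * s)) ^+ j * fine (strip_int E w (L ^- j)) <= C * fine (Hsq s w)].
Proof.
have [M [M0 L1 LM]] := hardy_scale; set L := 2 + M%:R * `|e0| in L1 LM.
have L0 : 0 < L by exact: lt_trans L1.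
pose K := (Num.sqrt n%:R * L) `^ p.
have K0 : 0 <= K by exact: powR_ge0.
have MR : 0 < M%:R :> R by rewrite ltr0n.
exists L, (2 * (1 + 2 * K)); split => // [|w Hw N]; first by rewrite mulr_ge0// addr_ge0// mulr_ge0.
have mw := Hs_meas Hw.
pose br t := fine (strip_int E w t).
pose hr t := fine (annulus_gag s w t (L * t)).
have br0 t : 0 <= br t by rewrite fine_ge0// strip_int_ge0.
have hr0 t : 0 <= hr t by rewrite fine_ge0// annulus_gag_ge0.
have finA t : annulus_gag s w t (L * t) \is a fin_num.
  rewrite ge0_fin_numE ?annulus_gag_ge0//.
  apply: le_lt_trans (gagliardo_lty Hw).
  rewrite (gagliardo_shift s mw); apply: dint_le.
  - exact: measurable_annulus_gag.
  - apply: measurable2M; last exact: measurable2_2 (measurable_rker s).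
    apply: measurable2X; apply: measurable2B; first exact: measurable2_1.
    exact: measurable2_add.
  - by move=> x y; nonneg.
  - by move=> x y; apply: ler_piMl; [nonneg|rewrite indicE lern1 leq_b1].
have step t : 0 < t -> br t <= 2 * K * t `^ (2 * s) * hr t + 2 / M%:R * br (L * t).
  move=> t0; have := hardy_step coneG ballG EG e02 s0 mw t0 (lexx L).
  rewrite -(fineK (strip_int_fin t Hw)) -(fineK (strip_int_fin (L * t) Hw)).
  rewrite -(fineK (finA t)) -!EFinM -EFinD lee_fin -/(br t) -/(br (L * t)) -/(hr t).
  have tn : 0 < t ^+ n by rewrite exprn_gt0.
  have -> : (Num.sqrt n%:R * (L * t)) `^ p = K * (t ^+ n * t `^ (2 * s)).
    rewrite mulrA powRM ?mulr_ge0 ?sqrtr_ge0 ?(ltW L0) ?(ltW t0)// -/K; congr (_ * _).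
    by rewrite -powR_mulrn ?(ltW t0)// -powRD// (gt_eqF t0) implybT.
  move=> h; rewrite -(ler_pM2l (mulr_gt0 MR tn)); apply: le_trans h _.
  rewrite le_eqVlt; apply/orP; left; apply/eqP.
  move: (br (L * t)) (hr t) (t `^ _) => u v z.
  by field; rewrite gt_eqF.
pose W := L `^ (2 * s).
have W0 : 0 < W by rewrite powR_gt0.
pose c j := W ^+ j * br (L ^- j).
have c0 j : 0 <= c j by rewrite mulr_ge0// exprn_ge0// ltW.
have Lj j : 0 < L ^- j by rewrite invr_gt0 exprn_gt0.
have WL j : W ^+ j * (L ^- j) `^ (2 * s) = 1.
  rewrite /W -powR_mulrn ?powR_ge0// -powRrM mulrC -powR_inv1 ?exprn_ge0 ?(ltW L0)//.
  rewrite -[L ^+ j]powR_mulrn ?(ltW L0)// -!powRrM -powRD; last by rewrite (gt_eqF L0) implybT.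
  by rewrite (_ : _ + _ = 0) ?powRr0//; ring.
(* [hardy_step] at t = L^(-j-1), multiplied by W^(j+1) = t^(-2s). The weight cancels the power of t
   in front of the seminorm, and W (2/M) <= 1/2 by the choice of M. *)
have rec j : c j.+1 <= 2 * K * hr (L ^- j.+1) + 2^-1 * c j.
  rewrite /c; have := ler_wpM2l (exprn_ge0 j.+1 (ltW W0)) (step _ (Lj j.+1)).
  move/le_trans; apply; rewrite mulrDr; apply: lerD.
    rewrite (_ : W ^+ j.+1 * (2 * K * (L ^- j.+1) `^ (2 * s) * hr (L ^- j.+1)) =
      2 * K * (W ^+ j.+1 * (L ^- j.+1) `^ (2 * s)) * hr (L ^- j.+1)).
      by rewrite WL mulr1.
    by move: ((L ^- j.+1) `^ _) (W ^+ _) => u v; ring.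
  have -> : L * L ^- j.+1 = L ^- j by rewrite exprS invfM mulrA divff ?gt_eqF// mul1r.
  have -> : W ^+ j.+1 * (2 / M%:R * br (L ^- j)) = W * (2 / M%:R) * (W ^+ j * br (L ^- j)).
    by rewrite exprS; move: (br _) (W ^+ j) => u v; ring.
  rewrite ler_wpM2r ?mulr_ge0 ?exprn_ge0 ?(ltW W0)//.
  have : W <= M%:R / 4 by exact: LM.
  rewrite mulrA ler_pdivrMr// ler_pdivlMr//; lra.
have G : \sum_(j < N) hr (L ^- j) <= fine (Hsq s w).
  rewrite -lee_fin (fineK (Hsq_fin Hw)) -sumEFin.
  rewrite (eq_bigr (fun j : 'I_N => annulus_gag s w (L ^- j) (L * L ^- j))); last first.
    by move=> j _; rewrite /hr (fineK (finA _)).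
  apply: le_trans (annulus_gag_sum N mw L1) _.
  by rewrite /Hsq leeDr// L2sq_ge0.
have c00 : c 0 <= fine (Hsq s w).
  rewrite /c expr0 mul1r /br -lee_fin (fineK (Hsq_fin Hw)) (fineK (strip_int_fin _ Hw)).
  apply: le_trans (strip_int_le _ mw) _.
  by rewrite /Hsq leeDl// gagliardo_ge0.
have -> : \sum_(j < N) W ^+ j * fine (strip_int E w (L ^- j)) = \sum_(j < N) c j by [].
(* Partial sums are real numbers, so the half on the right can be absorbed, which gives a bound
   independent of their length. *)
have S N' : (N' <= N)%N -> \sum_(j < N') c j <=
    c 0 + 2 * K * \sum_(j < N') hr (L ^- j) + 2^-1 * \sum_(j < N') c j.
  case: N' => [|N' _]; first by rewrite !big_ord0 !mulr0 !addr0.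
  rewrite [leLHS]big_ord_recl/= -addrA lerD2l.
  rewrite [X in 2 * K * X]big_ord_recl/= mulrDr -addrA.
  apply: ler_wpDl; first by rewrite !mulr_ge0.
  rewrite [X in 2^-1 * X]big_ord_recr/= mulrDr addrA.
  apply: ler_wpDr; first by rewrite mulr_ge0.
  rewrite !mulr_sumr -big_split/=; apply: ler_sum => j _; exact: rec.
have := S N (leqnn N); have := ler_wpM2l (mulr_ge0 (ler0n _ 2) K0) G.
move: (\sum_(j < N) c j) (2 * K * \sum_(j < N) hr _) c00.
rewrite (_ : 2 * (1 + 2 * K) * fine (Hsq s w) =
  2 * fine (Hsq s w) + 2 * (2 * K * fine (Hsq s w))); last by ring.
move: (2 * K * fine (Hsq s w)) (fine (Hsq s w)) (c 0) => Z q c' X Y h1 h2 h3; lra.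
Qed.

End hardy_sum.

(** * Multiplication by Lipschitz cutoffs *)

Section multiplier.
Context {R : realType} {n : nat} (s : R).
Hypotheses (s0 : 0 < s) (s1 : s < 1).
Local Notation rV := 'rV[R]_n.
Local Notation mu := (@lebesgue_rV R n).
Local Notation k := (@rker R n s).

Lemma integral_rV_subl (x : rV) (F : rV -> \bar R) :
  measurable_fun setT F -> (forall y, 0 <= F y)%E ->
  (\int[mu]_y F (x - y)%R = \int[mu]_y F y)%E.
Proof.
move=> mF F0; rewrite (@integral_rV_opp R n (fun y => F (x + y)%R)).
- exact: integral_rV_addl.
- by apply: (measurableT_comp mF); exact: measurable_rV_addl.
- by [].
Qed.

Lemma dint_weight_le (w : rV -> R) (F : rV -> rV -> R) (c : R) :
  measurable_fun setT w -> measurable2 F ->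
  (forall x, 0 <= w x) -> (forall x y, 0 <= F x y) -> 0 <= c ->
  (forall x, (\int[mu]_y (F x y)%:E <= c%:E)%E) ->
  (dint (fun x y => w x * F x y)%R <= c%:E * \int[mu]_x (w x)%:E)%E.
Proof.
move=> mw mF w0 F0 c0 Fc; rewrite (dint_wl mF F0 w0) -(nnint_scale mu mw w0 c0).
have m1 := measurable_dint_inner mF F0.
have mwE : measurable_fun setT (fun x => (w x)%:E) by exact/measurable_EFinP.
have mcE : measurable_fun setT (fun x => (c * w x)%:E).
  by apply/measurable_EFinP; apply: measurable_funM mw; exact: measurable_cst.
apply: ge0_le_integral.
- exact: measurableT.
- by move=> x _; rewrite mule_ge0 ?lee_fin ?w0//; exact: nnint_ge0.
- exact: emeasurable_funM mwE m1.
- exact: mcE.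
- by move=> x _; rewrite mulrC EFinM; apply: lee_wpmul2l; rewrite ?lee_fin ?w0.
Qed.

(* [min 1 (|z| / t)] bounds the oscillation of a [1/t]-Lipschitz function with
   values in [[0, 1]]. *)
Definition cut_ker (t : R) (z : rV) : R := Num.min 1 (`|z| / t) ^+ 2 * k z.

Lemma cut_ker_ge0 t z : 0 <= cut_ker t z.
Proof. by rewrite mulr_ge0 ?sqr_ge0 ?rker_ge0. Qed.

Lemma measurable_cut_ker t : measurable_fun setT (cut_ker t).
Proof.
apply: measurable_funM (measurable_rker s); apply: measurable_sqr.
apply: measurable_minr; first exact: measurable_cst.
apply: measurable_funM; last exact: measurable_cst.
exact: continuous_measurable_rV (@continuous_norm_rV R n).
Qed.

Lemma cut_ker_dist (t : R) (psi : rV -> R) x y : 0 <= psi x <= 1 -> 0 <= psi y <= 1 ->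
  `|psi x - psi y| <= `|x - y| / t ->
  (psi x - psi y) ^+ 2 * k (x - y) <= cut_ker t (x - y).
Proof.
move=> /andP[a0 a1] /andP[b0 b1] ab; rewrite ler_wpM2r ?rker_ge0//.
rewrite -[leLHS]real_normK ?num_real// lerXn2r ?nnegrE ?le_min ?ab ?ler01 ?(le_trans _ ab)//.
by rewrite andbT ler_norml; apply/andP; split; lra.
Qed.

Lemma int_cut_ker : exists2 C : R, 0 <= C & forall (t : R) x, 0 < t ->
  (\int[mu]_y (cut_ker t (x - y))%:E <= (C * t `^ (- (2 * s)))%:E)%E.
Proof.
have [C C0 HC] := @int_rker_near R n s s0 s1; exists C => // t x t0.
rewrite (@integral_rV_subl x (fun z => (cut_ker t z)%:E)); first exact: HC.
- by apply/measurable_EFinP; exact: measurable_cut_ker.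
- by move=> y; rewrite lee_fin cut_ker_ge0.
Qed.

Lemma int_far_ker : exists2 C : R, 0 <= C & forall (t : R) x, 0 < t ->
  (\int[mu]_y (\1_[set z : rV | t <= `|z|] (x - y) * k (x - y))%:E <=
     (C * t `^ (- (2 * s)))%:E)%E.
Proof.
have [C C0 HC] := @int_rker_far R n s s0; exists C => // t x t0.
pose F z := \1_[set z : rV | t <= `|z|] z * k z.
rewrite (@integral_rV_subl x (fun z => (F z)%:E)); first exact: HC.
- apply/measurable_EFinP; apply: measurable_funM (measurable_rker s).
  by apply: measurable_indic; exact: measurable_normr_ge.
- by move=> y; rewrite lee_fin /F; nonneg.
Qed.

(** Split the increment of chi g as chi(y) (g(x) - g(y)) + g(x) (chi(x) - chi(y)). The first part is
    controlled by the seminorm of g, the second by g(x)^2 times the integral of [cut_ker], which is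
    bounded uniformly in x. *)
Lemma Hsq_mult_lip (t : R) : 0 < t -> exists2 C : R, 0 <= C &
  forall chi g : rV -> R, measurable_fun setT chi -> measurable_fun setT g ->
  (forall x, 0 <= chi x <= 1) ->
  (forall x y, `|chi x - chi y| <= `|x - y| / t) ->
  (Hsq s (fun x => chi x * g x)%R <= C%:E * Hsq s g)%E.
Proof.
move=> t0; have [C C0 HC] := int_cut_ker.
set c := C * t `^ (- (2 * s)); have c0 : 0 <= c by rewrite mulr_ge0// powR_ge0.
exists (2 + 2 * c) => [|chi g mchi mg chi01 chil]; first by rewrite addr_ge0// mulr_ge0.
have mcg : measurable_fun setT (fun x => chi x * g x) by exact: measurable_funM.
have m1 := measurable_gag s mg.
have mK : measurable2 (fun x y => cut_ker t (x - y)).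
  exact: measurable2_sub (measurable_cut_ker t).
have m2 : measurable2 (fun x y => g x ^+ 2 * cut_ker t (x - y)).
  by apply: measurable2M mK; apply: measurable2_1; exact: measurable_sqr.
have p2 x y : 0 <= g x ^+ 2 * cut_ker t (x - y) by rewrite mulr_ge0 ?sqr_ge0 ?cut_ker_ge0.
have gag : (gagliardo s (fun x => chi x * g x)%R <=
            2%:E * (gagliardo s g + c%:E * L2sq g))%E.
  apply: (@le_trans _ _ (2%:E * (gagliardo s g +
      dint (fun x y => g x ^+ 2 * cut_ker t (x - y))%R))%E).
    rewrite !gagliardoE -(dint_add m1 m2 (gag_ge0 s g) p2).
    rewrite -(dint_scale (measurable2D m1 m2) (fun x y => addr_ge0 (gag_ge0 s g x y) (p2 x y)) (ler0n _ 2)).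
    apply: dint_le.
    - exact: measurable_gag.
    - by apply: measurable2M (measurable2D m1 m2); exact: measurable2_cst.
    - by move=> x y; nonneg.
    - move=> x y.
      have -> : chi x * g x - chi y * g y = chi y * (g x - g y) + g x * (chi x - chi y) by ring.
      apply: le_trans (ler_wpM2r (rker_ge0 s _) (sqrD_le _ _)) _.
      rewrite -mulrA ler_wpM2l// mulrDl !exprMn -(mulrA (chi y ^+ 2)) -(mulrA (g x ^+ 2)); apply: lerD.
        rewrite ler_piMl//; first by nonneg.
        by have /andP[h0 h1] := chi01 y; rewrite expr_le1.
      by rewrite ler_wpM2l ?sqr_ge0//; exact: cut_ker_dist.
  apply: lee_wpmul2l; first by rewrite lee_fin.
  apply: leeD2l; rewrite L2sqE.
  apply: (dint_weight_le (measurable_sqr mg) mK) => //; first by move=> x; exact: sqr_ge0.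
    by move=> x y; exact: cut_ker_ge0.
  by move=> x; exact: HC.
have L2 : (L2sq (fun x => chi x * g x)%R <= L2sq g)%E.
  apply: L2sq_le => // x; rewrite exprMn ler_piMl ?sqr_ge0//.
  by have /andP[h0 h1] := chi01 x; rewrite expr_le1.
have G0 := gagliardo_ge0 s g; have L0 := L2sq_ge0 g.
apply: le_trans (leeD L2 gag) _; rewrite /Hsq.
move: (L2sq g) (gagliardo s g) L0 G0 => a b a0 b0.
have cE : (0 <= c%:E :> \bar R)%E by rewrite lee_fin.
rewrite !ge0_muleDr ?mule_ge0// muleA -EFinM addeCA addeC.
have -> : ((2 + 2 * c)%:E * b = 2%:E * b + (2 * c)%:E * b)%E.
  by rewrite EFinD ge0_muleDl ?lee_fin ?mulr_ge0 ?powR_ge0.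
have -> : ((2 + 2 * c)%:E * a = a + (1 + 2 * c)%:E * a)%E.
  rewrite (_ : 2 + 2 * c = 1 + (1 + 2 * c)); last by ring.
  by rewrite EFinD ge0_muleDl ?lee_fin ?addr_ge0 ?mulr_ge0 ?powR_ge0// mul1e.
apply: leeD.
  by apply: leeD2l; apply: lee_wpmul2r => //; rewrite lee_fin lerDr.
by rewrite leeDl// mule_ge0// lee_fin mulr_ge0 ?powR_ge0.
Qed.

End multiplier.

Lemma dint_sym (R : realType) n (F : 'rV[R]_n -> 'rV[R]_n -> R) : measurable2 F ->
  (forall x y, 0 <= F x y) ->
  dint (fun x y => F x y + F y x) = (2%:E * dint F)%E.
Proof.
move=> mF F0; rewrite (dint_add mF (measurable2_swap mF) F0 (fun x y => F0 y x)).
rewrite (dint_swap mF F0) (_ : 2%:E = 1%:E + 1%:E :> \bar R)%E; last by rewrite -EFinD.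
by rewrite ge0_muleDl ?lee_fin// mul1e.
Qed.

(** * Smallness of functions cut off to a thin strip *)

Section strip_cutoff.
Context {R : realType} {n : nat} (s : R).
Hypotheses (s0 : 0 < s) (s1 : s < 1).
Local Notation rV := 'rV[R]_n.
Local Notation mu := (@lebesgue_rV R n).
Local Notation k := (@rker R n s).
Variables (E : set rV) (L : R).
Hypothesis L1 : 1 < L.

Let L0 : 0 < L. Proof. exact: lt_trans L1. Qed.

Let Lj0 j : 0 < L ^- j. Proof. by rewrite invr_gt0 exprn_gt0. Qed.

Lemma exprVn_small (e : R) : 0 < e -> exists j, L ^- j < e.
Proof.
move=> e0; have /cvgrPdist_lt /(_ e e0) [N _ HN] : L^-1 ^+ j @[j --> \oo] --> (0 : R).
  by apply: cvg_expr; rewrite ger0_norm ?invr_ge0 ?(ltW L0)// invf_lt1.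
exists N; have := HN N (leqnn N); rewrite sub0r normrN exprVn.
by rewrite gtr0_norm.
Qed.

Lemma leaves_nbhd x : ~ closure E x -> exists N, forall j, (N <= j)%N -> ~ nbhd E (L ^- j) x.
Proof.
move=> nx; have [e e0 He] : exists2 e : R, 0 < e & ball x e `<=` ~` E.
  have : nbhs x (~` closure E).
    by apply: open_nbhs_nbhs; split => //; apply: closed_openC; exact: closed_closure.
  move=> /nbhs_ballP[e e0 He]; exists e => // y xy Ey.
  by apply: He xy _; exact: subset_closure.
have [N HN] := exprVn_small e0; exists N => j Nj [z Ez xz].
apply: He Ez; rewrite -ball_normE/=; apply: lt_trans xz _; apply: le_lt_trans HN.
by rewrite lef_pV2 ?posrE ?exprn_gt0// ler_weXn2l// ltW.
Qed.

(** Strips exclude cl [E], and every point outside cl [E] eventually leaves them. Hence their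
    indicators tend to 0 everywhere and dominated convergence applies to the inner integral of
    [H]. *)
Lemma dint_strip_small (H : rV -> rV -> R) : measurable2 H -> (forall x y, 0 <= H x y) ->
  (dint H < +oo)%E -> forall e : R, 0 < e -> exists N, forall j, (N <= j)%N ->
  (dint (fun x y => \1_(strip E (L ^- j)) x * H x y)%R <= e%:E)%E.
Proof.
move=> mH H0 Hoo e e0.
pose h x := (\int[mu]_y (H x y)%:E)%E.
have mh : measurable_fun setT h by exact: measurable_dint_inner.
have h0 x : (0 <= h x)%E by exact: nnint_ge0.
have ih : mu.-integrable setT h.
  apply/integrableP; split => //; apply: le_lt_trans Hoo; rewrite dint_def.
  by rewrite (eq_integral h)// => x _; rewrite gee0_abs.
have m1 j : measurable_fun setT (\1_(strip E (L ^- j)) : rV -> R).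
  by apply: measurable_indic; exact: measurable_strip.
pose f j x := ((\1_(strip E (L ^- j)) x)%:E * h x)%E.
have mf j : measurable_fun setT (f j).
  by apply: emeasurable_funM mh; exact/measurable_EFinP.
have cf x : f ^~ x @ \oo --> (0%E : \bar R).
  have [cx|/leaves_nbhd[N HN]] := pselect (closure E x).
    rewrite (_ : f ^~ x = cst 0%E); first exact: cvg_cst.
    apply/funext => j; rewrite /f indicE memNset ?mul0e//.
    by move=> -[_]; apply.
  apply: cvg_near_cst; exists N => // j /= Nj; apply/eqP.
  rewrite /f indicE memNset ?mul0e// => -[+ _].
  exact: HN.
have ae1 : {ae mu, forall x, setT x -> f ^~ x @ \oo --> (cst 0%E : rV -> \bar R) x}.
  by apply: aeW => x _; exact: cf.
have ae2 : {ae mu, forall x j, setT x -> (`|f j x| <= h x)%E}.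
  apply: aeW => x j _; rewrite /f abseM gee0_abs ?lee_fin// (gee0_abs (h0 x)).
  by rewrite -[leRHS]mul1e lee_wpmul2r// lee_fin indicE lern1 leq_b1.
have [_ _] := @dominated_convergence _ _ _ mu setT measurableT f (cst 0%E) h mf
  (measurable_cst _) ae1 ih ae2.
rewrite integral0 => cI.
have fE j : (\int[mu]_x f j x = dint (fun x y => \1_(strip E (L ^- j)) x * H x y)%R)%E.
  by rewrite (dint_wl mH H0) => // x; rewrite indicE.
have fin j : (\int[mu]_x f j x \is a fin_num)%E.
  rewrite ge0_fin_numE.
  - apply: le_lt_trans Hoo; rewrite fE; apply: dint_le => //.
    + by apply: measurable2M mH; exact: measurable2_1.
    + by move=> x y; nonneg.
    + by move=> x y; rewrite ler_piMl// indicE lern1 leq_b1.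
  - by rewrite fE; apply: dint_ge0 => x y; nonneg.
have /fine_cvgP[_ /cvgrPdist_le /(_ e e0) [N _ HN]] := cI.
exists N => j Nj; rewrite -fE -(fineK (fin j)) lee_fin.
have := HN j Nj; rewrite /= sub0r normrN; apply: le_trans; exact: ler_norm.
Qed.

(* The strip is cut into the layers between the [L ^- j.+1]- and
   [L ^- j]-neighbourhoods of [E]. *)
Lemma strip_layer x : strip E (L ^- 0) x ->
  exists j, strip E (L ^- j) x /\ ~ nbhd E (L ^- j.+1) x.
Proof.
move=> [N0 nx]; have [N HN] := leaves_nbhd nx.
have ex : exists j, `[< ~ nbhd E (L ^- j) x >] by exists N; apply/asboolP; exact: HN.
have [[|j] /asboolP nj jmin] := ex_minnP ex; first by case: (nj N0).
exists j; split => //; split => //; apply: contrapT => nj'.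
by have := jmin j (asboolT nj'); rewrite ltnn.
Qed.

Lemma far_from_closure x y t : ~ nbhd E t x -> closure E y -> t <= `|x - y|.
Proof.
move=> nx cy; rewrite leNgt; apply/negP => xy; apply: nx.
have d0 : 0 < t - `|x - y| by rewrite subr_gt0.
have [z [Ez yz]] := cy _ (nbhsx_ballx y _ d0); exists z => //.
move: yz; rewrite -ball_normE/= => yz.
rewrite -(subrKA y x); apply: le_lt_trans (ler_normD _ _) _.
by rewrite -ltrBrDl.
Qed.

Let W := L `^ (2 * s).

Let W0 : 0 < W. Proof. exact: powR_gt0. Qed.

Let WL j : (L ^- j) `^ (- (2 * s)) = W ^+ j.
Proof.
have h1 : L ^- j = L `^ (- j%:R) by rewrite powRN powR_mulrn ?(ltW L0).
have h2 : W ^+ j = W `^ j%:R by rewrite powR_mulrn ?(ltW W0).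
by rewrite h1 h2 /W -!powRrM mulrNN mulrC.
Qed.

Variables (w : rV -> R) (Z : R).
Hypothesis Hw : Hs s w.
Hypothesis HZ : forall N, \sum_(j < N) W ^+ j * fine (strip_int E w (L ^- j)) <= Z.

Let mw : measurable_fun setT w. Proof. exact: Hs_meas Hw. Qed.

Let c j := W ^+ j * fine (strip_int E w (L ^- j)).

Let c0 j : 0 <= c j.
Proof. by rewrite mulr_ge0 ?exprn_ge0 ?(ltW W0)// fine_ge0// strip_int_ge0. Qed.

(** The Hardy bound makes the series of the [c j] converge, so its terms tend to 0. *)
Lemma strip_int_small e : 0 < e -> exists N, forall j, (N <= j)%N -> c j <= e.
Proof.
move=> e0; have cs : series c @ \oo --> limn (series c).
  apply: nondecreasing_is_cvgn.
    by apply/nondecreasing_series => j _ _; exact: c0.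
  exists Z => _ [N _ <-]; rewrite /series /= big_mkord; exact: HZ.
have /cvg_series_cvg_0 /cvgrPdist_le /(_ e e0) [N _ HN] : cvgn (series c) by apply/cvg_ex; exists (limn (series c)).
exists N => j Nj; have := HN j Nj; rewrite /= sub0r normrN; apply: le_trans; exact: ler_norm.
Qed.

Let m1 t : measurable_fun setT (\1_(strip E t) : rV -> R).
Proof. by apply: measurable_indic; exact: measurable_strip. Qed.

Let mwt t : measurable_fun setT (fun x => \1_(strip E t) x * w x ^+ 2).
Proof. by apply: measurable_funM => //; exact: measurable_sqr. Qed.

(** A point of layer [j] is at distance at least L^(-j-1) from cl [E], so its kernel integral over
    cl [E] is at most C W^(j+1). Summing over the layers leaves the Hardy sum. *)
Lemma int_strip_complement :
  (dint (fun x y => (\1_(strip E (L ^- 0)) x * w x ^+ 2) * (\1_(closure E) y * k (x - y)))%R < +oo)%E.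
Proof.
have [C C0 HC] := @int_far_ker R n s s0.
have mK : measurable2 (fun x y => \1_(closure E) y * k (x - y)).
  apply: measurable2M; last exact: measurable2_sub (measurable_rker s).
  apply: measurable2_2; apply: measurable_indic; apply: closed_measurable_rV.
  exact: closed_closure.
have K0 x y : 0 <= \1_(closure E) y * k (x - y) by nonneg.
have w0 t x : 0 <= \1_(strip E t) x * w x ^+ 2 by nonneg.
rewrite (dint_wl mK K0 (w0 _)); apply: le_lt_trans (ltry (C * W * Z)).
apply: (@nnint_eseries_le _ _ _ _ _
  (fun j x => C * W ^+ j.+1 * (\1_(strip E (L ^- j)) x * w x ^+ 2))
  (fun j => C * W * c j)).
- apply: emeasurable_funM; first by apply/measurable_EFinP; exact: mwt.
  exact: measurable_dint_inner.
- by move=> j; apply: measurable_funM; [exact: measurable_cst|exact: mwt].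
- by move=> x; apply: mule_ge0; [rewrite lee_fin|exact: nnint_ge0].
- by move=> j x; rewrite mulr_ge0// mulr_ge0// exprn_ge0// ltW.
- move=> x; have [h|[h /strip_layer [j [Sj nj]]]] := indic01 (strip E (L ^- 0)) x.
    by left; rewrite h mul0r mul0e.
  right; exists j; rewrite h mul1r [X in C * _ * (X * _)]indicE mem_set// mul1r.
  rewrite [leRHS]EFinM muleC; apply: lee_wpmul2r; first by rewrite lee_fin sqr_ge0.
  rewrite -WL; apply: le_trans (HC _ x (Lj0 j.+1)); apply: nnint_le.
  + exact: measurable2_y mK.
  + apply: (measurable2_y (F := fun x y => \1_[set z : rV | L ^- j.+1 <= `|z|] (x - y) * k (x - y))).
    apply: (measurable2_sub (u := fun z => \1_[set z : rV | L ^- j.+1 <= `|z|] z * k z)).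
    apply: measurable_funM (measurable_rker s).
    by apply: measurable_indic; exact: measurable_normr_ge.
  + by move=> y; exact: K0.
  + move=> y; rewrite ler_wpM2r ?rker_ge0//.
    have [->|[-> cy]] := indic01 (closure E) y; first exact: indic_ge0'.
    by rewrite indicE mem_set//=; exact: far_from_closure nj cy.
- move=> j; rewrite (nnint_scale mu (mwt _) (w0 _)); last first.
    by rewrite mulr_ge0// exprn_ge0// ltW.
  rewrite -/(strip_int E w (L ^- j)) -(fineK (strip_int_fin E (L ^- j) Hw)) -EFinM lee_fin.
  by rewrite /c exprS !mulrA.
- apply: lime_le.
    by apply: is_cvg_nneseries => j _ _; rewrite lee_fin mulr_ge0// mulr_ge0// ltW.
  apply: nearW => N; rewrite sumEFin lee_fin big_mkord -mulr_sumr.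
  by rewrite ler_wpM2l// mulr_ge0// ltW.
Qed.

(** [psi] may jump across the boundary of cl [E], so its Lipschitz bound is available only for [y]
    outside cl [E]. For [y] in cl [E] the whole value at [x] is charged to the kernel restricted to
    cl [E]. *)
Lemma strip_cutoff_pt (S : set rV) (psi : rV -> R) (t : R) x y :
  (forall z, 0 <= psi z <= 1) -> (S y -> ~ closure E y) -> (psi y != 0 -> S y) ->
  (~ closure E y -> `|psi x - psi y| <= `|x - y| / t) ->
  (psi x * w x - psi y * w y) ^+ 2 * k (x - y) <=
  2 * ((w x - w y) ^+ 2 * k (x - y) + w x ^+ 2 * (\1_(closure E) y * k (x - y))) +
  2 * (w x ^+ 2 * cut_ker s t (x - y)).
Proof.
move=> psi01 Sy psiS lip; have [x0 x1] := andP (psi01 x).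
have [y0 y1] := andP (psi01 y).
have k0 := rker_ge0 s (x - y); have m0 := cut_ker_ge0 s t (x - y).
have [cy|ncy] := pselect (closure E y).
  have -> : psi y = 0 by apply: contrapT => /eqP /psiS /Sy.
  rewrite mul0r subr0 indicE mem_set// mul1r exprMn.
  have h1 : psi x ^+ 2 * w x ^+ 2 * k (x - y) <= w x ^+ 2 * k (x - y).
    by rewrite ler_wpM2r// ler_piMl ?sqr_ge0// expr_le1.
  have h2 : 0 <= (w x - w y) ^+ 2 * k (x - y) by nonneg.
  have h3 : 0 <= w x ^+ 2 * cut_ker s t (x - y) by nonneg.
  have h4 : 0 <= w x ^+ 2 * k (x - y) by nonneg.
  move: h1 h2 h3 h4; move: (_ * k (x - y)) (w x ^+ 2 * k (x - y)) (_ * k (x - y)) (w x ^+ 2 * cut_ker _ _ _).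
  move=> a b c' d ? ? ? ?; lra.
have h1 := cut_ker_dist s (psi01 x) (psi01 y) (lip ncy).
have -> : psi x * w x - psi y * w y = psi y * (w x - w y) + w x * (psi x - psi y) by ring.
apply: le_trans (ler_wpM2r k0 (sqrD_le _ _)) _.
rewrite -mulrDr -mulrA ler_wpM2l// mulrDl !exprMn -(mulrA (psi y ^+ 2)) -(mulrA (w x ^+ 2)).
rewrite -addrA; apply: lerD.
  by rewrite ler_piMl ?expr_le1//; nonneg.
apply: ler_wpDl; first by nonneg.
by rewrite ler_wpM2l ?sqr_ge0.
Qed.

Lemma strip_cutoff_small (a e : R) : 0 < a -> 0 < e -> exists j,
  forall psi : rV -> R, measurable_fun setT psi -> (forall x, 0 <= psi x <= 1) ->
  (forall x, psi x != 0 -> strip E (L ^- j) x) ->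
  (forall x y, ~ closure E x -> ~ closure E y ->
     `|psi x - psi y| <= `|x - y| / (L ^- j * a)) ->
  (Hsq s (fun x => psi x * w x)%R <= e%:E)%E.
Proof.
move=> a0 e0; have [C C0 HC] := @int_cut_ker R n s s0 s1.
pose A := C * a `^ (- (2 * s)); have A0 : 0 <= A by rewrite mulr_ge0// powR_ge0.
pose S j := strip E (L ^- j).
(* A majorant independent of the scale: the widest strip [S 0] is used here, so that
   [dint_strip_small] can make its restriction to [S j] small. *)
pose H x y := (w x - w y) ^+ 2 * k (x - y) +
  (\1_(S 0) x * w x ^+ 2) * (\1_(closure E) y * k (x - y)).
have mk2 : measurable2 (fun x y : rV => k (x - y)) by exact: measurable2_sub (measurable_rker s).
have mH2 : measurable2 (fun x y => (\1_(S 0) x * w x ^+ 2) * (\1_(closure E) y * k (x - y))).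
  apply: measurable2M; first exact: measurable2_1 (mwt _).
  apply: measurable2M mk2; apply: measurable2_2; apply: measurable_indic.
  by apply: closed_measurable_rV; exact: closed_closure.
have mH : measurable2 H := measurable2D (measurable_gag s mw) mH2.
have H20 x y : 0 <= (\1_(S 0) x * w x ^+ 2) * (\1_(closure E) y * k (x - y)) by nonneg.
have H0 x y : 0 <= H x y := addr_ge0 (gag_ge0 s w x y) (H20 x y).
have Hoo : (dint H < +oo)%E.
  rewrite (dint_add (measurable_gag s mw) mH2 (gag_ge0 s w) H20) -gagliardoE.
  by rewrite lte_add_pinfty//; [exact: gagliardo_lty Hw|exact: int_strip_complement].
(* The final bound is c + 4 (e/8 + A c) = (1 + 4A) c + e/2, with c the weighted mass of the
   strip. *)
have e1 : 0 < e / (2 * (1 + 4 * A)) by rewrite divr_gt0// mulr_gt0// ltr_wpDr// mulr_ge0.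
have e2 : 0 < e / 8 by rewrite divr_gt0.
have [N1 HN1] := strip_int_small e1.
have [N2 HN2] := dint_strip_small mH H0 Hoo e2.
exists (maxn N1 N2) => psi mpsi psi01 psiS psil.
have := HN1 _ (leq_maxl N1 N2); have := HN2 _ (leq_maxr N1 N2).
move: (maxn N1 N2) psiS psil => j psiS psil I2 I1.
set t := L ^- j * a in psil.
have mpw : measurable_fun setT (fun x => psi x * w x) by exact: measurable_funM.
have SI : (strip_int E w (L ^- j) <= (c j)%:E)%E.
  rewrite -(fineK (strip_int_fin E (L ^- j) Hw)) lee_fin /c ler_peMl//.
    by rewrite fine_ge0// strip_int_ge0.
  by rewrite exprn_ege1// -(powRr0 L) ltW// ltr_powR_base_gt1// mulr_gt0.
have L2 : (L2sq (fun x => psi x * w x)%R <= (c j)%:E)%E.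
  apply: le_trans SI; rewrite L2sqE; apply: nnint_le.
  - exact: measurable_sqr.
  - exact: mwt.
  - by move=> x; exact: sqr_ge0.
  - move=> x; rewrite exprMn ler_wpM2r ?sqr_ge0//.
    have [->|/psiS Sx] := eqVneq (psi x) 0; first by rewrite expr0n indic_ge0'.
    by rewrite indicE mem_set//; have /andP[? ?] := psi01 x; rewrite expr_le1.
pose F1 x y := \1_(S j) x * H x y.
pose F2 x y := (\1_(S j) x * w x ^+ 2) * cut_ker s t (x - y).
have mF1 : measurable2 F1 by apply: measurable2M mH; exact: measurable2_1 (m1 _).
have mK : measurable2 (fun x y : rV => cut_ker s t (x - y)).
  exact: measurable2_sub (measurable_cut_ker s t).
have mF2 : measurable2 F2 by apply: measurable2M mK; exact: measurable2_1 (mwt _).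
have F10 x y : 0 <= F1 x y by rewrite mulr_ge0// indic_ge0'.
have F20 x y : 0 <= F2 x y by rewrite mulr_ge0 ?cut_ker_ge0// mulr_ge0 ?sqr_ge0 ?indic_ge0'.
pose F x y := 2 * (F1 x y + F2 x y).
have mF : measurable2 F.
  by apply: measurable2M (measurable2D mF1 mF2); exact: measurable2_cst.
have F0 x y : 0 <= F x y by rewrite mulr_ge0// addr_ge0.
have dF2 : (dint F2 <= (A * c j)%:E)%E.
  have tt : C * t `^ (- (2 * s)) = A * W ^+ j.
    by rewrite /t powRM ?(ltW (Lj0 j)) ?(ltW a0)// WL /A; ring.
  apply: le_trans (dint_weight_le (mwt _) mK _ _ _ (fun x => HC t x _)) _.
  - by move=> x; nonneg.
  - by move=> x y; exact: cut_ker_ge0.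
  - by rewrite mulr_ge0// powR_ge0.
  - by move=> _; exact: mulr_gt0.
  rewrite -/(strip_int E w (L ^- j)) -(fineK (strip_int_fin E (L ^- j) Hw)) -EFinM lee_fin.
  by rewrite tt mulrA.
have dF : (dint F <= (2 * (e / 8 + A * c j))%:E)%E.
  rewrite (dint_scale (measurable2D mF1 mF2) (fun x y => addr_ge0 (F10 x y) (F20 x y)) (ler0n _ 2)).
  rewrite (dint_add mF1 mF2 F10 F20) EFinM; apply: lee_wpmul2l; first by rewrite lee_fin.
  by rewrite EFinD; apply: leeD.
(* The pointwise bound needs its first point in the strip. Adding the same majorant with the points
   exchanged covers pairs whose second point alone is there, whence the factor 2. *)
have gag : (gagliardo s (fun x => psi x * w x)%R <= 2%:E * dint F)%E.
  have -> : (2%:E * dint F = dint (fun x y => F x y + F y x)%R)%E.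
    by rewrite dint_sym.
  rewrite gagliardoE; apply: dint_le.
  - exact: measurable_gag.
  - exact: measurable2D mF (measurable2_swap mF).
  - by move=> x y; nonneg.
  have S0 x : S j x -> S 0 x.
    by apply: strip_le; rewrite expr0 invr1 invf_le1 ?exprn_gt0// exprn_ege1// ltW.
  have pt x y : S j x ->
      (psi x * w x - psi y * w y) ^+ 2 * k (x - y) <= F x y.
    move=> Sx; have i1 : \1_(S j) x = 1 :> R by rewrite indicE mem_set.
    have i0 : \1_(S 0) x = 1 :> R by rewrite indicE mem_set//; exact: S0.
    rewrite /F /F1 /F2 /H i1 i0 !mul1r mulrDr; apply: (@strip_cutoff_pt (S j)) => //.
    - by move=> [].
    - exact: psiS.
    - by move=> ny; apply: psil => //; case: Sx.
  move=> x y; have [Sx|nSx] := pselect (S j x).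
    by apply: le_trans (pt x y Sx) _; rewrite lerDl.
  have [Sy|nSy] := pselect (S j y).
    have -> : (psi x * w x - psi y * w y) ^+ 2 = (psi y * w y - psi x * w x) ^+ 2 by ring.
    rewrite -rkerN opprB; apply: le_trans (pt y x Sy) _; by rewrite lerDr.
  have z x' : ~ S j x' -> psi x' = 0 by move=> h; apply: contrapT => /eqP /psiS.
  by rewrite (z x)// (z y)// !mul0r subrr expr0n mul0r addr_ge0.
apply: (@le_trans _ _ (c j + 2 * (2 * (e / 8 + A * c j)))%:E).
  rewrite EFinD; apply: leeD L2 _; apply: le_trans gag _.
  by rewrite EFinM; apply: lee_wpmul2l; rewrite ?lee_fin.
rewrite lee_fin; have : c j * (2 * (1 + 4 * A)) <= e.
  by rewrite -ler_pdivlMr// mulr_gt0// ltr_wpDr// mulr_ge0.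
move: (c j) => c' h; move: h; rewrite mulrDr mulrDr mulr1.
have -> : c' * (2 * (4 * A)) = 8 * (A * c') by ring.
move: (A * c') => b h; lra.
Qed.

End strip_cutoff.

(** * Approximation and representatives in the closure of the test functions *)

Section Hs_tilde.
Context {R : realType} {n : nat} (s : R).
Local Notation rV := 'rV[R]_n.
Local Notation mu := (@lebesgue_rV R n).
Implicit Types (u v f : rV -> R) (V : set rV).

Lemma Cc_infty_meas V f : Cc_infty V f -> measurable_fun setT f.
Proof. by move=> [/(_ 0) /= cf _ _]; exact: continuous_measurable_rV. Qed.

Lemma Cc_infty_out V f x : Cc_infty V f -> ~ V x -> f x = 0.
Proof.
move=> [_ _ fV] nV; apply: contrapT => /eqP fx; apply/nV/fV.
exact: subset_closure.
Qed.

Lemma Hs_tilde_approx V u : Hs_tilde s V u -> forall e : R, 0 < e ->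
  exists2 f, Cc_infty V f & (Hsq s (fun x => u x - f x)%R < e%:E)%E.
Proof.
move=> [_ H] e e0; have e1 : 0 < Num.sqrt e by rewrite sqrtr_gt0.
have [f Cf /(Hs_norm_lt s _ e1)] := H _ e1.
by rewrite sqr_sqrtr ?(ltW e0)// => uf; exists f.
Qed.

Lemma Hs_close u v : Hs s u -> measurable_fun setT v ->
  (Hsq s (fun x => u x - v x)%R < +oo)%E -> Hs s v.
Proof.
move=> Hu mv Huv; have Hd : Hs s (fun x => u x - v x).
  by apply/HsE; split => //; apply: measurable_funB => //; exact: Hs_meas Hu.
have := Hs_lin (-1) Hd Hu; congr (Hs s _); apply/funext => x; ring.
Qed.

Lemma Hs_tildeI V u : Hs s u -> (forall e : R, 0 < e ->
  exists2 f, Cc_infty V f & (Hsq s (fun x => u x - f x)%R < e%:E)%E) -> Hs_tilde s V u.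
Proof.
move=> Hu H; split => // e e0.
have [f Cf uf] := H (e ^+ 2) (exprn_gt0 2 e0); exists f => //.
exact/(Hs_norm_lt s _ e0).
Qed.

Lemma Cc_infty_Hs V u f e : Hs s u -> Cc_infty V f ->
  (Hsq s (fun x => u x - f x)%R < e%:E)%E -> Hs s f.
Proof.
move=> Hu Cf uf; apply: Hs_close Hu (Cc_infty_meas Cf) _.
exact: lt_trans uf (ltry _).
Qed.

Lemma Hs_ae_eq u v : Hs s u -> measurable_fun setT v -> ae_eq_on setT u v -> Hs s v.
Proof.
move=> Hu mv uv; have mf := Hs_meas Hu; apply: (Hs_close Hu mv).
have md : measurable_fun setT (fun x => u x - v x) by exact: measurable_funB.
suff -> : Hsq s (fun x => u x - v x) = 0%E by exact: ltry.
by apply: Hsq_ae0 md _; apply: filterS uv => x /= h _; rewrite h// subrr.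
Qed.

Lemma Hs_tilde_ae_eq V u v : Hs_tilde s V u -> measurable_fun setT v ->
  ae_eq_on setT u v -> Hs_tilde s V v.
Proof.
move=> Tu mv uv; have Hu := Tu.1; have mu_ := Hs_meas Hu.
apply: Hs_tildeI => [|e e0]; first exact: Hs_ae_eq Hu mv uv.
have e2 : 0 < e / 2 by rewrite divr_gt0.
have [f Cf uf] := Hs_tilde_approx Tu e2; exists f => //.
have mf := Cc_infty_meas Cf.
have -> : (fun x => v x - f x) = (fun x => (v x - u x) + (u x - f x)).
  by apply/funext => x; ring.
have m1 : measurable_fun setT (fun x => v x - u x) by exact: measurable_funB.
have m2 : measurable_fun setT (fun x => u x - f x) by exact: measurable_funB.
apply: le_lt_trans (Hsq_add s m1 m2) _.
have -> : Hsq s (fun x => v x - u x) = 0%E.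
  by apply: Hsq_ae0 => //; apply: filterS uv => x /= h _; rewrite h// subrr.
rewrite add0e (_ : e = 2 * (e / 2)); last by rewrite mulrC divfK.
by rewrite EFinM lte_pmul2l// lte_fin.
Qed.

(** Approximating test functions vanish off [V], so the mass of [u] there is bounded by the
    approximation error and is zero. *)
Lemma Hs_tilde_out V u : open V -> Hs_tilde s V u ->
  ae_eq_on setT u (fun x => \1_V x * u x).
Proof.
move=> oV Tu; have mf := Hs_meas Tu.1.
have mV : measurable V by exact: open_measurable_rV.
have m1 : measurable_fun setT (fun x => \1_V x * u x).
  by apply: measurable_funM => //; exact: measurable_indic.
have md : measurable_fun setT (fun x => u x - \1_V x * u x) by exact: measurable_funB.
suff /(L2sq_ae0 md) : L2sq (fun x => u x - \1_V x * u x) = 0%E.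
  by apply: filterS => x /= h _; apply/eqP; rewrite -subr_eq0 h.
apply/eqP; rewrite eq_le L2sq_ge0 andbT; apply/lee_addgt0Pr => e e0; rewrite add0e.
have [f Cf uf] := Hs_tilde_approx Tu e0; apply: le_trans (ltW uf).
have mff := Cc_infty_meas Cf.
apply: (@le_trans _ _ (L2sq (fun x => u x - f x))); last by rewrite /Hsq leeDl// gagliardo_ge0.
apply: L2sq_le => //; first exact: measurable_funB.
move=> x; have [Vx|nV] := pselect (V x).
  by rewrite indicE mem_set// mul1r subrr expr0n sqr_ge0.
by rewrite indicE memNset// mul0r (Cc_infty_out Cf nV).
Qed.

End Hs_tilde.

(** * Truncation outside cl [E] stays in the closure of the test functions *)

Section cutoff.
Context {R : realType} {n : nat} (s : R).
Hypotheses (s0 : 0 < s) (s12 : s < 2^-1).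
Local Notation rV := 'rV[R]_n.
Variables (E Gam : set rV) (e0 : rV).
Hypotheses (coneG : cone Gam) (ballG : ball e0 1 `<=` Gam).
Hypothesis EG : forall x y, closure E x -> Gam y -> E (x - y).
Hypothesis e02 : 2 <= `|e0|.
Variables (Om : set rV) (r : R) (w : rV -> R).
Hypothesis Omr : forall x, Om x -> `|x| <= r.
Hypotheses (Tw : Hs_tilde s Om w) (w_out : forall x, ~ Om x -> w x = 0).

Let s1 : s < 1.
Proof. by apply: lt_trans s12 _; rewrite invf_lt1// ltr1n. Qed.

(** The factor has to vanish on a whole neighbourhood of [E] of positive width: the support is a
    closure and must still avoid cl [E]. *)
Lemma Cc_infty_mul (V : set rV) (f g : rV -> R) (d : R) : 0 < d ->
  (forall k, Cn k g) -> (forall x, V x -> g x != 0 -> ~ nbhd E d x) ->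
  Cc_infty V f -> Cc_infty (V `\` closure E) (fun x => g x * f x).
Proof.
move=> d0 Cg gE [Cf cptf fV].
have sub : fsupp (fun x => g x * f x) `<=` fsupp f.
  by apply: closure_subset => x /=; apply: contra_neq => ->; rewrite mulr0.
split.
- by move=> k; apply: Cn_mul.
- apply: subclosed_compact cptf sub; exact: closed_closure.
- move=> x gfx; split; first exact/fV/sub.
  suff : (~` nbhd E d) x by apply: contra_not; exact: closure_nbhd.
  have cN : closed (~` nbhd E d) by apply: open_closedC; exact: nbhd_open.
  rewrite ((closure_id _).1 cN); apply: closure_subset gfx => z /= gfz.
  have fz : f z != 0 by apply: contra_neq gfz => ->; rewrite mulr0.
  apply: gE; last by apply: contra_neq gfz => ->; rewrite mul0r.
  by apply/fV/subset_closure.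
Qed.

Lemma Hs_tilde_cutoff :
  Hs_tilde s (Om `\` closure E) (fun x => \1_(~` closure E) x * w x).
Proof.
have Hw := Tw.1; have mw := Hs_meas Hw.
have [L [C [L1 C0 HS]]] := hardy_sum coneG ballG EG e02 s0 s12.
have [C1 C10 bump] := @lattice_bump R n.
have mP : measurable_fun setT (\1_(~` closure E) : rV -> R).
  apply: measurable_indic; apply: open_measurable_rV; apply: closed_openC.
  exact: closed_closure.
have mw1 : measurable_fun setT (fun x => \1_(~` closure E) x * w x).
  exact: measurable_funM.
(* With d = t/3 the lattice cutoff has Lipschitz constant C1/d = 3 C1/t <= 1/(t a); adding 1 keeps
   the denominator positive. *)
pose a : R := (3 * (C1 + 1))^-1.
have a0 : 0 < a by rewrite invr_gt0 mulr_gt0// ltr_wpDl.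
(* Asking for [Hs s f] as well yields, with error 1, that the truncation itself is in [Hs]. *)
suff H e : 0 < e -> exists2 f, Cc_infty (Om `\` closure E) f & Hs s f /\
    (Hsq s (fun x => \1_(~` closure E) x * w x - f x)%R < e%:E)%E.
  apply: Hs_tildeI => [|e ep].
    have [f _ [Hf wf]] := H 1 ltr01; apply: (Hs_close Hf mw1).
    rewrite -HsqN; last by apply: measurable_funB => //; exact: Hs_meas Hf.
    rewrite (_ : (fun x => - _) = (fun x => \1_(~` closure E) x * w x - f x)).
      exact: lt_trans wf (ltry _).
    by apply/funext => x; rewrite opprB.
  by have [f Cf [_ wf]] := H e ep; exists f.
move=> ep; have e4 : 0 < e / 4 by rewrite divr_gt0.
have [j Hj] := strip_cutoff_small s0 s1 L1 Hw (HS w Hw) a0 e4.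
pose t := L ^- j; have t0 : 0 < t by rewrite invr_gt0 exprn_gt0// (lt_trans _ L1).
(* Three layers of width d: on [Om], [eta] is 1 within d of [E]; its centres lie within 2d, and it
   vanishes beyond 3d = t. *)
pose d := t / 3; have d0 : 0 < d by rewrite divr_gt0.
have [eta [Ceta eta01 etal eta1 etaD]] := bump d r (nbhd E (2 * d)) d0.
pose chi x := 1 - eta x.
have Cchi k : Cn k chi.
  apply: Cn_eq (Cn_add (Cn_cst k 1) (Cn_mul (Cn_cst k (-1)) (Ceta k))) => x.
  by rewrite /chi mulN1r.
have chi01 x : 0 <= chi x <= 1.
  by have /andP[h0 h1] := eta01 x; rewrite /chi; apply/andP; split; lra.
have meta : measurable_fun setT eta by exact: continuous_measurable_rV (Ceta 0).
have mchi : measurable_fun setT chi by exact: continuous_measurable_rV (Cchi 0).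
have ta : (t * a)^-1 = (C1 + 1) / d.
  by rewrite /d /a [(t * _)^-1]invfM [(t / 3)^-1]invfM !invrK; ring.
have chil x y : `|chi x - chi y| <= `|x - y| / (t * a).
  rewrite (_ : chi x - chi y = - (eta x - eta y)); last by rewrite /chi; ring.
  rewrite normrN; apply: le_trans (etal x y) _; rewrite mulrC ler_wpM2l//.
  by rewrite ta ler_wpM2r ?invr_ge0 ?(ltW d0)// lerDl.
have [C2 C20 HC2] := @Hsq_mult_lip R n s s0 s1 _ (mulr_gt0 t0 a0).
(* [C2] depends on the scale, so [f] is chosen only now; multiplication by [chi] leaves an error of
   at most e/8. *)
have e5 : 0 < e / (8 * (C2 + 1)) by rewrite divr_gt0// mulr_gt0// ltr_wpDl.
have [f Cf wf] := Hs_tilde_approx Tw e5.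
have mf := Cc_infty_meas Cf; have Hf := Cc_infty_Hs Hw Cf wf.
have md : measurable_fun setT (fun x => w x - f x) by exact: measurable_funB.
have near_1 x : Om x -> nbhd E d x -> eta x = 1.
  move=> Ox [z Ez xz]; apply: eta1 => [|y xy]; first exact: Omr.
  exists z => //; rewrite -(subrKA x y); apply: le_lt_trans (ler_normD _ _) _.
  rewrite (_ : 2 * d = d + d); last by ring.
  by apply: ltrD => //; rewrite distrC.
exists (fun x => chi x * f x); first apply: Cc_infty_mul d0 Cchi _ Cf.
  move=> x Ox cx nx; move: cx; rewrite /chi (near_1 x Ox nx) subrr eqxx//.
split.
  apply/HsE; split; first exact: measurable_funM.
  apply: le_lt_trans (HC2 chi f mchi mf chi01 chil) _.
  by rewrite -(fineK (Hsq_fin Hf)) -EFinM ltry.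
pose psi x := \1_(~` closure E) x * eta x.
have mpsi : measurable_fun setT psi by exact: measurable_funM.
(* On cl [E] the identity holds because [chi] vanishes inside [Om], while [w] and [f] both vanish
   outside [Om]; hence the pointwise hypothesis [w_out]. *)
have -> : (fun x => \1_(~` closure E) x * w x - chi x * f x) =
    (fun x => psi x * w x + chi x * (w x - f x)).
  apply/funext => x; rewrite /psi /chi.
  have [cx|ncx] := pselect (closure E x); last first.
    by rewrite indicE mem_set// mulr1n; ring.
  rewrite indicE memNset ?mulr0n; last by move=> h; exact: h cx.
  have [Ox|nOx] := pselect (Om x).
    by rewrite (near_1 x Ox (closure_nbhd d0 cx)); ring.
  by rewrite (w_out nOx) (Cc_infty_out Cf nOx); ring.
have mpw : measurable_fun setT (fun x => psi x * w x) by exact: measurable_funM.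
have mcd : measurable_fun setT (fun x => chi x * (w x - f x)) by exact: measurable_funM.
apply: le_lt_trans (Hsq_add s mpw mcd) _.
have h1 : (Hsq s (fun x => psi x * w x)%R <= (e / 4)%:E)%E.
  apply: Hj => //.
  - move=> x; rewrite /psi; have /andP[h0 h1] := eta01 x.
    by have [->|[-> _]] := indic01 (~` closure E) x; rewrite ?mul0r ?mul1r ?lexx ?ler01 ?h0.
  - move=> x; rewrite /psi; have [->|[-> ncx]] := indic01 (~` closure E) x.
      by rewrite mul0r eqxx.
    rewrite mul1r => /etaD [y [z Ez yz] xy]; split => //; exists z => //.
    rewrite -(subrKA y x); apply: le_lt_trans (ler_normD _ _) _.
    have -> : L ^- j = d + 2 * d by rewrite -/t /d; field.
    exact: ltrD.
  - move=> x y nx ny; rewrite /psi !indicE !mem_set// !mul1r.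
    have := chil x y; rewrite (_ : chi x - chi y = - (eta x - eta y)) ?normrN//.
    by rewrite /chi; ring.
have h2 : (Hsq s (fun x => chi x * (w x - f x))%R <= (e / 8)%:E)%E.
  apply: le_trans (HC2 chi _ mchi md chi01 chil) _.
  apply: (@le_trans _ _ (C2%:E * (e / (8 * (C2 + 1)))%:E)%E).
    by apply: lee_wpmul2l; [rewrite lee_fin|exact: ltW].
  rewrite -EFinM lee_fin mulrA ler_pdivrMr; last by rewrite mulr_gt0// ltr_wpDl.
  rewrite (_ : e / 8 * (8 * (C2 + 1)) = C2 * e + e); last by field.
  by rewrite lerDl ltW.
apply: (@le_lt_trans _ _ (2%:E * ((e / 4)%:E + (e / 8)%:E))%E).
  by apply: lee_wpmul2l; [rewrite lee_fin|exact: leeD].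
by rewrite -EFinD -EFinM lte_fin; lra.
Qed.

End cutoff.

(** * Support properties and density arguments for the form *)

Section testing.
Context {R : realType} {n : nat} (s : R).
Local Notation rV := 'rV[R]_n.
Local Notation mu := (@lebesgue_rV R n).
Variables (Gam Om : set rV) (q : rV -> R).
Hypothesis mGam : measurable Gam.
Hypothesis qL : q \_ Om \in Lfun (lebesgue_rV n) +oo%E.
Local Notation B := (B_form s Gam Om q).
Implicit Types u v z : rV -> R.

(* [u] lives on a set [T] stable under [- Gam] on which [v] vanishes: each of
   the four products in the double integral is zero *)
Lemma B_form_separated (T : set rV) u v : (forall x, u x != 0 -> T x) ->
  (forall x, T x -> v x = 0) -> (forall x y, T x -> Gam y -> T (x - y)) ->
  B u v = 0.
Proof.
move=> uT Tv TG; have uv x y : (T x -> T y) -> u x * v y = 0.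
  move=> xy; have [->|/uT /xy /Tv ->] := eqVneq (u x) 0; last exact: mulr0.
  exact: mul0r.
have pt x y : Gam y -> (u x - u (x + y)) * (v x - v (x - y)) = 0.
  move=> Gy; have back x1 : T (x1 + y) -> T x1 by move=> Tz; have := TG _ _ Tz Gy; rewrite addrK.
  rewrite mulrBl !mulrBr (uv x x id) (uv x (x - y)) => [|Tx]; last exact: TG.
  rewrite (uv (x + y) x (back x)) (uv (x + y) (x - y)) ?subrr// => /back Tx.
  exact: TG.
have R0 (D : set rV) (F : rV -> R) : (forall x, D x -> F x = 0) ->
    \int[mu]_(x in D) F x = 0.
  by move=> F0; rewrite /Rintegral integral0_eq// => x Dx; rewrite F0.
rewrite /B_form R0; last first.
  by move=> x _; apply: R0 => y Gy; rewrite pt// mul0r.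
by rewrite mulr0 add0r; apply: R0 => x _; rewrite -mulrA uv ?mulr0.
Qed.

Lemma B_form_ae0 z v : Hs s z -> Hs s v -> ae_eq_on setT z (cst 0) -> B z v = 0.
Proof.
move=> Hz Hv z0; have [C C0 HC] := B_form_bound s mGam qL.
have := HC z v Hz Hv; rewrite (Hsq_ae0 s (Hs_meas Hz) z0) sqrtr0 mulr0 mul0r.
by rewrite normr_le0 => /eqP.
Qed.

Lemma B_form_aeq u u' v : Hs s u -> Hs s u' -> Hs s v -> ae_eq_on setT u u' ->
  B u v = B u' v.
Proof.
move=> Hu Hu' Hv uu'; have Hd := Hs_lin (-1) Hu' Hu.
have -> : u = (fun x => 1 * (-1 * u' x + u x) + u' x) by apply/funext => x; ring.
rewrite (B_form_linl mGam qL 1 Hd Hu' Hv) B_form_ae0 ?mulr0 ?add0r//.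
by apply: filterS uu' => x /= h _; rewrite h// mulN1r addNr.
Qed.

(** Continuity of the form reduces to test functions. Those used approximate an element of [Hs] in
    norm, and this alone puts them in [Hs]. *)
Lemma B_form_dense (V : set rV) z v : Hs s z ->
  (forall f, Cc_infty V f -> Hs s f -> B z f = 0) -> Hs_tilde s V v -> B z v = 0.
Proof.
move=> Hz z0 Tv; have [C C0 HC] := B_form_bound s mGam qL.
have Hv := Tv.1; apply/eqP; rewrite -normr_le0; apply/ler_addgt0Pr => e e0; rewrite add0r.
set b := C * Num.sqrt (fine (Hsq s z)).
have b0 : 0 <= b by rewrite mulr_ge0// sqrtr_ge0.
have d0 : 0 < e / (b + 1) by rewrite divr_gt0// ltr_wpDl.
have [f Cf vf] := Hs_tilde_approx Tv (exprn_gt0 2 d0).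
have Hf := Cc_infty_Hs Hv Cf vf.
have Hd : Hs s (fun x => v x - f x).
  have := Hs_lin (-1) Hf Hv; congr (Hs s _); apply/funext => x; ring.
have -> : v = (fun x => 1 * (v x - f x) + f x) by apply/funext => x; ring.
rewrite (B_form_linr mGam qL 1 Hz Hd Hf) (z0 f Cf Hf) addr0 mul1r.
apply: le_trans (HC _ _ Hz Hd) _; rewrite -/b.
apply: (@le_trans _ _ (b * (e / (b + 1)))).
  rewrite ler_wpM2l// -[leRHS]gtr0_norm// -sqrtr_sqr ler_sqrt ?sqr_ge0//.
  by rewrite -lee_fin (fineK (Hsq_fin Hd)) ltW.
rewrite mulrA ler_pdivrMr; last by rewrite ltr_wpDl.
by rewrite mulrDr mulr1 mulrC lerDl ltW.
Qed.

Lemma Cc_infty_Hs_tilde (V : set rV) f : Cc_infty V f -> Hs s f -> Hs_tilde s V f.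
Proof.
move=> Cf Hf; apply: Hs_tildeI => // e e0; exists f => //.
rewrite (_ : (fun x => _) = (cst 0)); last by apply/funext => x; rewrite subrr.
by rewrite Hsq_ae0 ?lte_fin//; exact: aeW.
Qed.

Lemma B_form_Hs_dual f : Hs s f -> Hs_dual s Om (fun v => - B f v).
Proof.
move=> Hf; have [C C0 HC] := B_form_bound s mGam qL; split.
  move=> a v w [Hv _] [Hw _]; rewrite (B_form_linr mGam qL a Hf Hv Hw); ring.
exists (C * Num.sqrt (fine (Hsq s f))) => v [Hv _].
rewrite normrN Hs_normE -(fineK (Hsq_fin Hv)) poweR_EFin powR12_sqrt ?fine_ge0 ?Hsq_ge0//.
by rewrite -EFinM lee_fin HC.
Qed.

End testing.

(** * A compactly supported Lipschitz function *)

Section tent.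
Context {R : realType} {n : nat} (s : R).
Hypotheses (s0 : 0 < s) (s1 : s < 1).
Local Notation rV := 'rV[R]_n.
Local Notation k := (@rker R n s).

(** An increment vanishes unless one of its two points is in the ball. By symmetry the seminorm is
    at most twice an integral over that ball, with the inner integral of [cut_ker] uniformly
    bounded. *)
Lemma Hs_tent (x0 : rV) (r : R) : 0 < r -> exists f : rV -> R,
  [/\ Hs s f, forall x, f x != 0 -> ball x0 r x & forall x, ball x0 r x -> 0 < f x].
Proof.
move=> r0; pose f x := Num.max 0 (1 - `|x - x0| / r).
have f01 x : 0 <= f x <= 1.
  by rewrite le_max lexx/= ge_max ler01 gerBl mulr_ge0// invr_ge0 ltW.
have fl x y : `|f x - f y| <= `|x - y| / r.
  apply: (@le_trans _ _ `|(1 - `|x - x0| / r) - (1 - `|y - x0| / r)|).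
    rewrite /f; move: (1 - _) (1 - _) => b a.
    by rewrite /Num.max; case: (ltP 0 a); case: (ltP 0 b) => ? ?; rewrite ler_norml;
      apply/andP; split; have := ler_norm (a - b); have := ler_norm (- (a - b)); rewrite normrN; lra.
  rewrite (_ : _ - _ = (`|y - x0| - `|x - x0|) / r); last by ring.
  rewrite normrM [`|r^-1|]gtr0_norm ?invr_gt0// ler_wpM2r ?invr_ge0 ?(ltW r0)//.
  apply: le_trans (ler_dist_dist _ _) _.
  by rewrite opprB addrA subrK distrC.
have fB x : (0 < f x) = (`|x0 - x| < r).
  by rewrite /f lt_max ltxx/= subr_gt0 ltr_pdivrMr// mul1r distrC.
exists f; split; last 2 first.
- move=> x fx; rewrite -ball_normE/= -fB lt_neqAle eq_sym fx.
  by have /andP[] := f01 x.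
- by move=> x; rewrite -ball_normE/= -fB.
have mB : measurable_fun setT (\1_(ball x0 r) : rV -> R).
  by apply: measurable_indic; exact: measurable_ball_rV.
have mf : measurable_fun setT f.
  apply: measurable_maxr; first exact: measurable_cst.
  apply: measurable_funB; first exact: measurable_cst.
  apply: measurable_funM; last exact: measurable_cst.
  apply: (measurableT_comp (continuous_measurable_rV (@continuous_norm_rV R n))).
  apply: measurable_fun_subr; [exact: measurable_id|exact: measurable_cst].
have f_out x : ~ ball x0 r x -> f x = 0.
  move=> nb; apply/eqP; rewrite eq_le; have /andP[-> _] := f01 x; rewrite andbT leNgt fB.
  by apply/negP; move: nb; rewrite -ball_normE.
have [C C0 HC] := @int_cut_ker R n s s0 s1.
have IB := int_indic_ball x0 r0.
apply/HsE; split => //; rewrite /Hsq; apply: lte_add_pinfty.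
  apply: le_lt_trans (ltry ((r *+ 2) ^+ n)); rewrite -IB L2sqE; apply: nnint_le => //.
  - exact: measurable_sqr.
  - by move=> x; exact: sqr_ge0.
  - move=> x; have [b|/f_out ->] := pselect (ball x0 r x); last by rewrite expr0n indic_ge0'.
    by rewrite indicE mem_set//; have /andP[? ?] := f01 x; rewrite expr_le1.
pose F x y := \1_(ball x0 r) x * cut_ker s r (x - y).
have mK : measurable2 (fun x y : rV => cut_ker s r (x - y)).
  exact: measurable2_sub (measurable_cut_ker s r).
have mF : measurable2 F by apply: measurable2M mK; exact: measurable2_1 mB.
have F0 x y : 0 <= F x y by rewrite mulr_ge0 ?cut_ker_ge0// indic_ge0'.
apply: (@le_lt_trans _ _ (2%:E * dint F)%E).
  rewrite -(dint_sym mF F0) gagliardoE; apply: dint_le.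
  - exact: measurable_gag.
  - exact: measurable2D mF (measurable2_swap mF).
  - by move=> x y; nonneg.
  have pt x y : ball x0 r x -> (f x - f y) ^+ 2 * k (x - y) <= F x y.
    by move=> b; rewrite /F indicE mem_set// mul1r; exact: cut_ker_dist.
  move=> x y; have [b|nb] := pselect (ball x0 r x).
    by apply: le_trans (pt x y b) _; rewrite lerDl.
  have [b|nb'] := pselect (ball x0 r y).
    have -> : (f x - f y) ^+ 2 = (f y - f x) ^+ 2 by ring.
    by rewrite -rkerN opprB; apply: le_trans (pt y x b) _; rewrite lerDr.
  by rewrite (f_out x nb) (f_out y nb') subrr expr0n mul0r addr_ge0.
apply: le_lt_trans (ltry (2 * (C * r `^ (- (2 * s)) * (r *+ 2) ^+ n))).
rewrite EFinM; apply: lee_wpmul2l; first by rewrite lee_fin.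
rewrite [leRHS]EFinM -IB; apply: (dint_weight_le mB mK).
- by move=> x; exact: indic_ge0'.
- by move=> x y; exact: cut_ker_ge0.
- by rewrite mulr_ge0// powR_ge0.
- by move=> x; exact: HC.
Qed.

End tent.

(** * Open convex cones and Minkowski sums *)

Section cones.
Context {R : realType} {n : nat}.
Local Notation rV := 'rV[R]_n.
Implicit Types A W Gam : set rV.

Lemma convex_cone_add Gam : cone Gam ->
  convex_set (Gam : set (convex_lmodType 'rV[R]_n)) ->
  forall x y, Gam x -> Gam y -> Gam (x + y).
Proof.
move=> cG vG x y Gx Gy.
have h01 : 0 <= (2^-1 : R) <= 1 by rewrite invr_ge0 ler0n invf_le1// ler1n.
have := @vG x y (Itv01 (andP h01).1 (andP h01).2); rewrite !inE => /(_ Gx Gy) => h.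
have -> : x + y = 2 *: (2^-1 *: x + (1 - 2^-1) *: y).
  by apply/rowP => l; rewrite !mxE; field.
exact: cG.
Qed.

Lemma mink_add_open A Gam : open Gam -> open (mink_add A Gam).
Proof.
move=> oG; rewrite openE => z [x Ax [y Gy <-]].
have /nbhs_ballP[e e0 He] : nbhs y Gam by exact: open_nbhs_nbhs.
apply/nbhs_ballP; exists e => // z'; rewrite -ball_normE/= => zz'.
exists x => //; exists (z' - x); last by rewrite addrC subrK.
by apply: He; rewrite -ball_normE/= opprB addrA [y + x]addrC.
Qed.

Lemma mink_addC A Gam : mink_add A Gam = mink_add Gam A.
Proof.
by apply/seteqP; split => _ [x Ax [y Gy <-]]; exists y => //; exists x => //; rewrite addrC.
Qed.

(** Replace [x] by a nearby [z] in the difference set; since [Gam] is open, [y - (x - z)] is still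
    in [Gam] and absorbs the error. *)
Lemma closure_mink_sub W Gam : open Gam -> (forall x y, Gam x -> Gam y -> Gam (x + y)) ->
  forall x y, closure (mink_sub W Gam) x -> Gam y -> mink_sub W Gam (x - y).
Proof.
move=> oG GG x y cx Gy.
have /nbhs_ballP[e e0 He] : nbhs y Gam by exact: open_nbhs_nbhs.
have [z [[a Wa [g Gg zE]]]] := cx _ (nbhsx_ballx x _ e0).
rewrite -ball_normE/= => xz; exists a => //; exists (g + (y - (x - z))).
  apply: GG => //; apply: He; rewrite -ball_normE/=.
  by rewrite subKr.
by rewrite -zE; apply/rowP => l; rewrite !mxE; ring.
Qed.

Lemma cone_ball Gam : open Gam -> Gam !=set0 -> ~ Gam 0 -> cone Gam ->
  exists2 e0 : rV, ball e0 1 `<=` Gam & 2 <= `|e0|.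
Proof.
move=> oG [g Gg] G0 cG.
have /nbhs_ballP[e /= e0 He] : nbhs g Gam by exact: open_nbhs_nbhs.
have g0 : 0 < `|g| by rewrite normr_gt0; apply/eqP => gz; apply: G0; rewrite -gz.
(* The first summand enlarges the ball around [g] to radius at least 1, the second brings its centre
   to norm at least 2. *)
pose c := e^-1 + 2 / `|g|.
have c0 : 0 < c by rewrite addr_gt0 ?divr_gt0 ?invr_gt0.
exists (c *: g) => [y|]; last first.
  rewrite normrZ (gtr0_norm c0) /c mulrDl divfK ?gt_eqF// lerDr.
  by rewrite mulr_ge0// invr_ge0 ltW.
rewrite -ball_normE/= => gy; have -> : y = c *: (c^-1 *: y).
  by rewrite scalerA divff ?gt_eqF// scale1r.
apply: cG => //; apply: He; rewrite -ball_normE/=.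
have -> : g - c^-1 *: y = c^-1 *: (c *: g - y).
  by rewrite scalerBr scalerA mulVf ?gt_eqF// scale1r.
rewrite normrZ gtr0_norm ?invr_gt0//; apply: (@lt_le_trans _ _ c^-1).
  by rewrite gtr_pMr ?invr_gt0.
rewrite -[leRHS]invrK lef_pV2 ?posrE ?invr_gt0// /c lerDl.
by rewrite divr_ge0.
Qed.

Lemma closure_setI_open A B (Om : set rV) x : open Om -> B = Om `&` A -> Om x ->
  closure A x -> closure B x.
Proof.
move=> oO -> Ox cx U nU.
have [y [Ay [Uy Oy]]] := cx _ (filterI nU (open_nbhs_nbhs (conj oO Ox))).
by exists y.
Qed.

(** A cone contains arbitrarily short vectors, and an open set allows a short step backwards. *)
Lemma subset_mink_add A Gam : open A -> Gam !=set0 -> cone Gam -> A `<=` mink_add A Gam.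
Proof.
move=> oA [g Gg] cG x Ax.
have /nbhs_ballP[e /= e0 He] : nbhs x A by exact: open_nbhs_nbhs.
have c0 : 0 < e / (`|g| + 1) by rewrite divr_gt0// ltr_wpDl.
exists (x - (e / (`|g| + 1)) *: g); last first.
  by exists ((e / (`|g| + 1)) *: g); [exact: cG|rewrite subrK].
apply: He; rewrite -ball_normE/= opprB addrC subrK normrZ gtr0_norm//.
rewrite -mulrA gtr_pMr// mulrC ltr_pdivrMr ?ltr_wpDl//.
by rewrite mul1r ltrDl.
Qed.

End cones.

(** * Construction of the solution *)

Theorem lemma5p25 (R : realType) (n : nat) (s : R)
    (Gam Om W : set 'rV[R]_n) (q : 'rV[R]_n -> R)
    (Om1 := Om `&` mink_sub W Gam) (Om2 := Om `\` closure Om1) :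
  0 < s < 2^-1 ->
  open Gam -> Gam !=set0 -> ~ Gam 0 ->
  cone Gam -> convex_set (Gam : set (convex_lmodType 'rV[R]_n)) ->
  antilocal s Gam ->
  bounded_set Om -> open Om -> lipschitz_domain Om ->
  q \_ Om \in Lfun (lebesgue_rV n) +oo%E ->
  zero_notin_spectrum s Gam Om q ->
  open W -> W !=set0 -> W `<=` mink_add Om Gam `\` closure Om ->
  Om2 !=set0 ->
  zero_not_dirichlet_eigenvalue s Gam Om q Om2 ->
  exists (U : set 'rV[R]_n) (u : 'rV[R]_n -> R),
    [/\ open U, U !=set0, U `<=` Om & Hs_on s (mink_add Gam Om) u] /\
    [/\ ~ ae_eq_on (mink_add Gam Om) u (cst 0),
        weak_solution s Gam Om q u &
        ae_eq_on U u (cst 0)].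
Proof.
move=> /andP[s0 s12] oG Gn0 G0 cG vG _ bOm oO _ qL spec oW [x0 Wx0] WO Om2n0 eig.
have s1 : s < 1 by apply: lt_trans s12 _; rewrite invf_lt1// ltr1n.
pose E := mink_sub W Gam.
have GG := convex_cone_add cG vG; have EG := closure_mink_sub oG GG (W := W).
have [e0 ballG e02] := cone_ball oG Gn0 G0 cG.
have mG : measurable Gam by exact: open_measurable_rV.
have mO : measurable Om by exact: open_measurable_rV.
have mcE : measurable (closure E).
  by apply: closed_measurable_rV; exact: closed_closure.
(* Inside the open set [Om] the closures of [Om1] and of [E] have the same points, so the boundary
   of [Om] does not interfere. *)
have Om2E : Om2 = Om `\` closure E.
  apply/seteqP; split => x [Ox nx]; split => //; apply: contra_not nx.
    exact: (@closure_setI_open _ _ E _ Om).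
  by apply: closure_subset => y [].
have oOm2 : open Om2.
  by apply: openI => //; apply: closed_openC; exact: closed_closure.
have WnO x : W x -> ~ Om x.
  by move=> /WO[_ nO] /subset_closure.
have OmO2 : Om2 `<=` Om by move=> x [].
have CcO2 f : Cc_infty Om2 f -> Cc_infty Om f.
  by move=> [Cf cf fO]; split => //; exact: subset_trans OmO2.
have [r Hr] : exists r : R, forall x, Om x -> `|x| <= r.
  by have [M [Mr HM]] := bOm; exists (M + 1) => x Ox;
    exact: (HM (M + 1) (ltr_pwDr ltr01 (lexx M)) x Ox).
have sep u v : (forall x, u x != 0 -> (W `|` closure E) x) -> Cc_infty Om2 v ->
    B_form s Gam Om q u v = 0.
  move=> uT Cv; apply: (B_form_separated s Om q uT) => [x Tx|x y Tx Gy].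
    apply: (Cc_infty_out Cv); rewrite Om2E => -[Ox nx].
    by case: Tx => // /WnO.
  right; apply: subset_closure; case: Tx => [Wx|/EG]; last exact.
  by exists x => //; exists y.
have [d d0 Hd] : exists2 d : R, 0 < d & ball x0 d `<=` W.
  by have /nbhs_ballP[d /= d0 Hd] : nbhs x0 W by [exact: open_nbhs_nbhs]; exists d.
have [f [Hf fB f_gt0]] := Hs_tent s0 s1 x0 d0.
have fW x : f x != 0 -> W x by move=> /fB /Hd.
have [w0 [Tw0 Bw0 _]] := spec _ (B_form_Hs_dual mG qL Hf).
(* A representative vanishing at every point outside [Om], as the truncation result requires. *)
pose w x := \1_Om x * w0 x.
have mw : measurable_fun setT w.
  by apply: measurable_funM (Hs_meas Tw0.1); exact: measurable_indic.
have w0w := Hs_tilde_out oO Tw0.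
have Tw : Hs_tilde s Om w := Hs_tilde_ae_eq Tw0 mw w0w.
have Hw := Tw.1.
have w_out x : ~ Om x -> w x = 0 by move=> nO; rewrite /w indicE memNset// mul0r.
have Bw v : Hs_tilde s Om v -> B_form s Gam Om q w v = - B_form s Gam Om q f v.
  by move=> Tv; rewrite -Bw0// (B_form_aeq mG qL Tw0.1 Hw Tv.1 w0w).
pose z x := \1_(~` closure E) x * w x.
have Tz : Hs_tilde s Om2 z.
  by rewrite Om2E; exact: (Hs_tilde_cutoff s0 s12 cG ballG EG e02 Hr Tw w_out).
have Hz := Tz.1.
have z_ae0 : ae_eq_on setT z (cst 0).
  apply: eig Tz _ => v; apply: (B_form_dense mG qL Hz) => g Cg Hg.
  have Hwz := Hs_lin (-1) Hz Hw.
  (* Here z = w - (w - z): the difference lives on cl [E], where [sep] applies, and w is tested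
     through its equation, whose right-hand side vanishes by [sep] for [f]. *)
  have -> : z = (fun x => -1 * (-1 * z x + w x) + w x) by apply/funext => x; ring.
  rewrite (B_form_linl mG qL (-1) Hwz Hw Hg) sep//.
    rewrite mulr0 add0r (Bw _ (Cc_infty_Hs_tilde (CcO2 _ Cg) Hg)).
    by rewrite (sep f g)// ?oppr0// => x /fW; left.
  move=> x; rewrite /z; have [cx _|ncx] := pselect (closure E x); first by right.
  by rewrite indicE mem_set// mulr1n mul1r mulN1r addNr eqxx.
pose u x := 1 * w x + f x.
have Hu : Hs s u := Hs_lin 1 Hw Hf.
exists Om2, u; split; first by split => //; exists u => //; exact: aeW.
have [N [mN N0 zN]] := z_ae0.
split.
(* On the ball around [x0], which lies in [W], [u] equals the positive tent; if [u] were trivial, a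
   ball of positive measure would be null. *)
- move=> [M [mM M0 uM]]; have := lebesgue_rV_ball x0 d0.
  rewrite (@subset_measure0 _ _ _ (lebesgue_rV n) _ M)//; last 2 first.
  + exact: measurable_ball_rV.
  + move=> x bx; apply: uM => /= h; have Wx := Hd _ bx.
    have [OGx _] := WO _ Wx; rewrite mink_addC in OGx.
    have := h OGx; rewrite /u w_out ?mulr0 ?add0r => [fx|]; last exact: WnO.
    by have := f_gt0 _ bx; rewrite fx ltxx.
  + by move=> /esym /eqP; rewrite eqe gt_eqF// exprn_gt0// mulrn_wgt0.
(* Any extension differs from [u] by a function that, up to a null set, lives off [Om + Gam]. That
   complement is stable under subtraction of [Gam] and misses [Om], so the form does not see the
   difference. *)
- move=> ut Hut uut v Tv.
  pose V := mink_add Om Gam.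
  have mV : measurable V by apply: open_measurable_rV; exact: mink_add_open.
  have Hd' := Hs_lin (-1) Hu Hut.
  pose y x := \1_(~` V) x * (-1 * u x + ut x).
  have yae : ae_eq_on setT (fun x => -1 * u x + ut x) y.
    apply: filterS uut => x /= h _; rewrite /y.
    have [Vx|nV] := pselect (V x); last by rewrite indicE mem_set// mul1r.
    by rewrite h// mulN1r addNr mulr0.
  have Hy : Hs s y.
    apply: (Hs_ae_eq Hd' _ yae); apply: measurable_funM (Hs_meas Hd').
    by apply: measurable_indic; exact: measurableC.
  have -> : ut = (fun x => 1 * (-1 * u x + ut x) + u x) by apply/funext => x; ring.
  rewrite (B_form_linl mG qL 1 Hd' Hu Tv.1) (B_form_aeq mG qL Hd' Hy Tv.1 yae).
  rewrite (B_form_linl mG qL 1 Hw Hf Tv.1) (Bw _ Tv) !mul1r addNr addr0.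
  apply: (B_form_dense mG qL Hy) Tv => g Cg _.
  apply: (@B_form_separated _ _ _ _ _ _ (~` V)).
  + by move=> x; rewrite /y; have [->|[_ //]] := indic01 (~` V) x; rewrite mul0r eqxx.
  + move=> x nV; apply: (Cc_infty_out Cg); apply: contra_not nV.
    exact: subset_mink_add.
  + move=> x t nV Gt; apply: contra_not nV => -[a Oa [g' Gg' E']].
    exists a => //; exists (g' + t); first exact: GG.
    by rewrite addrA E' subrK.
(* On [Om2] the truncation is [w] itself, and [f] vanishes because [W] misses [Om]. *)
- exists N; split => // x /= h; apply: zN => /= zx; apply: h => O2x; have := zx I.
  have := O2x; rewrite Om2E => -[Ox nx].
  rewrite /z indicE mem_set// mul1r /u => ->.
  rewrite mulr0 add0r; apply: contrapT => /eqP /fW /WnO; exact.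
Qed.
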